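(* Let $P_3$ be the pure braid group on three strands, let $R\subset P_3$ be the normal subgroup generated by $r_1=\sigma_1\sigma_2^2\sigma_1$, $r_2=\sigma_1^2\sigma_2^2$, $r_3=\sigma_2\sigma_1^2\sigma_2$, and consider the map $\pi_1(SO(3))\to P_3/R$ which sends the homotopy class of a closed path in $SO(3)$ based at the identity to the class modulo $R$ of the pure braid obtained by stereographic projection of the associated spherical braid (this map is defined in detail in the context). Then the map $\pi_1(SO(3))\to P_3/R$ is a monomorphism.
   Context: Braid groups: $B_3=\langle \sigma_1,\sigma_2 \mid \sigma_2\sigma_1\sigma_2=\sigma_1\sigma_2\sigma_1\rangle$ is the group of isotopy classes of geometric braids with three strands in $\mathbb{R}^3$: three disjoint continuous strands joining three fixed points of a lower horizontal plane to the points in the same positions of an upper horizontal plane, each strand having monotonic $z$-coordinate. Multiplication is stacking; an isotopy is a homotopy of the strands through braids keeping endpoints fixed. The generator $\sigma_1$ (resp. $\sigma_2$) twists the first and second (resp. second and third) strands, the one to the left passing behind the one to the right. $P_3\subset B_3$ is the subgroup of pure braids, i.e. those in which every strand joins a point of the lower plane to its translate in the upper plane (equivalently, the kernel of the natural homomorphism $B_3\to S_3$). The subgroup $R$ generated by $r_1,r_2,r_3$ is normal in $B_3$. Spherical braid of a path: let $\omega:[0,1]\to SO(3)$ be continuous with $\omega(0)=\omega(1)=I$. Put $\mathbf{x}_0^1=(1,0,0)$, $\mathbf{x}_0^2=(-1/2,\sqrt3/2,0)$, $\mathbf{x}_0^3=(-1/2,-\sqrt3/2,0)$ and $$\mathbf{x}^i(t):=(1-t/2)\,\omega(t)(\mathbf{x}_0^i),\qquad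 t\in[0,1],\ i=1,2,3.$$ These are three disjoint strands joining the sphere of radius $1$ to the sphere of radius $1/2$ centred at the origin, and for each fixed $t$ the three points lie on the sphere of radius $1-t/2$. They form the spherical braid associated with $\omega$. Stereographic projection: choose a ray from the origin that meets none of the strands (the representative $\omega$ being chosen in its homotopy class so that such a ray exists; the ray may be taken through the north pole or a point very close to it). For each $\rho\in[1/2,1]$ project the sphere of radius $\rho$, minus the point where the ray meets it, stereographically from that point to a horizontal plane, and give the image points $z$-coordinate $z=-\rho$. The images of the three strands form a pure braid with three strands, hence define an element of $P_3$ (after the standard identification of the three base points in the plane with the standard ones). The class of this element in $P_3/R$ does not depend on the choice of ray, and homotopic closed paths in $SO(3)$ give the same class, so a map $\pi_1(SO(3))\to P_3/R$ is obtained. *)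

(* Defs.v *)
From HB Require Import structures.
From mathcomp Require Import all_boot all_order all_algebra all_fingroup.
From mathcomp Require Import generic_quotient.
From mathcomp Require Import all_classical all_reals topology.
From mathcomp Require Import normedtype homotopy.
From mathcomp Require Import ring lra.

Set Implicit Arguments.
Unset Strict Implicit.
Unset Printing Implicit Defensive.

Import Order.TTheory GRing.Theory Num.Theory.
Import numFieldNormedType.Exports.

Local Open Scope classical_set_scope.
Local Open Scope ring_scope.
Local Open Scope quotient_scope.

Definition unitI (R : realType) : Type := set_type `[0%R : R, 1%R]%classic.

HB.instance Definition _ (R : realType) :=
  Topological.copy (unitI R) (set_type `[0%R : R, 1%R]%classic).

Section UnitInterval.
Context {R : realType}.

Definition ival (s : unitI R) : R := \val s.

Lemma ival_ge0 (s : unitI R) : 0 <= ival s.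
Proof. by have /set_mem := valP s; rewrite /= in_itv /= => /andP[]. Qed.

Lemma ival_le1 (s : unitI R) : ival s <= 1.
Proof. by have /set_mem := valP s; rewrite /= in_itv /= => /andP[]. Qed.

Lemma ival_inj : injective ival. Proof. exact: val_inj. Qed.

Lemma clamp_subproof (x : R) :
  Num.max 0 (Num.min x 1) \in `[0%R : R, 1%R]%classic.
Proof.
apply/mem_set; rewrite /= in_itv /= le_max lexx /=.
by rewrite ge_max ler01 ge_min lexx orbT.
Qed.

Definition clamp (x : R) : unitI R := 
  @exist R (fun y => y \in `[0%R : R, 1%R]%classic) _ (clamp_subproof x).

Lemma clampE x : ival (clamp x) = Num.max 0 (Num.min x 1).
Proof. by []. Qed.

Lemma clampK x : 0 <= x <= 1 -> ival (clamp x) = x.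
Proof. by move=> /andP[x0 x1]; rewrite clampE min_l // max_r. Qed.

Lemma ivalK : cancel ival clamp.
Proof. by move=> s; apply: ival_inj; rewrite clampK // ival_ge0 ival_le1. Qed.

Lemma unitI_zero_neq_one : clamp 0 != clamp 1.
Proof.
apply/eqP => /(congr1 ival).
by rewrite !clampK ?lexx ?ler01 // => /eqP; rewrite eq_sym oner_eq0.
Qed.

End UnitInterval.

HB.instance Definition _ (R : realType) :=
  isBiPointed.Build (unitI R) unitI_zero_neq_one.

Section UnitIntervalTopology.
Context {R : realType}.

Lemma continuous_ival : continuous (@ival R).
Proof. exact: initial_continuous. Qed.

Lemma continuous_clamp_comp (U : topologicalType) (f : U -> R) :
  continuous f -> continuous (clamp \o f).
Proof.
move=> cf; apply: continuous_comp_initial => u.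
apply: (@continuous_max R U (fun=> 0) (fun v => Num.min (f v) 1)).
  exact: cst_continuous.
by apply: (@continuous_min R U f (fun=> 1)); [exact: cf | exact: cst_continuous].
Qed.

Lemma ival0 : ival (zero : unitI R) = 0.
Proof. by rewrite clampK // lexx ler01. Qed.

Lemma ival1 : ival (one : unitI R) = 1.
Proof. by rewrite clampK // lexx ler01. Qed.

Lemma clamp_le0 (x : R) : x <= 0 -> clamp x = zero.
Proof.
move=> x0; apply: ival_inj; rewrite ival0 clampE min_l ?max_l //.
exact: le_trans x0 ler01.
Qed.

Lemma clamp_ge1 (x : R) : 1 <= x -> clamp x = one.
Proof.
by move=> x1; apply: ival_inj; rewrite ival1 clampE min_r // max_r.
Qed.

Lemma continuous_paste (U T : topologicalType) (f : U -> R) (c : R)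
    (a b : U -> T) :
  continuous f -> continuous a -> continuous b ->
  (forall u, f u = c -> a u = b u) ->
  continuous (fun u => if f u <= c then a u else b u).
Proof.
move=> cf ca cb ab.
pose g u := if f u <= c then a u else b u.
rewrite -/g.
have cA : closed [set u | f u <= c].
  by apply: (@preimage_closed _ _ f [set x | x <= c]); [by move=> u _; exact: cf|exact: closed_le].
have cB : closed [set u | c <= f u].
  by apply: (@preimage_closed _ _ f [set x | c <= x]); [by move=> u _; exact: cf|exact: closed_ge].
apply/continuous_subspace_setT.
have -> : [set: U] = [set u | f u <= c] `|` [set u | c <= f u].
  by apply/seteqP; split=> u // _; case: (lerP (f u) c) => h; [left | right => /=; exact: ltW].
apply: withinU_continuous => //.
  apply: (@subspace_eq_continuous _ _ _ a); last exact: continuous_subspaceT.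
  by move=> u /set_mem /= fu; rewrite /from_subspace /g fu.
apply: (@subspace_eq_continuous _ _ _ b); last exact: continuous_subspaceT.
move=> u /set_mem /= fu; rewrite /from_subspace /g; case: ifP => // fu'.
by rewrite ab //; apply/eqP; rewrite eq_le fu fu'.
Qed.

End UnitIntervalTopology.

Section Homotopy.
Context {R : realType} {T : topologicalType}.
Local Notation I := (unitI R).
Implicit Types p q r : I -> T.

Definition homotopic p q := exists h : I * I -> T,
  [/\ continuous h,
      forall s, h (s, zero) = p s, forall s, h (s, one) = q s,
      forall t, h (zero, t) = p zero & forall t, h (one, t) = p one].

Definition cat_fun p q : I -> T := fun s =>
  if ival s <= 2^-1 then p (clamp (2 * ival s)) else q (clamp (2 * ival s - 1)).

Definition rev_fun p : I -> T := fun s => p (clamp (1 - ival s)).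

End Homotopy.

Section HomotopyTheory.
Context {R : realType} {T : topologicalType}.
Local Notation I := (unitI R).
Implicit Types p q r : I -> T.

Lemma continuous_scale (U : topologicalType) (f : U -> R) (a b : R) :
  continuous f -> continuous (fun u => a * f u + b).
Proof.
move=> cf u; apply: cvgD; last exact: cvg_cst.
by apply: cvgM; [exact: cvg_cst | exact: cf].
Qed.

Lemma continuous_clampM (U : topologicalType) (f : U -> R) (a b : R) :
  continuous f -> continuous (fun u => clamp (a * f u + b)).
Proof. by move=> cf; apply: continuous_clamp_comp; exact: continuous_scale. Qed.

Lemma continuous_clamp2 (U : topologicalType) (f : U -> R) :
  continuous f -> continuous (fun u => clamp (2 * f u)).
Proof.
move=> cf; have := continuous_clampM (a := 2) (b := 0) cf.
by under eq_fun do rewrite addr0.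
Qed.

Lemma continuous_comp_fun (U V W : topologicalType) (f : U -> V) (g : V -> W) :
  continuous f -> continuous g -> continuous (fun u => g (f u)).
Proof. by move=> cf cg u; apply: continuous_comp; [exact: cf | exact: cg]. Qed.

Lemma continuous_pair_fun (U V W : topologicalType) (f : U -> V) (g : U -> W) :
  continuous f -> continuous g -> continuous (fun u => (f u, g u)).
Proof. by move=> cf cg u; apply: cvg_pair; [exact: cf | exact: cg]. Qed.

Lemma continuous_fst (U V : topologicalType) : continuous (@fst U V).
Proof. by move=> ?; exact: cvg_fst. Qed.

Lemma continuous_snd (U V : topologicalType) : continuous (@snd U V).
Proof. by move=> ?; exact: cvg_snd. Qed.

Lemma continuous_cat p q : continuous p -> continuous q -> p one = q zero ->
  continuous (cat_fun p q).
Proof.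
move=> cp cq pq; apply: continuous_paste; first exact: continuous_ival.
- apply: continuous_comp_fun cp; apply: continuous_clamp2.
  exact: continuous_ival.
- apply: continuous_comp_fun cq; apply: continuous_clampM.
  exact: continuous_ival.
move=> s ->; rewrite divff ?pnatr_eq0 // subrr.
by rewrite clamp_ge1 // clamp_le0.
Qed.

Lemma continuous_rev p : continuous p -> continuous (rev_fun p).
Proof.
move=> cp; apply: continuous_comp_fun cp.
have := @continuous_clampM _ (@ival R) (-1) 1 (@continuous_ival R).
by under eq_fun do rewrite mulN1r addrC.
Qed.

Lemma cat_fun0 p q : cat_fun p q zero = p zero.
Proof. by rewrite /cat_fun ival0 invr_ge0 ler0n mulr0 clamp_le0. Qed.

Lemma cat_fun1 p q : cat_fun p q one = q one.
Proof.
rewrite /cat_fun ival1 invf_ge1 ?ltr0n // lern1 /= mulr1 clamp_ge1 //; lra.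
Qed.

Lemma rev_fun0 p : rev_fun p zero = p one.
Proof. by rewrite /rev_fun ival0 subr0 clamp_ge1. Qed.

Lemma rev_fun1 p : rev_fun p one = p zero.
Proof. by rewrite /rev_fun ival1 subrr clamp_le0. Qed.

Lemma homotopic_ends p q : homotopic p q -> q zero = p zero /\ q one = p one.
Proof. by case=> h [_ _ h1 ha hb]; rewrite -!h1 ha hb. Qed.

Lemma homotopic_refl p : continuous p -> homotopic p p.
Proof.
move=> cp; exists (fun z => p z.1); split=> //.
exact: continuous_comp_fun (@continuous_fst _ _) cp.
Qed.

Lemma homotopic_sym p q : homotopic p q -> homotopic q p.
Proof.
move=> hpq; have [e0 e1] := homotopic_ends hpq.
case: hpq => h [ch h0 h1 ha hb].
exists (fun z => h (z.1, clamp (-1 * ival z.2 + 1))); split=> //.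
- apply: continuous_comp_fun ch; apply: continuous_pair_fun.
    exact: continuous_fst.
  apply: continuous_clampM.
  exact: continuous_comp_fun (@continuous_snd _ _) (@continuous_ival R).
- by move=> s /=; rewrite ival0 mulr0 add0r clamp_ge1.
- by move=> s /=; rewrite ival1 mulr1 addNr clamp_le0.
- by move=> t /=; rewrite ha e0.
- by move=> t /=; rewrite hb e1.
Qed.

Lemma homotopic_trans p q r : homotopic p q -> homotopic q r -> homotopic p r.
Proof.
move=> hpq; have [e0 e1] := homotopic_ends hpq.
case: hpq => h [ch h0 h1 ha hb] [k [ck k0 k1 ka kb]].
have c2 : continuous (fun z : I * I => ival z.2).
  exact: continuous_comp_fun (@continuous_snd _ _) (@continuous_ival R).
exists (fun z => if ival z.2 <= 2^-1 then h (z.1, clamp (2 * ival z.2))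
                 else k (z.1, clamp (2 * ival z.2 - 1))); split.
- apply: continuous_paste => //.
  + apply: continuous_comp_fun ch; apply: continuous_pair_fun.
      exact: continuous_fst.
    exact: continuous_clamp2.
  + apply: continuous_comp_fun ck; apply: continuous_pair_fun.
      exact: continuous_fst.
    exact: continuous_clampM.
  + move=> z ->; rewrite divff ?pnatr_eq0 // subrr.
    by rewrite clamp_ge1 // clamp_le0 // h1 k0.
- by move=> s /=; rewrite ival0 invr_ge0 ler0n mulr0 clamp_le0.
- move=> s /=; rewrite ival1 invf_ge1 ?ltr0n // lern1 /= mulr1 clamp_ge1 //.
  lra.
- by move=> t /=; case: ifP => _; rewrite ?ha ?ka ?e0.
- by move=> t /=; case: ifP => _; rewrite ?hb ?kb ?e1.
Qed.

Lemma homotopic_cat p p' q q' : p one = q zero ->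
  homotopic p p' -> homotopic q q' -> homotopic (cat_fun p q) (cat_fun p' q').
Proof.
move=> pq [h [ch h0 h1 ha hb]] [k [ck k0 k1 ka kb]].
have c1 : continuous (fun z : I * I => ival z.1).
  exact: continuous_comp_fun (@continuous_fst _ _) (@continuous_ival R).
exists (fun z => if ival z.1 <= 2^-1 then h (clamp (2 * ival z.1), z.2)
                 else k (clamp (2 * ival z.1 - 1), z.2)); split.
- apply: continuous_paste => //.
  + apply: continuous_comp_fun ch; apply: continuous_pair_fun.
      exact: continuous_clamp2.
    exact: continuous_snd.
  + apply: continuous_comp_fun ck; apply: continuous_pair_fun.
      exact: continuous_clampM.
    exact: continuous_snd.
  + move=> z ->; rewrite divff ?pnatr_eq0 // subrr.
    by rewrite clamp_ge1 // clamp_le0 // hb ka.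
- by move=> s /=; rewrite /cat_fun; case: ifP.
- by move=> s /=; rewrite /cat_fun; case: ifP.
- move=> t /=; rewrite ival0 invr_ge0 ler0n mulr0 clamp_le0 //.
  by rewrite ha cat_fun0.
- move=> t /=; rewrite ival1 invf_ge1 ?ltr0n // lern1 /= mulr1 clamp_ge1; last lra.
  by rewrite kb cat_fun1.
Qed.

Lemma homotopic_rev p p' :
  homotopic p p' -> homotopic (rev_fun p) (rev_fun p').
Proof.
case=> h [ch h0 h1 ha hb].
exists (fun z => h (clamp (-1 * ival z.1 + 1), z.2)); split=> //.
- apply: continuous_comp_fun ch; apply: continuous_pair_fun.
    apply: continuous_clampM.
    exact: continuous_comp_fun (@continuous_fst _ _) (@continuous_ival R).
  exact: continuous_snd.
- by move=> s /=; rewrite h0 mulN1r addrC.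
- by move=> s /=; rewrite h1 mulN1r addrC.
- by move=> t /=; rewrite ival0 mulr0 add0r clamp_ge1 // hb rev_fun0.
- by move=> t /=; rewrite ival1 mulr1 addNr clamp_le0 // ha rev_fun1.
Qed.

Lemma homotopic_reparam p (f g : I -> R) : continuous p ->
  continuous f -> continuous g -> f zero = g zero -> f one = g one ->
  homotopic (fun s => p (clamp (f s))) (fun s => p (clamp (g s))).
Proof.
move=> cp cf cg fg0 fg1.
exists (fun z => p (clamp (f z.1 + ival z.2 * (g z.1 - f z.1)))); split.
- apply: continuous_comp_fun cp; apply: continuous_clamp_comp => z.
  have cf1 : {for z, continuous (fun z : I * I => f z.1)}.
    exact: (continuous_comp_fun (@continuous_fst _ _) cf).
  have cg1 : {for z, continuous (fun z : I * I => g z.1)}.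
    exact: (continuous_comp_fun (@continuous_fst _ _) cg).
  have c2 : {for z, continuous (fun z : I * I => ival z.2)}.
    exact: (continuous_comp_fun (@continuous_snd _ _) (@continuous_ival R)).
  by apply: cvgD => //; apply: cvgM => //; apply: cvgB.
- by move=> s /=; rewrite ival0 mul0r addr0.
- by move=> s /=; rewrite ival1 mul1r addrC subrK.
- by move=> t /=; rewrite fg0 subrr mulr0 addr0.
- by move=> t /=; rewrite fg1 subrr mulr0 addr0.
Qed.

Lemma continuous_ivalM (a b : R) : continuous (fun s : I => a * ival s + b).
Proof. exact: continuous_scale (@continuous_ival R). Qed.

Lemma continuous_minI (f g : I -> R) : continuous f -> continuous g ->
  continuous (fun s => Num.min (f s) (g s)).
Proof. by move=> cf cg s; apply: (@continuous_min R I f g); [exact: cf | exact: cg]. Qed.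

Lemma homotopic_eq p q : continuous p -> p =1 q -> homotopic p q.
Proof. by move=> cp /funext <-; exact: homotopic_refl. Qed.

Lemma homotopic_reparamI p (f g : I -> I) : continuous p ->
  continuous f -> continuous g -> f zero = g zero -> f one = g one ->
  homotopic (fun s => p (f s)) (fun s => p (g s)).
Proof.
move=> cp cf cg e0 e1.
have := @homotopic_reparam p (fun s => ival (f s)) (fun s => ival (g s)) cp
  (continuous_comp_fun cf (@continuous_ival R))
  (continuous_comp_fun cg (@continuous_ival R)) (congr1 _ e0) (congr1 _ e1).
by under eq_fun do rewrite ivalK; under [X in homotopic _ X]eq_fun do rewrite ivalK.
Qed.

Lemma homotopic_cat_cstl p :
  continuous p -> homotopic (cat_fun (fun=> p zero) p) p.
Proof.
move=> cp.
have -> : cat_fun (fun=> p zero) p = fun s => p (clamp (2 * ival s - 1)).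
  apply/funext => s; rewrite /cat_fun; case: ifP => // h.
  by rewrite clamp_le0 //; lra.
apply: (@homotopic_reparamI p _ id) => //.
- exact: continuous_clampM (@continuous_ival R).
- by move=> s; exact: cvg_id.
- by rewrite ival0 clamp_le0 //; lra.
- by rewrite ival1 clamp_ge1 //; lra.
Qed.

Lemma homotopic_cat_cstr p :
  continuous p -> homotopic (cat_fun p (fun=> p one)) p.
Proof.
move=> cp.
have -> : cat_fun p (fun=> p one) = fun s => p (clamp (2 * ival s)).
  apply/funext => s; rewrite /cat_fun; case: ifP => // h.
  by rewrite clamp_ge1 //; lra.
apply: (@homotopic_reparamI p _ id) => //.
- exact: continuous_clamp2 (@continuous_ival R).
- by move=> s; exact: cvg_id.
- by rewrite ival0 clamp_le0 //; lra.
- by rewrite ival1 clamp_ge1 //; lra.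
Qed.

Lemma homotopic_cat_revr p :
  continuous p -> homotopic (cat_fun p (rev_fun p)) (fun=> p zero).
Proof.
move=> cp.
have -> : cat_fun p (rev_fun p) =
    fun s => p (clamp (Num.min (2 * ival s + 0) (-2 * ival s + 2))).
  apply/funext => s; rewrite /cat_fun /rev_fun.
  have s0 := ival_ge0 s; have s1 := ival_le1 s.
  case: ifP => h; first by rewrite addr0 min_l //; lra.
  rewrite min_r; last lra.
  by rewrite clampK; [congr (p (clamp _)); lra | lra].
apply: (@homotopic_reparamI p _ (fun=> zero)) => //.
- by apply: continuous_clamp_comp; apply: continuous_minI; exact: continuous_ivalM.
- exact: cst_continuous.
- by rewrite ival0 clamp_le0 // ge_min; apply/orP; left; lra.
- by rewrite ival1 clamp_le0 // ge_min; apply/orP; right; lra.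
Qed.

Lemma rev_funK p : rev_fun (rev_fun p) = p.
Proof.
apply/funext => s; rewrite /rev_fun; have s0 := ival_ge0 s; have s1 := ival_le1 s.
rewrite clampK; last lra.
by rewrite subKr ivalK.
Qed.

Lemma homotopic_cat_revl p :
  continuous p -> homotopic (cat_fun (rev_fun p) p) (fun=> p one).
Proof.
move=> cp; have := homotopic_cat_revr (continuous_rev cp).
by rewrite rev_funK rev_fun0.
Qed.

Lemma homotopic_catA p q r : continuous p -> continuous q -> continuous r ->
  p one = q zero -> q one = r zero ->
  homotopic (cat_fun p (cat_fun q r)) (cat_fun (cat_fun p q) r).
Proof.
move=> cp cq cr pq qr; apply: homotopic_sym.
pose f (s : I) : R :=
  Num.min (Num.min (2 * ival s + 0) (1 * ival s + 4^-1)) (2^-1 * ival s + 2^-1).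
have -> : cat_fun (cat_fun p q) r = fun s => cat_fun p (cat_fun q r) (clamp (f s)).
  apply/funext => s; have s0 := ival_ge0 s; have s1 := ival_le1 s.
  have [s4|s4] := lerP (ival s) 4^-1.
    have -> : f s = 2 * ival s.
      by rewrite /f addr0 [X in Num.min X _]min_l ?min_l //; lra.
    rewrite [LHS]/cat_fun ifT; last lra.
    rewrite /cat_fun clampK; last lra.
    by have -> : 2 * ival s <= 2^-1 by lra.
  have [s2|s2] := lerP (ival s) 2^-1.
    have -> : f s = ival s + 4^-1.
      by rewrite /f mul1r [X in Num.min X _]min_r ?min_l //; lra.
    rewrite [LHS]/cat_fun ifT // /cat_fun clampK; last lra.
    rewrite ifF; last lra.
    rewrite clampK; last lra.
    rewrite ifF; last lra.
    rewrite clampK; last lra.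
    rewrite ifT; last lra.
    by congr (q (clamp _)); lra.
  have -> : f s = 2^-1 * ival s + 2^-1.
    by rewrite /f min_r // le_min; apply/andP; split; lra.
  rewrite [LHS]/cat_fun ifF; last lra.
  rewrite /cat_fun clampK; last lra.
  rewrite ifF; last lra.
  rewrite clampK; last lra.
  rewrite ifF; last lra.
  by congr (r (clamp _)); lra.
apply: (@homotopic_reparamI _ _ id) => //.
- apply: continuous_cat => //; first exact: continuous_cat.
  by rewrite cat_fun0.
- apply: continuous_clamp_comp; apply: continuous_minI.
    by apply: continuous_minI; exact: continuous_ivalM.
  exact: continuous_ivalM.
- by move=> s; exact: cvg_id.
- by rewrite clamp_le0 // /f ival0 !ge_min; apply/orP; left; apply/orP; left; lra.
- by rewrite clamp_ge1 // /f ival1 !le_min; apply/andP; split; [apply/andP; split|]; lra.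
Qed.

End HomotopyTheory.

Lemma homotopic_comp (R : realType) (T U : topologicalType) (f : T -> U)
    (p q : unitI R -> T) : continuous f ->
  homotopic p q -> homotopic (fun s => f (p s)) (fun s => f (q s)).
Proof.
move=> cf [h [ch h0 h1 ha hb]]; exists (fun z => f (h z)); split=> /=.
- exact: continuous_comp_fun ch cf.
- by move=> s; rewrite h0.
- by move=> s; rewrite h1.
- by move=> t; rewrite ha.
- by move=> t; rewrite hb.
Qed.

(** Operations on [A] satisfying the group axioms up to [pg_equiv]; the classes
    form the group [class_group]. *)
Record pregroup (A : choiceType) := Pregroup {
  pg_equiv : equiv_rel A;
  pg_one : A;
  pg_inv : A -> A;
  pg_mul : A -> A -> A;
  pg_inv_congr : forall a a', pg_equiv a a' -> pg_equiv (pg_inv a) (pg_inv a');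
  pg_mul_congr : forall a a' b b', pg_equiv a a' -> pg_equiv b b' ->
    pg_equiv (pg_mul a b) (pg_mul a' b');
  pg_mulA : forall a b c,
    pg_equiv (pg_mul a (pg_mul b c)) (pg_mul (pg_mul a b) c);
  pg_mul1 : forall a, pg_equiv (pg_mul pg_one a) a;
  pg_mulr1 : forall a, pg_equiv (pg_mul a pg_one) a;
  pg_mulV : forall a, pg_equiv (pg_mul (pg_inv a) a) pg_one;
  pg_mulrV : forall a, pg_equiv (pg_mul a (pg_inv a)) pg_one
}.

Section ClassGroup.
Context {A : choiceType} (P : pregroup A).

Definition class_group : Type := {eq_quot pg_equiv P}.

HB.instance Definition _ := Choice.copy class_group {eq_quot pg_equiv P}.

Definition class_of (a : A) : class_group := \pi_{eq_quot pg_equiv P} a.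
Definition class_repr (x : class_group) : A := repr (x : {eq_quot pg_equiv P}).

Lemma class_ofP a b : reflect (class_of a = class_of b) (pg_equiv P a b).
Proof. by apply: (iffP idP) => [/eqmodP|/eqmodP]. Qed.

Lemma class_reprK x : class_of (class_repr x) = x.
Proof. exact: reprK. Qed.

Lemma class_ofK a : pg_equiv P (class_repr (class_of a)) a.
Proof. by apply/class_ofP; rewrite class_reprK. Qed.

Definition class_one : class_group := class_of (pg_one P).
Definition class_inv x : class_group := class_of (pg_inv P (class_repr x)).
Definition class_mul x y : class_group :=
  class_of (pg_mul P (class_repr x) (class_repr y)).

Lemma class_of_inv a : class_inv (class_of a) = class_of (pg_inv P a).
Proof. by apply/class_ofP/pg_inv_congr/class_ofK. Qed.

Lemma class_of_mul a b :
  class_mul (class_of a) (class_of b) = class_of (pg_mul P a b).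
Proof. by apply/class_ofP/pg_mul_congr; exact: class_ofK. Qed.

Lemma class_mulA : associative class_mul.
Proof.
move=> x y z; rewrite -(class_reprK x) -(class_reprK y) -(class_reprK z).
by rewrite !class_of_mul; apply/class_ofP/pg_mulA.
Qed.

Lemma class_mul1 : left_id class_one class_mul.
Proof.
by move=> x; rewrite -(class_reprK x) class_of_mul; apply/class_ofP/pg_mul1.
Qed.

Lemma class_mulr1 : right_id class_one class_mul.
Proof.
by move=> x; rewrite -(class_reprK x) class_of_mul; apply/class_ofP/pg_mulr1.
Qed.

Lemma class_mulV : left_inverse class_one class_inv class_mul.
Proof.
move=> x; rewrite -(class_reprK x) class_of_inv class_of_mul.
exact/class_ofP/pg_mulV.
Qed.

Lemma class_mulrV : right_inverse class_one class_inv class_mul.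
Proof.
move=> x; rewrite -(class_reprK x) class_of_inv class_of_mul.
exact/class_ofP/pg_mulrV.
Qed.

HB.instance Definition _ := isGroup.Build class_group
  class_mulA class_mul1 class_mulr1 class_mulV class_mulrV.

Lemma class_ofM a b :
  class_of (pg_mul P a b) = (class_of a * class_of b)%g.
Proof. by rewrite -class_of_mul. Qed.

Lemma class_ofV a : class_of (pg_inv P a) = (class_of a)^-1%g.
Proof. by rewrite -class_of_inv. Qed.

Lemma class_of1 : class_of (pg_one P) = 1%g.
Proof. by []. Qed.

End ClassGroup.

Record normal_subgroup (G : groupType) := NormalSubgroup {
  ns_set :> set G;
  ns1 : ns_set 1%g;
  nsM : forall x y, ns_set x -> ns_set y -> ns_set (x * y)%g;
  nsV : forall x, ns_set x -> ns_set x^-1%g;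
  nsJ : forall x y, ns_set x -> ns_set (x ^ y)%g
}.

Section NormalClosure.
Context {G : groupType} (S : set G).

Definition normal_closure_set : set G :=
  [set x | forall N : normal_subgroup G, S `<=` N -> ns_set N x].

Lemma normal_closure1 : normal_closure_set 1%g.
Proof. by move=> N _; exact: ns1. Qed.

Lemma normal_closureM x y : normal_closure_set x -> normal_closure_set y ->
  normal_closure_set (x * y)%g.
Proof. by move=> nx ny N SN; apply: nsM; [exact: nx | exact: ny]. Qed.

Lemma normal_closureV x : normal_closure_set x -> normal_closure_set x^-1%g.
Proof. by move=> nx N SN; apply: nsV; exact: nx. Qed.

Lemma normal_closureJ x y :
  normal_closure_set x -> normal_closure_set (x ^ y)%g.
Proof. by move=> nx N SN; apply: nsJ; exact: nx. Qed.

Definition normal_closure : normal_subgroup G := NormalSubgroup normal_closure1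
  normal_closureM normal_closureV normal_closureJ.

End NormalClosure.

Section QuotientGroup.
Context {G : groupType} (N : normal_subgroup G).

Definition eq_mod (x y : G) : bool := `[< ns_set N (x^-1 * y)%g >].

Lemma eq_mod_refl : reflexive eq_mod.
Proof. by move=> x; apply/asboolP; rewrite mulVg; exact: ns1. Qed.

Lemma eq_mod_sym : symmetric eq_mod.
Proof.
suff h x y : eq_mod x y -> eq_mod y x by move=> x y; apply/idP/idP; exact: h.
by move=> /asboolP /nsV; rewrite invgM invgK => ?; apply/asboolP.
Qed.

Lemma eq_mod_trans : transitive eq_mod.
Proof.
move=> y x z /asboolP xy /asboolP yz; apply/asboolP.
by have := nsM xy yz; rewrite mulgA mulgK.
Qed.

Canonical eq_mod_equiv := EquivRel eq_mod eq_mod_refl eq_mod_sym eq_mod_trans.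

Lemma eq_mod_inv x y : eq_mod x y -> eq_mod x^-1%g y^-1%g.
Proof.
move=> /asboolP /nsV /nsJ; move/(_ x^-1%g) => h; apply/asboolP.
by move: h; rewrite invgM invgK conjgE invgK -!mulgA mulgV mulg1.
Qed.

Lemma eq_mod_mul x x' y y' :
  eq_mod x x' -> eq_mod y y' -> eq_mod (x * y)%g (x' * y')%g.
Proof.
move=> /asboolP xx' /asboolP yy'; apply/asboolP.
by have := nsM (nsJ y xx') yy'; rewrite conjgE invgM -!mulgA mulKVg.
Qed.

Lemma eq_mod_eq x y : x = y -> eq_mod x y.
Proof. by move=> ->; exact: eq_mod_refl. Qed.

Definition quotient_pregroup : pregroup G :=
  @Pregroup G eq_mod_equiv 1%g (fun x => x^-1%g) (fun x y => (x * y)%g)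
    eq_mod_inv eq_mod_mul
    (fun x y z => eq_mod_eq (mulgA x y z)) (fun x => eq_mod_eq (mul1g x))
    (fun x => eq_mod_eq (mulg1 x)) (fun x => eq_mod_eq (mulVg x))
    (fun x => eq_mod_eq (mulgV x)).

Definition quotient_group : groupType := class_group quotient_pregroup.

Definition to_quotient (x : G) : quotient_group := class_of quotient_pregroup x.

End QuotientGroup.

Section Paths.
Context {R : realType} {T : topologicalType}.
Local Notation path := (fun x y : T => {path unitI R from x to y}).

Lemma continuous_path (x y : T) (p : path x y) : continuous p.
Proof. exact: cts_fun. Qed.

Section Cat.
Context (x y z : T) (p : path x y) (q : path y z).

Lemma cat_path_subproof : continuous (cat_fun p q).
Proof.
apply: continuous_cat; [exact: continuous_path..|].
by rewrite path_one path_zero.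
Qed.

Lemma cat_path_zero : cat_fun p q zero = x.
Proof. by rewrite cat_fun0 path_zero. Qed.

Lemma cat_path_one : cat_fun p q one = z.
Proof. by rewrite cat_fun1 path_one. Qed.

Definition cat_path : path x z :=
  mk_path cat_path_subproof cat_path_zero cat_path_one.

Lemma rev_path_zero : rev_fun p zero = y.
Proof. by rewrite rev_fun0 path_one. Qed.

Lemma rev_path_one : rev_fun p one = x.
Proof. by rewrite rev_fun1 path_zero. Qed.

Definition rev_path : path y x :=
  mk_path (continuous_rev (@continuous_path x y p)) rev_path_zero rev_path_one.

End Cat.

Section Pi1.
Variable x : T.
Implicit Types p q r : path x x.

Definition path_homotopic p q : bool := `[< homotopic p q >].

Lemma path_homotopic_refl : reflexive path_homotopic.
Proof. by move=> p; apply/asboolP/homotopic_refl/continuous_path. Qed.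

Lemma path_homotopic_sym : symmetric path_homotopic.
Proof.
by move=> p q; apply/asboolP/asboolP => /homotopic_sym.
Qed.

Lemma path_homotopic_trans : transitive path_homotopic.
Proof.
move=> q p r /asboolP pq /asboolP qr.
exact/asboolP/(homotopic_trans pq qr).
Qed.

Canonical path_homotopic_equiv := EquivRel path_homotopic
  path_homotopic_refl path_homotopic_sym path_homotopic_trans.

Lemma path_homotopic_rev p q :
  path_homotopic p q -> path_homotopic (rev_path p) (rev_path q).
Proof. by move=> /asboolP pq; apply/asboolP/homotopic_rev. Qed.

Lemma path_homotopic_cat p p' q q' : path_homotopic p p' ->
  path_homotopic q q' -> path_homotopic (cat_path p q) (cat_path p' q').
Proof.
move=> /asboolP pp' /asboolP qq'; apply/asboolP/homotopic_cat => //.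
by rewrite path_one path_zero.
Qed.

Lemma path_homotopic_catA p q r : path_homotopic
  (cat_path p (cat_path q r)) (cat_path (cat_path p q) r).
Proof.
apply/asboolP/homotopic_catA; try exact: continuous_path.
  by rewrite path_one path_zero.
by rewrite path_one path_zero.
Qed.

Definition cst_path : path x x := (cst x : unitI R -> T).

Lemma path_homotopic_cstl p : path_homotopic (cat_path cst_path p) p.
Proof.
apply/asboolP; have := homotopic_cat_cstl (@continuous_path _ _ p).
by rewrite path_zero.
Qed.

Lemma path_homotopic_cstr p : path_homotopic (cat_path p cst_path) p.
Proof.
apply/asboolP; have := homotopic_cat_cstr (@continuous_path _ _ p).
by rewrite path_one.
Qed.

Lemma path_homotopic_revl p :
  path_homotopic (cat_path (rev_path p) p) cst_path.
Proof.
apply/asboolP; have := homotopic_cat_revl (@continuous_path _ _ p).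
by rewrite path_one.
Qed.

Lemma path_homotopic_revr p :
  path_homotopic (cat_path p (rev_path p)) cst_path.
Proof.
apply/asboolP; have := homotopic_cat_revr (@continuous_path _ _ p).
by rewrite path_zero.
Qed.

Definition loop_pregroup : pregroup {path unitI R from x to x} :=
  Pregroup (pg_equiv := path_homotopic_equiv)
    path_homotopic_rev path_homotopic_cat path_homotopic_catA
    path_homotopic_cstl path_homotopic_cstr
    path_homotopic_revl path_homotopic_revr.

End Pi1.
End Paths.

Definition fundamental_group (R : realType) (T : topologicalType) (x : T) :
  groupType := class_group (loop_pregroup (R := R) x).

(** Row [i] of the matrix is the position of the [i]-th strand in a horizontal
    plane. *)
Definition Conf (R : realType) n : set 'M[R]_(n, 2) :=
  [set X | injective (fun i => row i X)].
Arguments Conf : clear implicits.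

Section Configurations.
Context {R : realType}.

Lemma continuous_mx (U : topologicalType) m n (f : U -> 'M[R]_(m, n)) :
  (forall i j, continuous (fun u => f u i j)) -> continuous f.
Proof.
move=> cf u A [P nP PA].
have : \forall v \near u, forall i j, P i j (f v i j).
  apply: filter_forall => i; apply: filter_forall => j.
  exact: cf (nP i j).
by apply: filterS => v Pv; exact: PA.
Qed.

Definition conf n (X : 'M[R]_(n, 2)) (hX : Conf R n X) : Conf R n :=
  @exist _ (fun Y => Y \in Conf R n) X (mem_set hX).

Lemma conf_inj n (X : Conf R n) : injective (fun i => row i (\val X)).
Proof. exact: set_mem (valP X). Qed.

Definition base_mx n : 'M[R]_(n, 2) :=
  \matrix_(i, j) if j == 0 then (i : nat)%:R else 0.

Lemma base_subproof n : Conf R n (base_mx n).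
Proof.
move=> i i' /rowP /(_ 0); rewrite !mxE eqxx => /eqP.
by rewrite eqr_nat => /eqP ii'; exact: val_inj.
Qed.

Definition base n : Conf R n := conf (@base_subproof n).

Lemma relabel_subproof n (s : 'S_n) (X : Conf R n) :
  Conf R n (row_perm s (\val X)).
Proof.
move=> i i' h; apply: (@perm_inj _ s); apply: (@conf_inj _ X).
by apply/rowP => j; move/rowP: h => /(_ j); rewrite !mxE.
Qed.

(** Strand [i] of [relabel s X] is strand [s i] of [X]. *)
Definition relabel n (s : 'S_n) (X : Conf R n) : Conf R n :=
  conf (@relabel_subproof n s X).

Lemma relabel1 n (X : Conf R n) : relabel 1%g X = X.
Proof. by apply: val_inj; rewrite /= row_perm1. Qed.

Lemma relabelM n (s t : 'S_n) (X : Conf R n) :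
  relabel (s * t)%g X = relabel s (relabel t X).
Proof. by apply: val_inj; rewrite /= row_permM. Qed.

Lemma relabel_inj n (s t : 'S_n) (X : Conf R n) :
  relabel s X = relabel t X -> s = t.
Proof.
move=> /(congr1 val) /= h; apply/permP => i; apply: (@conf_inj _ X).
by apply/rowP => j; move/matrixP: h => /(_ i j); rewrite !mxE.
Qed.

Lemma continuous_conf_val (U : topologicalType) n (f : U -> Conf R n) :
  continuous (fun u => \val (f u)) -> continuous f.
Proof. by move=> cf; exact: continuous_comp_initial. Qed.

Lemma continuous_relabel n (s : 'S_n) : continuous (@relabel n s).
Proof.
apply: continuous_conf_val; apply: continuous_mx => i j.
under eq_fun do rewrite mxE.
have cv : continuous (fun X : Conf R n => \val X).
  exact: initial_continuous.
exact: continuous_comp_fun cv (@coord_continuous _ _ _ (s i) j).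
Qed.

End Configurations.
Arguments base : clear implicits.

Section Braids.
Context {R : realType} {n : nat}.
Local Notation base := (base R n).

(** Strands with monotonic height are parametrized by their height, rescaled to
    [0, 1]: the strands of a braid are a path of configurations, in which
    strand [i] goes from the [i]-th base point to the [braid_perm i]-th one. An
    isotopy is a homotopy of such paths with fixed endpoints. *)
Record braid := Braid {
  braid_perm : 'S_n;
  strands : {path unitI R from base to relabel braid_perm base}
}.

HB.instance Definition _ := gen_eqMixin braid.
HB.instance Definition _ := gen_choiceMixin braid.
Implicit Types a b c : braid.

Definition isotopic a b : bool := `[< homotopic (strands a) (strands b) >].

Lemma isotopic_refl : reflexive isotopic.
Proof. by move=> a; apply/asboolP/homotopic_refl/continuous_path. Qed.

Lemma isotopic_sym : symmetric isotopic.
Proof. by move=> a b; apply/asboolP/asboolP => /homotopic_sym. Qed.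

Lemma isotopic_trans : transitive isotopic.
Proof.
move=> b a c /asboolP ab /asboolP bc.
exact/asboolP/(homotopic_trans ab bc).
Qed.

Canonical isotopic_equiv :=
  EquivRel isotopic isotopic_refl isotopic_sym isotopic_trans.

Lemma isotopic_perm a b : isotopic a b -> braid_perm a = braid_perm b.
Proof.
move=> /asboolP /homotopic_ends[_]; rewrite !path_one => h.
by symmetry; exact: relabel_inj h.
Qed.

Section Relabel.
Context (s t : 'S_n) (p : {path unitI R from base to relabel t base}).

Lemma relabel_path_continuous : continuous (fun u => relabel s (p u)).
Proof.
exact: continuous_comp_fun (@continuous_path _ _ _ _ p) (@continuous_relabel _ _ s).
Qed.

Lemma relabel_path_zero : relabel s (p zero) = relabel s base.
Proof. by rewrite path_zero. Qed.

Lemma relabel_path_one : relabel s (p one) = relabel (s * t)%g base.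
Proof. by rewrite path_one relabelM. Qed.

Definition relabel_path :
    {path unitI R from relabel s base to relabel (s * t)%g base} :=
  mk_path relabel_path_continuous relabel_path_zero relabel_path_one.

End Relabel.

(** [b] is stacked on top of [a]: strand [i] of [a] is continued by the strand of
    [b] that starts at its upper endpoint. *)
Definition braid_mul a b : braid :=
  Braid (cat_path (strands a) (relabel_path (braid_perm a) (strands b))).

Section Inverse.
Variable a : braid.
Let s := (braid_perm a)^-1%g.
Let p : unitI R -> Conf R n := fun u => relabel s (rev_fun (strands a) u).

Lemma braid_inv_continuous : continuous p.
Proof.
apply: continuous_comp_fun (@continuous_relabel _ _ s).
exact: continuous_rev (@continuous_path _ _ _ _ (strands a)).
Qed.

Lemma braid_inv_zero : p zero = base.
Proof. by rewrite /p rev_fun0 path_one -relabelM mulVg relabel1. Qed.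

Lemma braid_inv_one : p one = relabel s base.
Proof. by rewrite /p rev_fun1 path_zero. Qed.

Definition braid_inv : braid :=
  Braid (mk_path braid_inv_continuous braid_inv_zero braid_inv_one
         : {path unitI R from base to relabel s base}).

End Inverse.

Section PureBraid.
Variable p : {path unitI R from base to base}.

Lemma pure_braid_one : p one = relabel 1%g base.
Proof. by rewrite path_one relabel1. Qed.

Definition pure_braid : braid :=
  Braid (mk_path (@continuous_path _ _ _ _ p) (path_zero (s := p)) pure_braid_one
         : {path unitI R from base to relabel 1%g base}).

End PureBraid.

Definition braid_one : braid := pure_braid (cst_path base).

Lemma relabel_cat (s : 'S_n) (p q : unitI R -> Conf R n) :
  (fun u => relabel s (cat_fun p q u)) =
  cat_fun (fun u => relabel s (p u)) (fun u => relabel s (q u)).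
Proof. by apply/funext => u; rewrite /cat_fun; case: ifP. Qed.

Lemma homotopic_relabel (s t : 'S_n) (p q : unitI R -> Conf R n) :
  s = t -> homotopic p q ->
  homotopic (fun u => relabel s (p u)) (fun u => relabel t (q u)).
Proof. by move=> <-; apply: homotopic_comp; exact: continuous_relabel. Qed.

Lemma isotopic_inv a b : isotopic a b -> isotopic (braid_inv a) (braid_inv b).
Proof.
move=> ab; apply/asboolP; apply: homotopic_relabel.
  by rewrite (isotopic_perm ab).
by apply: homotopic_rev; apply/asboolP.
Qed.

Lemma strands_match a b :
  strands a one = relabel (braid_perm a) (strands b zero).
Proof. by rewrite path_one path_zero. Qed.

Lemma isotopic_mul a a' b b' : isotopic a a' -> isotopic b b' ->
  isotopic (braid_mul a b) (braid_mul a' b').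
Proof.
move=> aa' /asboolP bb'; apply/asboolP.
apply: homotopic_cat; first exact: strands_match.
  exact/asboolP.
exact: homotopic_relabel (isotopic_perm aa') bb'.
Qed.

Lemma continuous_relabel_strands (s : 'S_n) a :
  continuous (fun u => relabel s (strands a u)).
Proof. exact: relabel_path_continuous. Qed.

Lemma isotopic_mulA a b c :
  isotopic (braid_mul a (braid_mul b c)) (braid_mul (braid_mul a b) c).
Proof.
apply/asboolP; rewrite /= /mk_path relabel_cat /=.
under [X in homotopic (cat_fun _ (cat_fun _ X)) _]eq_fun do rewrite -relabelM.
apply: homotopic_catA.
- exact: continuous_path.
- exact: continuous_relabel_strands.
- exact: continuous_relabel_strands.
- exact: strands_match.
- by rewrite path_one path_zero relabelM.
Qed.

Lemma isotopic_mul1 a : isotopic (braid_mul braid_one a) a.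
Proof.
apply/asboolP; rewrite /= /mk_path /=.
under [X in homotopic (cat_fun _ X) _]eq_fun do rewrite relabel1.
have := homotopic_cat_cstl (@continuous_path _ _ _ _ (strands a)).
by rewrite path_zero.
Qed.

Lemma isotopic_mulr1 a : isotopic (braid_mul a braid_one) a.
Proof.
apply/asboolP; rewrite /= /mk_path /=.
have := homotopic_cat_cstr (@continuous_path _ _ _ _ (strands a)).
by rewrite path_one.
Qed.

Lemma isotopic_mulrV a : isotopic (braid_mul a (braid_inv a)) braid_one.
Proof.
apply/asboolP; rewrite /= /mk_path /=.
under [X in homotopic (cat_fun _ X) _]eq_fun do rewrite -relabelM mulgV relabel1.
have := homotopic_cat_revr (@continuous_path _ _ _ _ (strands a)).
by rewrite path_zero.
Qed.

Lemma isotopic_mulV a : isotopic (braid_mul (braid_inv a) a) braid_one.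
Proof.
apply/asboolP; rewrite /= /mk_path /=.
have := homotopic_cat_revl (@continuous_path _ _ _ _ (strands a)).
move=> /(homotopic_comp (@continuous_relabel _ _ (braid_perm a)^-1%g)).
by rewrite relabel_cat path_one -relabelM mulVg relabel1.
Qed.

Definition braid_pregroup : pregroup braid :=
  Pregroup (pg_equiv := isotopic_equiv) isotopic_inv isotopic_mul isotopic_mulA
    isotopic_mul1 isotopic_mulr1 isotopic_mulV isotopic_mulrV.

End Braids.
Arguments braid : clear implicits.

Definition braid_group (R : realType) (n : nat) : groupType :=
  class_group (@braid_pregroup R n).

Section PureBraids.
Context {R : realType} {n : nat}.

Definition braid_class (b : braid R n) : braid_group R n :=
  class_of (@braid_pregroup R n) b.

Definition class_perm (x : braid_group R n) : 'S_n := braid_perm (class_repr x).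

Lemma class_permE b : class_perm (braid_class b) = braid_perm b.
Proof. exact/isotopic_perm/(@class_ofK _ (@braid_pregroup R n)). Qed.

Lemma class_permM x y : class_perm (x * y)%g = (class_perm x * class_perm y)%g.
Proof.
rewrite -[x]class_reprK -[y]class_reprK -class_ofM.
by rewrite !class_permE.
Qed.

Lemma class_perm1 : class_perm 1%g = 1%g.
Proof. exact: class_permE. Qed.

Lemma class_permV x : class_perm x^-1%g = (class_perm x)^-1%g.
Proof. by rewrite -[x]class_reprK -class_ofV !class_permE. Qed.

Definition pure : {pred braid_group R n} := [pred x | class_perm x == 1%g].

Lemma pure_closed : group_closed pure.
Proof.
split; first by rewrite inE class_perm1.
by move=> x y; rewrite !inE class_permM class_permV => /eqP -> /eqP ->; rewrite mulgV.
Qed.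

Record pure_braid_group := PureBraid {
  pure_val :> braid_group R n; pure_valP : pure_val \in pure }.

HB.instance Definition _ := [isSub for pure_val].
HB.instance Definition _ := [Choice of pure_braid_group by <:].
HB.instance Definition _ :=
  SubChoice_isSubGroup.Build (braid_group R n) pure pure_braid_group pure_closed.

Lemma pure_braidP (p : {path unitI R from base R n to base R n}) :
  braid_class (pure_braid p) \in pure.
Proof. by rewrite inE class_permE. Qed.

Definition pure_class (p : {path unitI R from base R n to base R n}) :
  pure_braid_group := PureBraid (pure_braidP p).

End PureBraids.
Arguments pure_braid_group : clear implicits.

(** The first coordinate runs from left to right and the second one points away
    from the observer, so that "behind" means "with a larger second
    coordinate": the strand which starts at [k] moves to [k + 1] through
    positive second coordinates. *)
Section Generators.
Context {R : realType} {n : nat}.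
Variable k : 'I_n.

Definition twist_mx (s : R) : 'M[R]_(n.+1, 2) :=
  \matrix_(i, j)
    if i == k :> nat then (if j == 0 then k%:R + s else s * (1 - s))
    else if i == k.+1 :> nat then
      (if j == 0 then k.+1%:R - s else - (s * (1 - s)))
    else base_mx n.+1 i j.

Lemma other_position (m : nat) : (m == k) = false -> (m == k.+1) = false ->
  (m%:R + 1 <= k%:R :> R) \/ (k%:R + 2 <= m%:R :> R).
Proof.
move=> mk mk1; have [h|h|h] := ltngtP m k; [left|right|by rewrite h eqxx in mk].
  by rewrite natr1 ler_nat.
by rewrite -natrD ler_nat addn2 ltn_neqAle eq_sym mk1.
Qed.

Lemma twist_subproof (s : R) : 0 <= s <= 1 -> Conf R n.+1 (twist_mx s).
Proof.
move=> /andP[s0 s1] i i' /rowP h.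
move: (h 0) (h 1); rewrite !mxE /= -!natr1 => {h}.
case: ifP => ik.
  case: ifP => i'k; first by move=> _ _; apply: val_inj; rewrite /= (eqP ik) (eqP i'k).
  case: ifP => i'k1 e0 e1; exfalso; last by case: (other_position i'k i'k1); lra.
  have s2 : s = 2^-1 by lra.
  by move: e1; rewrite s2; lra.
case: ifP => ik1; case: ifP => i'k.
- move=> e0 e1; exfalso; have s2 : s = 2^-1 by lra.
  by move: e1; rewrite s2; lra.
- case: ifP => i'k1; first by move=> _ _; apply: val_inj; rewrite /= (eqP ik1) (eqP i'k1).
  by move=> e0; exfalso; case: (other_position i'k i'k1); lra.
- by move=> e0; exfalso; case: (other_position ik ik1); lra.
case: ifP => i'k1.
  by move=> e0; exfalso; case: (other_position ik ik1); lra.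
by move=> /eqP; rewrite eqr_nat => /eqP ii' _; exact: val_inj.
Qed.

Definition twist_fun (u : unitI R) : Conf R n.+1 :=
  conf (twist_subproof (introT andP (conj (ival_ge0 u) (ival_le1 u)))).

Definition twist_perm : 'S_n.+1 :=
  tperm (widen_ord (leqnSn n) k) (lift ord0 k).

Lemma twist_continuous : continuous twist_fun.
Proof.
apply: continuous_conf_val => /=; apply: continuous_mx => i j.
have ca (a b : R) : continuous (fun u : unitI R => a * ival u + b).
  exact: continuous_scale (@continuous_ival R).
have cs (a : R) : continuous (fun u : unitI R => a * (ival u * (1 - ival u))).
  have -> : (fun u => a * (ival u * (1 - ival u))) =
      (fun u => (a * ival u + 0) * (-1 * ival u + 1)).
    by apply/funext => u; ring.
  by move=> u; exact: (cvgM (ca a 0 u) (ca (-1) 1 u)).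
have ext (f g : unitI R -> R) : f =1 g -> continuous f -> continuous g.
  by move=> /funext ->.
apply: (ext (fun u => twist_mx (ival u) i j)) => //.
rewrite /twist_mx; under eq_fun do rewrite mxE.
case: (i == k :> nat).
  case: (j == 0).
    by apply: ext (ca 1 k%:R) => u; ring.
  by apply: ext (cs 1) => u; ring.
case: (i == k.+1 :> nat).
  case: (j == 0).
    by apply: ext (ca (-1) k.+1%:R) => u; ring.
  by apply: ext (cs (-1)) => u; ring.
by apply: ext (ca 0 (base_mx n.+1 i j)) => u; ring.
Qed.

Lemma twist_zero : twist_fun zero = base R n.+1.
Proof.
apply: val_inj; apply/matrixP => i j; rewrite !mxE ival0 mul0r oppr0 !addr0.
by case: eqP => [->|_] //; case: eqP => [->|].
Qed.

Lemma twist_one : twist_fun one = relabel twist_perm (base R n.+1).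
Proof.
apply: val_inj; apply/matrixP => i j.
rewrite !mxE ival1 subrr mulr0 oppr0 natr1 -natr1 addrK.
have [ik|ik] := eqVneq (i : nat) k.
  have -> : i = widen_ord (leqnSn n) k by exact: val_inj.
  by rewrite tpermL lift0 natr1.
have [ik1|ik1] := eqVneq (i : nat) k.+1.
  have -> : i = lift ord0 k by apply: val_inj; rewrite /= ik1.
  by rewrite tpermR.
rewrite tpermD //; apply/eqP => /(congr1 val) /= h.
  by move: ik; rewrite -h eqxx.
by move: ik1; rewrite -h /bump leq0n add1n eqxx.
Qed.

Definition sigma : braid_group R n.+1 := braid_class
  (Braid (mk_path twist_continuous twist_zero twist_one
          : {path unitI R from base R n.+1 to relabel twist_perm (base R n.+1)})).

Lemma class_perm_sigma : class_perm sigma = twist_perm.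
Proof. exact: class_permE. Qed.

End Generators.

Section P3.
Variable R : realType.
Local Notation s1 := (@sigma R 2 ord0).
Local Notation s2 := (@sigma R 2 ord_max).

Lemma class_perm_sigma2 (k : 'I_2) : class_perm (@sigma R 2 k ^+ 2)%g = 1%g.
Proof. by rewrite class_permM class_perm_sigma tperm2. Qed.

Lemma r1_pure : (s1 * s2 ^+ 2 * s1)%g \in @pure R 3.
Proof.
by rewrite inE class_permM class_permM class_perm_sigma2 mulg1 class_perm_sigma tperm2.
Qed.

Lemma r2_pure : (s1 ^+ 2 * s2 ^+ 2)%g \in @pure R 3.
Proof. by rewrite inE class_permM !class_perm_sigma2 mulg1. Qed.

Lemma r3_pure : (s2 * s1 ^+ 2 * s2)%g \in @pure R 3.
Proof.
by rewrite inE class_permM class_permM class_perm_sigma2 mulg1 class_perm_sigma tperm2.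
Qed.

Definition r1 : pure_braid_group R 3 := PureBraid r1_pure.
Definition r2 : pure_braid_group R 3 := PureBraid r2_pure.
Definition r3 : pure_braid_group R 3 := PureBraid r3_pure.

(** Normal closure inside the pure braid group. *)
Definition Rsub : normal_subgroup (pure_braid_group R 3) :=
  normal_closure [set r1; r2; r3].

Definition P3_mod_R : groupType := quotient_group Rsub.

End P3.

Section Spherical.
Variable R : realType.

(** Rotations act on column vectors. *)
Definition SO3 : set 'M[R]_3 := [set A | A *m A^T = 1%:M /\ \det A = 1].

Lemma SO3_id_subproof : SO3 1%:M.
Proof. by split; [rewrite trmx1 mulmx1 | rewrite det1]. Qed.

Definition SO3_id : SO3 :=
  @exist _ (fun A => A \in SO3) 1%:M (mem_set SO3_id_subproof).

Definition pi1_SO3 : groupType := fundamental_group R SO3_id.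

Definition vec3 (a b c : R) : 'cV[R]_3 := \col_(i < 3) [:: a; b; c]`_i.

Definition x0 (i : 'I_3) : 'cV[R]_3 :=
  [:: vec3 1 0 0;
      vec3 (- 2^-1) (Num.sqrt 3 / 2) 0;
      vec3 (- 2^-1) (- (Num.sqrt 3 / 2)) 0]`_i.

Definition radius (t : unitI R) : R := 1 - ival t / 2.

Definition spherical_strand (w : unitI R -> SO3) (i : 'I_3) (t : unitI R) :
  'cV[R]_3 := radius t *: (\val (w t) *m x0 i).

Definition north : 'cV[R]_3 := vec3 0 0 1.

Definition ray_avoids (u : 'cV[R]_3) (w : unitI R -> SO3) : Prop :=
  forall i t (c : R), 0 <= c -> spherical_strand w i t <> c *: u.

(** Projection of the sphere of radius [rho] from its north pole to the
    horizontal plane at distance 1 below that pole; with this choice of planes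
    the images of [rho *: v] for a fixed unit vector [v] do not depend on
    [rho]. *)
Definition stereo (rho : R) (x : 'cV[R]_3) : 'rV[R]_2 :=
  \row_(j < 2) (x (widen_ord (leqnSn 2) j) 0 / (rho - x ord_max 0)).

(** A ray is given by a rotation [g] carrying the vertical ray to it; the
    projection is taken in the rotated frame, where the ray is vertical. *)
Definition projected_strand (w : unitI R -> SO3) (g : SO3) (i : 'I_3)
    (t : unitI R) : 'rV[R]_2 :=
  stereo (radius t) ((\val g)^T *m spherical_strand w i t).

(** The class [c] comes from some loop [w] in the class [a], some ray missing the
    strands of [w] (the ray of direction [g *m north]), the pure braid [p]
    formed by the projected strands, and some path [q] of configurations
    identifying the standard base points with the projected ones. The level
    [z = - radius t] of the projected braid is level [t] of [p]. *)
Definition stereo_graph (a : pi1_SO3) (c : P3_mod_R R) : Prop :=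
  exists (w : {path unitI R from SO3_id to SO3_id}) (g : SO3) (y : Conf R 3)
    (p : {path unitI R from y to y}) (q : {path unitI R from base R 3 to y}),
  [/\ a = class_of (loop_pregroup SO3_id) w,
      ray_avoids (\val g *m north) w,
      forall i t, row i (\val (p t)) = projected_strand w g i t &
      c = to_quotient (Rsub R)
            (pure_class (cat_path (cat_path q p) (rev_path q)))].

End Spherical.

(* Main.v *)
(** Both groups have two elements, and they are compared through sign changes
    of lifts. A loop in [SO(3)] lifts along the covering by the nonzero
    quaternions, and is null homotopic as soon as the lift keeps its sign, since
    the space of nonzero quaternions is simply connected. On the side of braids,
    the square root of the discriminant of three moving points makes a quarter
    turn at each twist, so that [r_1], [r_2] and [r_3] preserve its sign while
    [sigma_1^2] changes it.

    By stereographic projection a rotation acts as a Moebius transformation of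
    denominator [E], which depends on the quaternion and on the point: the
    discriminant [D] of the projected points is related to that of the standard
    ones by [D E^2 = n^3 D0], with [E] the product of the three denominators and
    [n] the norm of the quaternion. As [E] is cubic in the quaternion, the two
    signs agree.

    There remains that [P_3/R] has no other element than [1] and [sigma_1^2]. The
    configurations of three points are covered by 27 convex open cells, given by
    the choice of one out of three half-planes for the direction of each pair of
    points, so that the pure braid group is generated by the passages from cell
    to cell. The relations coming from the triple intersections of cells, and the
    words of cells visited by [r_1], [r_2] and [r_3], express every passage as a
    power of [sigma_1^2] and give [sigma_1^4 = 1]. *)

Require Import Defs.
From HB Require Import structures.
From mathcomp Require Import all_boot all_order all_algebra all_fingroup.
From mathcomp Require Import generic_quotient.
From mathcomp Require Import all_classical all_reals topology.
From mathcomp Require Import normedtype homotopy.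
From mathcomp Require Import realfun trigo ring lra.
Import Defs.

Set Implicit Arguments.
Unset Strict Implicit.
Unset Printing Implicit Defensive.

Import Order.TTheory GRing.Theory Num.Theory.
Import numFieldNormedType.Exports.

Local Open Scope classical_set_scope.
Local Open Scope ring_scope.
Local Open Scope quotient_scope.

(** * Lifting paths of lines *)

(** The map is given by a relation, [stereo_graph], so that the existence of a value and its
    independence of all choices have to be proved too. Independence comes with the sign: every
    choice yields a braid of the same parity, and parity determines the class once [P_3/R] is known
    to have at most two elements. Existence would call for moving an arbitrary loop off a ray; as
    only two homotopy classes occur, turns about the vertical axis represent both, with strands on
    the equator. The morphism property likewise follows from order two, not from stacking braids.
    The two coverings, by quaternions and by square roots, are treated as one: a line is encoded by
    a positive multiple of its projector, and lifts are propagated by orthogonal projection, so no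
    local trivialization is constructed. The braid group is a group of isotopy classes of paths, so
    generation by the [sigma k] is not given and has to be extracted from a cover of the
    configuration space. Convexity of the cells makes the choice of a point in an intersection
    irrelevant, which leaves a finite computation on tables. *)

Section UnitIntervalInduction.
Context {R : realType}.
Local Notation I := (unitI R).

Lemma clamp_image : @clamp R @` `[0, 1] = [set: I].
Proof.
apply/seteqP; split=> [//|s _ /=]; exists (ival s); last by rewrite ivalK.
by rewrite /= in_itv /= ival_ge0 ival_le1.
Qed.

Lemma continuous_clamp : continuous (@clamp R).
Proof. by apply: (@continuous_clamp_comp R R idfun) => x; exact: cvg_id. Qed.

Lemma unitI_connected : connected [set: I].
Proof.
rewrite -clamp_image; apply: connected_continuous_connected.
  exact: segment_connected.
exact/continuous_subspaceT/continuous_clamp.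
Qed.

Lemma unitI_compact : compact [set: I].
Proof.
rewrite -clamp_image; apply: continuous_compact; last exact: segment_compact.
exact/continuous_subspaceT/continuous_clamp.
Qed.

(** Near every point [P] passes between any two parameters, in both orders, so that [P] and its
    complement are open and connectedness applies. No order on the interval is involved. *)
Lemma unitI_ind (P : I -> Prop) (s : I) :
  (forall t : I, \forall x \near t & y \near t, P x -> P y) -> P s -> forall t, P t.
Proof.
move=> locP Ps t.
suff PT : [set x | P x] = [set: I] by change ([set x | P x] t); rewrite PT.
have opP (Q : I -> Prop) : (forall t, Q t -> \forall u \near t, Q u) ->
    open [set x | Q x].
  by move=> QP; rewrite openE => x /QP; rewrite /interior.
have nP (u : I) : exists2 U, nbhs u U & forall x y, U x -> U y -> P x -> P y.
  have [[U V] /= [nU nV] UV] := locP u.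
  exists (U `&` V); first exact: filterI.
  by move=> x y [Ux _] [_ Vy]; exact: (UV (x, y)).
have := unitI_connected => /(_ [set x | P x]).
apply.
- by exists s.
- exists [set x | P x]; last by rewrite setTI.
  apply: opP => u Pu; have [U nU PU] := nP u.
  by apply: filterS (nU) => x Ux; apply: PU Pu => //; exact: (nbhs_singleton nU).
- exists [set x | P x]; last by rewrite setTI.
  rewrite -openC; apply: opP => u Pu; have [U nU PU] := nP u.
  apply: filterS (nU) => x Ux Px; apply: Pu; apply: PU Px => //.
  exact: (nbhs_singleton nU).
Qed.

(** This is the tube lemma, from compactness of the interval. *)
Lemma near_unitI_forall (T : topologicalType) (x : T) (P : I -> T -> Prop) :
  (forall s : I, \forall t \near s & y \near x, P t y) ->
  \forall y \near x, forall s, P s y.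
Proof.
move=> nP; have /compact_near_coveringP cI := unitI_compact.
have := cI T (nbhs x) (fun y s => P s y) (nbhs_filter x) (fun s _ => nP s).
by apply: filterS => y Py s; apply: Py.
Qed.

End UnitIntervalInduction.

Section Continuity.
Context {R : realType} {U : topologicalType}.
Implicit Types f g : U -> R.

Lemma cont_add f g : continuous f -> continuous g ->
  continuous (fun u => f u + g u).
Proof. by move=> cf cg u; apply: cvgD; [exact: cf|exact: cg]. Qed.

Lemma cont_mul f g : continuous f -> continuous g ->
  continuous (fun u => f u * g u).
Proof. by move=> cf cg u; apply: cvgM; [exact: cf|exact: cg]. Qed.

Lemma cont_opp f : continuous f -> continuous (fun u => - f u).
Proof. by move=> cf u; apply: cvgN; exact: cf. Qed.

Lemma cont_sub f g : continuous f -> continuous g ->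
  continuous (fun u => f u - g u).
Proof. by move=> cf cg; apply: cont_add => //; exact: cont_opp. Qed.

Lemma cont_cst (c : R) : continuous (fun _ : U => c).
Proof. exact: cst_continuous. Qed.

Lemma cont_inv f : (forall u, f u != 0) -> continuous f ->
  continuous (fun u => (f u)^-1).
Proof. by move=> f0 cf u; apply: cvgV; [exact: f0|exact: cf]. Qed.

Lemma cont_sum (J : Type) (r : seq J) (f : J -> U -> R) :
  (forall j, continuous (f j)) -> continuous (fun u => \sum_(j <- r) f j u).
Proof.
move=> cf; elim: r => [|j r IHr].
  by under eq_fun do rewrite big_nil; exact: cont_cst.
by under eq_fun do rewrite big_cons; exact: cont_add.
Qed.

Lemma cont_entry m n (f : U -> 'M[R]_(m, n)) i j :
  continuous f -> continuous (fun u => f u i j).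
Proof.
by move=> cf; exact: continuous_comp_fun cf (@coord_continuous _ _ _ i j).
Qed.

Lemma cont_mulmx m n p (f : U -> 'M[R]_(m, n)) (g : U -> 'M[R]_(n, p)) :
  continuous f -> continuous g -> continuous (fun u => f u *m g u).
Proof.
move=> cf cg; apply: continuous_mx => i j; under eq_fun do rewrite mxE.
by apply: cont_sum => k; apply: cont_mul; exact: cont_entry.
Qed.

Lemma cont_trmx m n (f : U -> 'M[R]_(m, n)) :
  continuous f -> continuous (fun u => (f u)^T).
Proof.
move=> cf; apply: continuous_mx => i j; under eq_fun do rewrite mxE.
exact: cont_entry.
Qed.

Lemma cont_mxtrace n (f : U -> 'M[R]_n) :
  continuous f -> continuous (fun u => \tr (f u)).
Proof. by move=> cf; apply: cont_sum => i; exact: cont_entry. Qed.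

Lemma cont_scalemx m n (k : U -> R) (f : U -> 'M[R]_(m, n)) :
  continuous k -> continuous f -> continuous (fun u => k u *: f u).
Proof.
move=> ck cf; apply: continuous_mx => i j; under eq_fun do rewrite mxE.
by apply: cont_mul => //; exact: cont_entry.
Qed.

Lemma cont_addmx m n (f g : U -> 'M[R]_(m, n)) :
  continuous f -> continuous g -> continuous (fun u => f u + g u).
Proof.
move=> cf cg; apply: continuous_mx => i j; under eq_fun do rewrite mxE.
by apply: cont_add; exact: cont_entry.
Qed.

Lemma near_gt0 f u : continuous f -> 0 < f u -> \forall v \near u, 0 < f v.
Proof.
move=> cf fu; have /cf : nbhs (f u) [set x : R | 0 < x] by exact: lt_nbhsr.
exact.
Qed.

Lemma open_gt0 f : continuous f -> open [set u | 0 < f u].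
Proof. by move=> cf; rewrite openE => u /= fu; exact: near_gt0. Qed.

End Continuity.

Lemma convex_gt0 (R : realFieldType) (c x y : R) : 0 <= c <= 1 ->
  0 < x -> 0 < y -> 0 < (1 - c) * x + c * y.
Proof.
move=> /andP[c0 c1] x0 y0; have [->|cn0] := eqVneq c 0.
  by rewrite subr0 mul1r mul0r addr0.
rewrite ltr_wpDl //; first by rewrite mulr_ge0 ?subr_ge0 // ltW.
by rewrite mulr_gt0 // lt_def cn0.
Qed.

Section Lines.
Context {R : realType} {n : nat}.
Implicit Types (e f g : 'rV[R]_n) (M : 'M[R]_n).

Definition posmul e f := exists2 c : R, 0 < c & f = c *: e.

(** A line of [R ^ n] is represented by the positive multiples of the orthogonal
    projection on it, so that [lifts] is the covering from the nonzero vectors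
    to the projective space. *)
Definition lifts e M := exists2 c : R, 0 < c & M = c *: (e^T *m e).
Definition line M := exists2 e, e != 0 & lifts e M.

Lemma posmul_refl e : posmul e e.
Proof. by exists 1; rewrite ?scale1r. Qed.

Lemma posmul_trans e f g : posmul e f -> posmul f g -> posmul e g.
Proof.
by move=> [c c0 ->] [d d0 ->]; exists (d * c); rewrite ?mulr_gt0 ?scalerA.
Qed.

Lemma posmul_sym e f : posmul e f -> posmul f e.
Proof.
move=> [c c0 ->]; exists c^-1; rewrite ?invr_gt0 // scalerA mulVf ?scale1r //.
by rewrite gt_eqF.
Qed.

Lemma dot_gt0 e : e != 0 -> 0 < (e *m e^T) 0 0.
Proof.
move=> e0; rewrite mxE lt_def; apply/andP; split; last first.
  by apply: sumr_ge0 => i _; rewrite mxE -expr2 sqr_ge0.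
apply: contraNneq e0 => /eqP; rewrite psumr_eq0; last first.
  by move=> i _; rewrite mxE -expr2 sqr_ge0.
move=> /allP h; apply/eqP/rowP => i; rewrite mxE; apply/eqP.
by have := h i (mem_index_enum i); rewrite mxE -expr2 sqrf_eq0.
Qed.

Lemma mulmx_outer e f g : e *m (f^T *m g) = (e *m f^T) 0 0 *: g.
Proof. by rewrite mulmxA [e *m f^T]mx11_scalar mul_scalar_mx [_%:M 0 0]mxE mulr1n. Qed.

Lemma line_neq0 M e : line M -> lifts e M -> e != 0.
Proof.
move=> [f f0 [d d0 ->]] [c c0 h]; apply: contraTneq (f0) => e0.
have := congr1 (mulmx f) h; rewrite e0 mulmx0 scaler0 mulmx0 -scalemxAr.
rewrite mulmx_outer => /eqP; rewrite !scaler_eq0 !gt_eqF ?dot_gt0 //= => ->.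
by [].
Qed.

Lemma liftsZ c e M : c != 0 -> lifts e M -> lifts (c *: e) M.
Proof.
move=> c0 [d d0 ->]; exists (d / c ^+ 2).
  by rewrite divr_gt0 // exprn_even_gt0.
by rewrite [(c *: e)^T]linearZ /= -scalemxAl -scalemxAr !scalerA; congr (_ *: _); field.
Qed.

(** Applying [M] to [f] gives a nonzero multiple of [f] by one expression of [M] and a multiple of
    [e] by the other. *)
Lemma lifts_uniq M e f : line M -> lifts e M -> lifts f M ->
  exists2 c : R, c != 0 & f = c *: e.
Proof.
move=> lM eM fM; have e0 := line_neq0 lM eM; have f0 := line_neq0 lM fM.
case: eM fM => c c0 -> [d d0] h.
have := congr1 (mulmx f) h; rewrite -!scalemxAr !mulmx_outer !scalerA.
have k0 : d * (f *m f^T) 0 0 != 0.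
  by rewrite mulf_neq0 ?gt_eqF // dot_gt0.
set k := d * _ in k0 *; set l := c * _ => kl.
have fE : f = (l / k) *: e.
  by rewrite mulrC -scalerA kl scalerA mulVf // scale1r.
exists (l / k) => //; apply: contraNneq f0 => lk0.
by rewrite fE lk0 scale0r.
Qed.

(** The trace is a positive multiple of the squared scalar product of directions of the two lines.
    If it is positive the lines are not orthogonal, and the projection of [e] does not vanish. *)
Lemma lifts_proj M M' e : line M' -> lifts e M ->
  0 < \tr (M *m M') -> lifts (e *m M') M'.
Proof.
move=> [f f0 [d d0 ->]] [c c0 ->] tr0.
rewrite -scalemxAr mulmx_outer scalerA.
apply: liftsZ; last by exists d.
apply: contraTneq tr0 => /eqP; rewrite mulf_eq0 gt_eqF //= => /eqP k0.
rewrite -scalemxAl -scalemxAr -mulmxA mulmx_outer k0 scale0r mulmx0 !scaler0.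
by rewrite mxtrace0 ltxx.
Qed.

Lemma lifts_projK M e : line M -> lifts e M -> posmul e (e *m M).
Proof.
move=> lM eM; have e0 := line_neq0 lM eM; case: eM => c c0 ->.
rewrite -scalemxAr mulmx_outer scalerA.
by eexists; last reflexivity; rewrite mulr_gt0 // dot_gt0.
Qed.

Lemma line_trace M : line M -> 0 < \tr (M *m M).
Proof.
move=> [e e0 [c c0 ->]]; rewrite -scalemxAl -scalemxAr !linearZ /=.
rewrite mulrA pmulr_rgt0 ?mulr_gt0 //.
rewrite -mulmxA mulmx_outer -scalemxAr linearZ /= mxtrace_mulC.
by rewrite [\tr _]big_ord1 mulr_gt0 // dot_gt0.
Qed.

End Lines.

Section Lifting.
Context {R : realType} {n : nat}.
Local Notation I := (unitI R).
Implicit Types (e f : I -> 'rV[R]_n) (w : I -> 'M[R]_n).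

Definition lift_path e w := continuous e /\ forall s, lifts (e s) (w s).

(* Projecting the lift of a path onto the lines of a uniformly close path lifts
   the latter. *)
Lemma lift_homotopy (h : I * I -> 'M[R]_n) e :
  continuous h -> (forall z, line (h z)) ->
  lift_path e (fun s => h (s, zero)) ->
  forall t, exists e', [/\ lift_path e' (fun s => h (s, t)),
    (forall t', h (zero, t') = h (zero, zero)) -> posmul (e zero) (e' zero) &
    (forall t', h (one, t') = h (one, zero)) -> posmul (e one) (e' one)].
Proof.
move=> ch lh le; apply: (@unitI_ind _ _ zero); last first.
  by exists e; split=> // _; exact: posmul_refl.
move=> t.
(* The trace is positive on the diagonal by [line_trace]; compactness makes the neighbourhood of
   [(t, t)] uniform in [s]. *)
have : \forall z \near (t, t), forall s, 0 < \tr (h (s, z.1) *m h (s, z.2)).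
  apply: near_unitI_forall => s.
  pose g (y : I * (I * I)) := \tr (h (y.1, y.2.1) *m h (y.1, y.2.2)).
  have cg : continuous g.
    apply: cont_mxtrace; apply: cont_mulmx; apply: continuous_comp_fun ch;
      apply: continuous_pair_fun; try exact: continuous_fst;
      apply: continuous_comp_fun (@continuous_snd _ _) _;
      [exact: continuous_fst | exact: continuous_snd].
  have := @near_gt0 _ _ g (s, (t, t)) cg (line_trace (lh (s, t))).
  exact: filterS.
apply: filterS => -[t1 t2] /= near12 [f [[cf lf] f0 f1]].
(* At an end where the line does not move, [f s] is projected onto its own line, which only rescales
   it by a positive factor. *)
have pf s : (forall t', h (s, t') = h (s, zero)) ->
    posmul (f s) (f s *m h (s, t2)).
  move=> hs; apply: lifts_projK; first exact: lh.
  by rewrite hs -(hs t1).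
exists (fun s => f s *m h (s, t2)); split.
- split; last first.
    by move=> s; apply: lifts_proj (lh _) (lf s) (near12 s).
  apply: cont_mulmx => //; apply: continuous_comp_fun ch.
  by apply: continuous_pair_fun; [move=> x; exact: cvg_id|exact: cst_continuous].
- by move=> hs; apply: posmul_trans (f0 hs) (pf _ hs).
- by move=> hs; apply: posmul_trans (f1 hs) (pf _ hs).
Qed.

Lemma path_lift w (e0 : 'rV[R]_n) : continuous w -> (forall s, line (w s)) ->
  lifts e0 (w zero) -> exists2 e, lift_path e w & posmul e0 (e zero).
Proof.
move=> cw lw le0.
(* The homotopy contracts [w] to its starting point, whose constant lift is then transported to [w]
   by [lift_homotopy]. *)
pose h (z : I * I) := w (clamp (ival z.1 * ival z.2)).
have ch : continuous h.
  apply: continuous_comp_fun cw; apply: continuous_clamp_comp.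
  apply: cont_mul; apply: continuous_comp_fun (@continuous_ival R);
    [exact: continuous_fst|exact: continuous_snd].
have h0 t : h (zero, t) = w zero by rewrite /h /= ival0 mul0r clamp_le0.
have h1 s : h (s, zero) = w zero by rewrite /h /= ival0 mulr0 clamp_le0.
have [|e [[ce le] e00 _]] :=
    @lift_homotopy h (fun=> e0) ch (fun z => lw _) _ one.
  by split=> [|s]; [exact: cst_continuous|rewrite h1].
exists e; last by apply: e00 => t; rewrite !h0.
by split=> // s; have := le s; rewrite /h /= ival1 mulr1 ivalK.
Qed.

(** Two lifts are proportional at each parameter, so their scalar product never vanishes and keeps
    its sign along the interval. *)
Lemma lift_path_uniq w e f : (forall s, line (w s)) ->
  lift_path e w -> lift_path f w ->
  posmul (e zero) (f zero) -> posmul (e one) (f one).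
Proof.
move=> lw [ce le] [cf lf].
pose g s := (e s *m (f s)^T) 0 0.
have cg : continuous g.
  by apply: cont_entry; apply: cont_mulmx => //; exact: cont_trmx.
have gP s : exists2 k, f s = k *: e s & g s = k * (e s *m (e s)^T) 0 0.
  have [c _ fE] := lifts_uniq (lw s) (le s) (lf s).
  by exists c => //; rewrite /g fE [(_ *: _)^T]linearZ /= -scalemxAr mxE.
have e0 s : 0 < (e s *m (e s)^T) 0 0 by apply/dot_gt0/(line_neq0 (lw s)).
have g0 s : g s != 0.
  have f0 := line_neq0 (lw s) (lf s); have [k fE ->] := gP s.
  rewrite mulf_neq0 ?(gt_eqF (e0 s)) //.
  by apply: contraNneq f0 => k0; rewrite fE k0 scale0r.
have posE s : posmul (e s) (f s) <-> 0 < g s.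
  split.
    move=> [c c0 fE]; rewrite /g fE [(_ *: _)^T]linearZ /= -scalemxAr mxE.
    exact: mulr_gt0.
  have [k fE ->] := gP s; rewrite pmulr_lgt0 // => k0; by exists k.
move=> ef0; apply: (@unitI_ind _ (fun s => posmul (e s) (f s)) zero) => // t.
have [gt|gt|gt] := ltgtP 0 (g t); last by move: (g0 t); rewrite -gt eqxx.
  have nt := near_gt0 cg gt; exists (setT, [set x | 0 < g x]).
    by split=> //; exact: filterT.
  by move=> [x y] /= [_ gy] _; apply/posE.
have nt : \forall x \near t, 0 < - g x.
  by apply: near_gt0; [exact: cont_opp|rewrite oppr_gt0].
exists ([set x | 0 < - g x], setT); first by split=> //; exact: filterT.
by move=> [x y] /= [gx _] /posE; rewrite ltNge ltW // -oppr_gt0.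
Qed.

Lemma lift_pathZ c e w : c != 0 -> lift_path e w ->
  lift_path (fun s => c *: e s) w.
Proof.
move=> c0 [ce le]; split=> [|s]; last exact: liftsZ.
by apply: cont_scalemx => //; exact: cont_cst.
Qed.

Lemma lift_path_cat e f w w' : lift_path e w -> lift_path f w' ->
  e one = f zero -> lift_path (cat_fun e f) (cat_fun w w').
Proof.
move=> [ce le] [cf lf] ef; split; first exact: continuous_cat.
by move=> s; rewrite /cat_fun; case: ifP.
Qed.

Lemma lift_path_rev e w : lift_path e w -> lift_path (rev_fun e) (rev_fun w).
Proof.
by move=> [ce le]; split; [exact: continuous_rev|move=> s; exact: le].
Qed.

End Lifting.

(** * Path classes and convex covers *)

Reserved Notation "x \;; y" (at level 40, left associativity).

Section PathClasses.
Context {R : realType} {T : topologicalType}.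
Local Notation path := (fun x y : T => {path unitI R from x to y}).

Section Classes.
Context (x y : T).

Definition homotopicb (p q : path x y) : bool := `[< homotopic p q >].

Lemma homotopicb_refl : reflexive homotopicb.
Proof. by move=> p; apply/asboolP/homotopic_refl/continuous_path. Qed.

Lemma homotopicb_sym : symmetric homotopicb.
Proof. by move=> p q; apply/asboolP/asboolP => /homotopic_sym. Qed.

Lemma homotopicb_trans : transitive homotopicb.
Proof.
by move=> q p r /asboolP pq /asboolP qr; apply/asboolP/(homotopic_trans pq qr).
Qed.

Canonical homotopicb_equiv :=
  EquivRel homotopicb homotopicb_refl homotopicb_sym homotopicb_trans.

Definition pclass : Type := {eq_quot homotopicb_equiv}.

Definition pcls (p : path x y) : pclass := \pi_{eq_quot homotopicb_equiv} p.
Definition prepr (a : pclass) : path x y :=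
  repr (a : {eq_quot homotopicb_equiv}).

Lemma preprK a : pcls (prepr a) = a. Proof. exact: reprK. Qed.

Lemma pclsP (p q : path x y) : homotopic p q <-> pcls p = pcls q.
Proof.
by split=> [pq|/eqmodP/asboolP//]; apply/eqmodP/asboolP.
Qed.

Lemma pcls_ext (p q : path x y) : p =1 q -> pcls p = pcls q.
Proof. by move=> pq; apply/pclsP/homotopic_eq => //; exact: continuous_path. Qed.

End Classes.

Definition pcomp x y z (a : pclass x y) (b : pclass y z) : pclass x z :=
  pcls (cat_path (prepr a) (prepr b)).
Definition pinv x y (a : pclass x y) : pclass y x := pcls (rev_path (prepr a)).
Definition pid x : pclass x x := pcls (cst_path x).

Local Notation "a \;; b" := (pcomp a b).

Lemma pcls_cat x y z (p : path x y) (q : path y z) :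
  pcls (cat_path p q) = pcls p \;; pcls q.
Proof.
apply/pclsP; apply: homotopic_cat; first by rewrite path_one path_zero.
  by apply/pclsP; rewrite preprK.
by apply/pclsP; rewrite preprK.
Qed.

Lemma pcls_rev x y (p : path x y) : pcls (rev_path p) = pinv (pcls p).
Proof. by apply/pclsP; apply: homotopic_rev; apply/pclsP; rewrite preprK. Qed.

Lemma pcompA x y z t (a : pclass x y) (b : pclass y z) (c : pclass z t) :
  a \;; (b \;; c) = a \;; b \;; c.
Proof.
rewrite -(preprK a) -(preprK b) -(preprK c) -!pcls_cat; apply/pclsP.
by apply: homotopic_catA; rewrite ?path_one ?path_zero //;
  exact: continuous_path.
Qed.

Lemma pcomp1p x y (a : pclass x y) : pid x \;; a = a.
Proof.
rewrite -(preprK a) -!pcls_cat; apply/pclsP.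
have := homotopic_cat_cstl (@continuous_path _ _ _ _ (prepr a)).
by rewrite path_zero.
Qed.

Lemma pcompp1 x y (a : pclass x y) : a \;; pid y = a.
Proof.
rewrite -(preprK a) -!pcls_cat; apply/pclsP.
have := homotopic_cat_cstr (@continuous_path _ _ _ _ (prepr a)).
by rewrite path_one.
Qed.

Lemma pcompV x y (a : pclass x y) : a \;; pinv a = pid x.
Proof.
rewrite -{1}(preprK a) -(preprK a) -pcls_rev -!pcls_cat; apply/pclsP.
have := homotopic_cat_revr (@continuous_path _ _ _ _ (prepr a)).
by rewrite path_zero preprK.
Qed.

Lemma pcompVp x y (a : pclass x y) : pinv a \;; a = pid y.
Proof.
rewrite -(preprK a) -pcls_rev -!pcls_cat; apply/pclsP.
have := homotopic_cat_revl (@continuous_path _ _ _ _ (prepr a)).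
by rewrite path_one.
Qed.

Lemma pcompVK x y z (a : pclass x y) (b : pclass y z) :
  pinv a \;; (a \;; b) = b.
Proof. by rewrite pcompA pcompVp pcomp1p. Qed.

Lemma pinv_uniq x y (a : pclass x y) b : a \;; b = pid x -> b = pinv a.
Proof. by move=> ab; rewrite -(pcompVK a b) ab pcompp1. Qed.

Lemma pinvM x y z (a : pclass x y) (b : pclass y z) :
  pinv (a \;; b) = pinv b \;; pinv a.
Proof.
by apply/esym/pinv_uniq; rewrite pcompA -(pcompA a) pcompV pcompp1 pcompV.
Qed.

End PathClasses.
Arguments pclass R {T} x y.
Notation "a \;; b" := (pcomp a b).

(** * Segments in convex cells *)

Section ConvexCells.
Context {R : realType} {m n : nat} {S : set 'M[R]_(m, n)}.
Local Notation I := (unitI R).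

Definition point (v : 'M[R]_(m, n)) (Sv : S v) : S :=
  @exist _ (fun u => u \in S) v (mem_set Sv).

Lemma continuous_point (U : topologicalType) (f : U -> 'M[R]_(m, n))
    (Sf : forall u, S (f u)) :
  continuous f -> continuous (fun u => point (Sf u)).
Proof. by move=> cf; exact: continuous_comp_initial. Qed.

Lemma continuous_sval (U : topologicalType) (f : U -> S) :
  continuous f -> continuous (fun u => \val (f u)).
Proof.
by move=> cf; apply: continuous_comp_fun cf _; exact: initial_continuous.
Qed.

Record convex_cell := ConvexCell {
  cell_set :> 'M[R]_(m, n) -> Prop;
  cell_convex : forall x y (c : R), 0 <= c <= 1 -> cell_set x -> cell_set y ->
    cell_set ((1 - c) *: x + c *: y);
  cell_sub : cell_set `<=` S
}.
Implicit Types (C D : convex_cell) (x y z : S).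

Definition interp (u v : 'M[R]_(m, n)) (t : I) := (1 - ival t) *: u + ival t *: v.

Lemma interp0 u v : interp u v zero = u.
Proof. by rewrite /interp ival0 subr0 scale1r scale0r addr0. Qed.

Lemma interp1 u v : interp u v one = v.
Proof. by rewrite /interp ival1 subrr scale1r scale0r add0r. Qed.

Lemma interp_id u t : interp u u t = u.
Proof. by rewrite /interp -scalerDl subrK scale1r. Qed.

Lemma cell_interp C u v t : C u -> C v -> C (interp u v t).
Proof. by apply: cell_convex; rewrite ival_ge0 ival_le1. Qed.

Lemma continuous_interp (U : topologicalType) (f g : U -> 'M[R]_(m, n))
    (h : U -> I) : continuous f -> continuous g -> continuous h ->
  continuous (fun u => interp (f u) (g u) (h u)).
Proof.
move=> cf cg ch; have chi := continuous_comp_fun ch (@continuous_ival R).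
apply: cont_addmx; apply: cont_scalemx => //.
by apply: cont_sub => //; exact: cont_cst.
Qed.

Lemma cell_homotopic C x y (p q : {path I from x to y}) :
  (forall s, C (\val (p s))) -> (forall s, C (\val (q s))) -> pcls p = pcls q.
Proof.
move=> Cp Cq; apply/pclsP.
pose f (u : I * I) := interp (\val (p u.1)) (\val (q u.1)) u.2.
have Sf u : S (f u) by apply/(@cell_sub C)/cell_interp.
exists (fun u => point (Sf u)); split.
- apply: continuous_point; apply: continuous_interp.
  + apply: continuous_sval; apply: continuous_comp_fun (@continuous_fst _ _) _.
    exact: continuous_path.
  + apply: continuous_sval; apply: continuous_comp_fun (@continuous_fst _ _) _.
    exact: continuous_path.
  + exact: continuous_snd.
- by move=> s; apply: val_inj; rewrite /= /f interp0.
- by move=> s; apply: val_inj; rewrite /= /f interp1.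
- by move=> t; apply: val_inj; rewrite /= /f /= !path_zero interp_id.
- by move=> t; apply: val_inj; rewrite /= /f /= !path_one interp_id.
Qed.

Section Segment.
Context (C : convex_cell) (x y : S) (Cx : C (\val x)) (Cy : C (\val y)).

Definition seg_fun (t : I) : S := point (cell_sub (cell_interp t Cx Cy)).

Lemma seg_continuous : continuous seg_fun.
Proof.
apply: continuous_point; apply: continuous_interp;
  [exact: cst_continuous..|by move=> t; exact: cvg_id].
Qed.

Lemma seg_zero : seg_fun zero = x.
Proof. by apply: val_inj; rewrite /= interp0. Qed.

Lemma seg_one : seg_fun one = y.
Proof. by apply: val_inj; rewrite /= interp1. Qed.

Definition seg : pclass R x y :=
  pcls (mk_path seg_continuous seg_zero seg_one : {path I from x to y}).

Lemma path_seg (p : {path I from x to y}) :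
  (forall s, C (\val (p s))) -> pcls p = seg.
Proof. by move=> Cp; apply: (cell_homotopic Cp) => s; exact: cell_interp. Qed.

End Segment.
Arguments seg C {x y} Cx Cy.

Lemma seg_comp C x y z (Cx : C (\val x)) (Cy : C (\val y)) (Cz : C (\val z)) :
  seg C Cx Cy \;; seg C Cy Cz = seg C Cx Cz.
Proof.
rewrite {1 2}/seg -pcls_cat; apply: path_seg => s.
by rewrite /= /mk_path /cat_fun; case: ifP => _; exact: cell_interp.
Qed.

Lemma seg_id C x (Cx : C (\val x)) : seg C Cx Cx = pid x.
Proof. by apply/esym/path_seg. Qed.

Lemma seg_inv C x y (Cx : C (\val x)) (Cy : C (\val y)) :
  pinv (seg C Cx Cy) = seg C Cy Cx.
Proof. by apply/esym/pinv_uniq; rewrite seg_comp seg_id. Qed.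

Lemma seg_cell C D x y (Cx : C (\val x)) (Cy : C (\val y)) (Dx : D (\val x))
  (Dy : D (\val y)) : seg C Cx Cy = seg D Dx Dy.
Proof. by apply: pcls_ext => s; exact: val_inj. Qed.

End ConvexCells.
Arguments convex_cell {R m n} S.
Arguments seg {R m n S} C {x y} Cx Cy.

(** * Generation of loops by the passages of a convex open cover *)

Section CellCover.
Context {R : realType} {m n : nat} {S : set 'M[R]_(m, n)}.
Local Notation I := (unitI R).
Context {J : Type} (C : J -> convex_cell S) (x0 : S) (c : J -> S).
Context (Cc : forall j, C j (\val (c j))) (delta : forall j, pclass R x0 (c j)).
Hypothesis C_open : forall j, open (C j).
Hypothesis C_cover : forall x : S, exists j, C j (\val x).
Context (K : pclass R x0 x0 -> Prop).
Hypothesis KM : forall a b, K a -> K b -> K (a \;; b).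
Hypothesis KV : forall a, K a -> K (pinv a).
Hypothesis K_base : forall j (Cx : C j (\val x0)),
  K (delta j \;; seg (C j) (Cc j) Cx).
Hypothesis K_meet : forall i j x (Ci : C i (\val x)) (Cj : C j (\val x)),
  K (delta i \;; seg (C i) (Cc i) Ci \;; (seg (C j) Cj (Cc j) \;; pinv (delta j))).

Variable w : {path I from x0 to x0}.

Lemma subpath_continuous t : continuous (fun s => w (clamp (ival s * ival t))).
Proof.
apply: continuous_comp_fun (@continuous_path _ _ _ _ w).
apply: continuous_clamp_comp; apply: cont_mul; last exact: cont_cst.
exact: continuous_ival.
Qed.

Lemma subpath_zero t : w (clamp (ival zero * ival t)) = x0.
Proof. by rewrite ival0 mul0r clamp_le0 // path_zero. Qed.

Lemma subpath_one t : w (clamp (ival one * ival t)) = w t.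
Proof. by rewrite ival1 mul1r ivalK. Qed.

Definition subpath t : {path I from x0 to w t} :=
  mk_path (@subpath_continuous t) (subpath_zero t) (subpath_one t).

(** The parameters [t] and [u] may come in either order, as required by [unitI_ind]. *)
Definition between (t u s : I) : I :=
  clamp ((1 - ival s) * ival t + ival s * ival u).

Lemma between0 t u : between t u zero = t.
Proof. by rewrite /between ival0 subr0 mul1r mul0r addr0 ivalK. Qed.

Lemma between1 t u : between t u one = u.
Proof. by rewrite /between ival1 subrr mul1r mul0r add0r ivalK. Qed.

Lemma continuous_between t u : continuous (between t u).
Proof.
apply: continuous_clamp_comp; apply: cont_add; apply: cont_mul;
  try exact: cont_cst; try exact: continuous_ival.
by apply: cont_sub; [exact: cont_cst|exact: continuous_ival].
Qed.

Lemma subpath_step j t u (Ct : C j (\val (w t))) (Cu : C j (\val (w u))) :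
  (forall s, C j (\val (w (between t u s)))) ->
  pcls (subpath u) = pcls (subpath t) \;; seg (C j) Ct Cu.
Proof.
move=> Cw.
have cw : continuous (fun s => w (between t u s)).
  exact: continuous_comp_fun (@continuous_between t u) (@continuous_path _ _ _ _ w).
have w0 : w (between t u zero) = w t by rewrite between0.
have w1 : w (between t u one) = w u by rewrite between1.
rewrite -(@path_seg _ _ _ _ _ _ _ Ct Cu (mk_path cw w0 w1)) // -pcls_cat.
apply/pclsP => /=.
rewrite /mk_path.
pose f (s : I) : I := clamp (ival s * ival u).
pose g := cat_fun (fun s => clamp (ival s * ival t)) (between t u).
have -> : cat_fun (fun s => w (clamp (ival s * ival t)))
    (fun s => w (between t u s)) = fun s => w (g s).
  by apply/funext => s; rewrite /g /cat_fun; case: ifP.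
have cl v : continuous (fun s : I => clamp (ival s * ival v)).
  apply: continuous_clamp_comp; apply: cont_mul; last exact: cont_cst.
  exact: continuous_ival.
apply: homotopic_reparamI.
- exact: continuous_path.
- exact: cl.
- apply: continuous_cat => //; first exact: continuous_between.
  by rewrite between0 ival1 mul1r ivalK.
- by rewrite /g cat_fun0 !ival0 !mul0r.
- by rewrite /g cat_fun1 between1 ival1 mul1r ivalK.
Qed.

Lemma near_cell j t : C j (\val (w t)) ->
  \forall u \near t & v \near t, forall s, C j (\val (w (between u v s))).
Proof.
move=> Ct.
(* Extending [w] to the real line by [clamp] replaces neighbourhoods in the interval by balls of the
   line, which are convex and so contain [between u v s]. *)
have cf : continuous (fun x : R => \val (w (clamp x))).
  apply: continuous_sval; apply: continuous_comp_fun (@continuous_clamp R) _.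
  exact: continuous_path.
have [e e0 we] : exists2 e : R, 0 < e &
    forall u, `|ival t - ival u| < e -> C j (\val (w u)).
  have : nbhs (ival t) [set x | C j (\val (w (clamp x)))].
    apply: (cf (ival t)); apply: open_nbhs_nbhs; split; first exact: C_open.
    by rewrite ivalK.
  move=> /nbhs_ballP [e /= e0 he]; exists e => // u /he.
  by rewrite /= ivalK.
have nb : nbhs t [set u : I | `|ival t - ival u| < e].
  have /= := @continuous_ival R t (ball (ival t) e).
  by apply; exact: nbhsx_ballx.
exists ([set u : I | `|ival t - ival u| < e], [set u : I | `|ival t - ival u| < e]).
  by [].
move=> [u v] /= [ue ve] s; apply: we;
have pos (x y : R) : 0 < x -> 0 < y -> 0 < (1 - ival s) * x + ival s * y.
  by apply: convex_gt0; rewrite ival_ge0 ival_le1.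
have nneg (x y : R) : 0 <= x -> 0 <= y -> 0 <= (1 - ival s) * x + ival s * y.
  by move=> xp yp; rewrite addr_ge0 // mulr_ge0 ?subr_ge0 ?ival_ge0 ?ival_le1.
have comb (a x y : R) : (1 - ival s) * (a - x) + ival s * (a - y) =
    a - ((1 - ival s) * x + ival s * y) by ring.
have comb' (a x y : R) : (1 - ival s) * (x - a) + ival s * (y - a) =
    (1 - ival s) * x + ival s * y - a by ring.
move: ue ve; rewrite distrC ltr_distl => ue; rewrite distrC ltr_distl => ve.
rewrite clampK.
  rewrite distrC ltr_distl -subr_gt0 -comb' -[X in _ && X]subr_gt0 -comb.
  by move: ue ve => /andP[? ?] /andP[? ?]; rewrite !pos ?subr_gt0.
rewrite nneg ?ival_ge0 //= -subr_ge0 -comb.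
by rewrite nneg ?subr_ge0 ?ival_le1.
Qed.

(** The property propagated along [w] is that the initial piece of [w], closed up through any cell
    containing its endpoint and the branch of that cell, lies in [K]. Moving inside one cell does
    not change the closed loop, and changing the cell multiplies it by an element given by
    [K_meet]. *)
Lemma cover_generation : K (pcls w).
Proof.
pose good t := forall j (Ct : C j (\val (w t))),
  K (pcls (subpath t) \;; (seg (C j) Ct (Cc j) \;; pinv (delta j))).
have good0 : good zero.
  move=> j Ct; have C0 : C j (\val x0) by rewrite -(path_zero (s := w)).
  rewrite pcompA.
  have -> : pcls (subpath zero) \;; seg (C j) Ct (Cc j) = seg (C j) C0 (Cc j).
    rewrite -pcls_cat; apply: path_seg => s; rewrite /= {1}/mk_path /cat_fun; case: ifP => _.
      by rewrite /= /mk_path ival0 mulr0 clamp_le0 // (path_zero (s := w)).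
    exact: cell_interp.
  by have := KV (K_base C0); rewrite pinvM seg_inv.
suff good1 : good one.
  have [j Cj] := C_cover (w one).
  have C1 : C j (\val x0) by rewrite -(path_one (s := w)).
  have := KM (good1 j Cj) (K_base C1).
  rewrite -!pcompA pcompVK !pcompA.
  suff -> : pcls (subpath one) \;; seg (C j) Cj (Cc j) =
      pcls w \;; seg (C j) C1 (Cc j).
    by rewrite -pcompA seg_comp seg_id pcompp1.
  rewrite -!pcls_cat; apply: pcls_ext => s; rewrite /= /mk_path /cat_fun; case: ifP => _.
    by rewrite /= /mk_path ival1 mulr1 ivalK.
  by apply: val_inj; rewrite /= (path_one (s := w)).
apply: (@unitI_ind _ good zero) => // t.
have [i Ci] := C_cover (w t).
apply: filterS (near_cell Ci) => -[u v] /= Cuv gu j Cv.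
have Cu : C i (\val (w u)) by have := Cuv zero; rewrite between0.
have Cv' : C i (\val (w v)) by have := Cuv one; rewrite between1.
have := KM (gu i Cu) (K_meet Cv' Cv).
rewrite (@subpath_step i u v Cu Cv') //.
by rewrite -!pcompA pcompVK !pcompA -(pcompA (pcls _) _ (seg _ _ _)) seg_comp.
Qed.

End CellCover.

Section StarCover.
Context {R : realType} {m n : nat} {S : set 'M[R]_(m, n)}.
Context {J : Type} (C : J -> convex_cell S) (o : J) (x0 : S).
Hypothesis C_open : forall j, open (C j).
Hypothesis C_cover : forall x : S, exists j, C j (\val x).
Hypothesis Co : C o (\val x0).
Hypothesis C_meet : forall i j, exists y : S,
  [/\ C o (\val y), C i (\val y) & C j (\val y)].

(** Since [C i] and [C j] are convex, the passage at [x] can be moved to a point [y] which also lies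
    in [C o]. There all the segments lie in one convex cell and cancel. *)
Lemma star_cover_simply_connected (w : {path unitI R from x0 to x0}) :
  pcls w = pid x0.
Proof.
have /choice [c cP] j : exists y : S, C o (\val y) /\ C j (\val y).
  by have [y [? ? _]] := C_meet j j; exists y.
have [co cj] := (fun j => (cP j).1, fun j => (cP j).2).
have Kb j (Cx : C j (\val x0)) :
    seg (C o) Co (co j) \;; seg (C j) (cj j) Cx = pid x0.
  by rewrite (seg_cell (cj j) Cx (co j) Co) seg_comp seg_id.
apply: (cover_generation (delta := fun j => seg (C o) Co (co j)) C_open C_cover
  (K := fun a => a = pid x0)) => //.
- by move=> a b -> ->; rewrite pcompp1.
- by move=> a ->; apply/esym/pinv_uniq; rewrite pcompp1.
move=> i j x Ci Cj; have [y [yo yi yj]] := C_meet i j.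
rewrite -(seg_comp (cj i) yi Ci) -(seg_comp Cj yj (cj j)).
rewrite (seg_cell (cj i) yi (co i) yo) (seg_cell yj (cj j) yo (co j)).
rewrite (seg_cell yi Ci yj Cj) !pcompA seg_comp.
by rewrite -(pcompA _ (seg _ yj Cj)) seg_comp seg_id pcompp1 seg_comp pcompV.
Qed.

End StarCover.

(** * Simple connectedness of the space of nonzero quaternions *)

Section PuncturedSpace.
Context {R : realType}.

Definition nonzero : set 'rV[R]_4 := [set v | v != 0].

(** The five half-spaces are dual to a simplex around the origin: they cover the punctured space and
    any three of them meet. The eight coordinate half-spaces also cover it, but opposite ones are
    disjoint. *)
Definition half_space (j : option 'I_4) : set 'rV[R]_4 :=
  [set v | if j is Some i then 0 < v 0 i else \sum_i v 0 i < 0].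

Lemma half_space_convex j x y (c : R) : 0 <= c <= 1 ->
  half_space j x -> half_space j y -> half_space j ((1 - c) *: x + c *: y).
Proof.
move=> c01.
case: j => [i|] /=; first by rewrite !mxE; exact: convex_gt0.
move=> x0 y0; have := convex_gt0 (x := - \sum_i x 0 i) (y := - \sum_i y 0 i) c01.
rewrite !oppr_gt0 => /(_ x0 y0) h; rewrite -oppr_gt0; move: h; congr (_ < _).
by rewrite !big_ord_recl !big_ord0 !mxE; ring.
Qed.

Lemma half_space_sub j : half_space j `<=` nonzero.
Proof.
move=> v hv; apply/eqP => v0; move: hv; rewrite v0; case: j => [i|] /=.
  by rewrite mxE ltxx.
by under eq_bigr do rewrite mxE; rewrite big1_eq ltxx.
Qed.

Definition half_cell j : convex_cell nonzero :=
  ConvexCell (half_space_convex (j := j)) (@half_space_sub j).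

Lemma half_space_open j : open (half_space j).
Proof.
have cv i : continuous (fun v : 'rV[R]_4 => v 0 i).
  exact: coord_continuous.
case: j => [i|]; first exact: open_gt0.
have := @open_gt0 _ _ (fun v : 'rV[R]_4 => - \sum_i v 0 i).
under eq_set do rewrite oppr_gt0.
by apply; apply: cont_opp; exact: cont_sum.
Qed.

Lemma half_space_cover (v : 'rV[R]_4) : nonzero v -> exists j, half_space j v.
Proof.
move=> v0; case: (pselect (exists i, 0 < v 0 i)) => [[i vi]|nv].
  by exists (Some i).
have vle i : v 0 i <= 0 by rewrite leNgt; apply/negP => vi; apply: nv; exists i.
exists None => /=; rewrite lt_def; apply/andP; split; last first.
  by apply: sumr_le0 => i _.
apply: contra_notN (_ : ~ (v == 0)) => [|/eqP]; last exact/eqP.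
rewrite eq_sym -oppr_eq0 -sumrN psumr_eq0; last by move=> i _; rewrite oppr_ge0.
move=> /allP h; apply/eqP/rowP => i; rewrite mxE; apply/eqP.
by rewrite -oppr_eq0; exact: (h i (mem_index_enum i)).
Qed.

Lemma half_space_meet i j : exists v : 'rV[R]_4,
  [/\ half_space (Some ord0) v, half_space i v & half_space j v].
Proof.
(* When the half-space of negative sum is among the three, at most two coordinates are 1, and the
   value [- 3] of the others makes the sum negative. *)
exists (\row_k if (k == ord0) || (Some k == i) || (Some k == j) then 1 else - 3).
split=> /=.
- by rewrite mxE eqxx.
- case: i => [i|]; first by rewrite /= mxE eqxx orbT.
  rewrite /= !big_ord_recl big_ord0 !mxE /=.
  by case: j => [[[|[|[|[|//]]]] ?]|] /=; lra.
- case: j => [j|]; first by rewrite /= mxE eqxx !orbT.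
  rewrite /= !big_ord_recl big_ord0 !mxE /=.
  by case: i => [[[|[|[|[|//]]]] ?]|] /=; lra.
Qed.

Definition quat1 : 'rV[R]_4 := \row_i (i == 0)%:R.

Lemma quat1_neq0 : nonzero quat1.
Proof.
by apply/eqP => /rowP /(_ 0) /eqP; rewrite !mxE eqxx oner_eq0.
Qed.

Lemma nonzero_simply_connected
    (w : {path unitI R from point quat1_neq0 to point quat1_neq0}) :
  pcls w = pid (point quat1_neq0).
Proof.
apply: (star_cover_simply_connected (C := half_cell) (o := Some ord0)).
- exact: half_space_open.
- by move=> x; apply: half_space_cover; have := valP x; rewrite inE.
- by rewrite /= mxE eqxx.
move=> i j; have [v [v0 vi vj]] := half_space_meet i j.
by exists (point (half_space_sub vi)).
Qed.

End PuncturedSpace.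

(** * Cells of configurations of three points *)

Variant direction := East | North | Southwest.

Definition direction_eqb (a b : direction) : bool :=
  match a, b with
  | East, East | North, North | Southwest, Southwest => true
  | _, _ => false
  end.

Lemma direction_eqP : Equality.axiom direction_eqb.
Proof. by do 2!case; constructor. Qed.

HB.instance Definition _ := hasDecEq.Build direction direction_eqP.

Definition directions := [:: East; North; Southwest].

Lemma mem_directions a : a \in directions. Proof. by case: a. Qed.

Definition cell_index : Type := (direction * direction * direction)%type.

Definition cell_indices : seq cell_index :=
  [seq (ab, c) | ab <- [seq (a, b) | a <- directions, b <- directions],
                 c <- directions].

Lemma mem_cell_indices (d : cell_index) : d \in cell_indices.
Proof. by case: d => [[[] []] []]. Qed.

Definition strand0 : 'I_3 := @Ordinal 3 0 isT.
Definition strand1 : 'I_3 := @Ordinal 3 1 isT.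
Definition strand2 : 'I_3 := @Ordinal 3 2 isT.

Lemma ord3P (i : 'I_3) : [\/ i = strand0, i = strand1 | i = strand2].
Proof.
case: i => [[|[|[|//]]] hi]; [apply: Or31|apply: Or32|apply: Or33];
  exact: val_inj.
Qed.

Section ConfigurationCells.
Context {R : realType}.
Implicit Types (a b : direction) (d e : cell_index) (x y : R).

(* Three linear forms with sum zero; their positive half-planes cover the
   punctured plane. *)
Definition face a x y : R :=
  match a with East => x | North => y | Southwest => - (x + y) end.

Definition pair_face a (i j : 'I_3) (X : 'M[R]_(3, 2)) : R :=
  face a (X j 0 - X i 0) (X j 1 - X i 1).

Definition in_cell d (X : 'M[R]_(3, 2)) : Prop :=
  [/\ 0 < pair_face d.1.1 strand0 strand1 X,
      0 < pair_face d.1.2 strand1 strand2 X &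
      0 < pair_face d.2 strand0 strand2 X].

Lemma face_cover x y : ~ (x = 0 /\ y = 0) -> exists a, 0 < face a x y.
Proof.
move=> xy0; have [x0|x0] := ltrP 0 x; first by exists East.
have [y0|y0] := ltrP 0 y; first by exists North.
exists Southwest => /=; rewrite lt_def; apply/andP; split; last lra.
by apply/eqP => s; apply: xy0; split; lra.
Qed.

Lemma pair_face_cover (i j : 'I_3) (X : 'M[R]_(3, 2)) :
  Conf R 3 X -> i != j -> exists a, 0 < pair_face a i j X.
Proof.
move=> cX ij; apply: face_cover => -[h0 h1].
have : row i X = row j X.
  apply/rowP => k; rewrite !mxE; case: k => [[|[|//]] hk] /=.
    by rewrite (_ : Ordinal hk = 0); [lra | exact: val_inj].
  by rewrite (_ : Ordinal hk = 1); [lra | exact: val_inj].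
by move/cX/eqP; rewrite (negPf ij).
Qed.

Lemma in_cell_cover (X : Conf R 3) : exists d, in_cell d (\val X).
Proof.
have cX : Conf R 3 (\val X) by exact: set_mem (valP X).
have [a ha] := pair_face_cover cX (isT : strand0 != strand1).
have [b hb] := pair_face_cover cX (isT : strand1 != strand2).
have [c hc] := pair_face_cover cX (isT : strand0 != strand2).
by exists (a, b, c).
Qed.

Lemma face_convex a x y x' y' (c : R) : 0 <= c <= 1 ->
  0 < face a x y -> 0 < face a x' y' ->
  0 < face a ((1 - c) * x + c * x') ((1 - c) * y + c * y').
Proof.
move=> c01 h h'; have := convex_gt0 c01 h h'; congr (_ < _).
by case: a {h h'} => //=; ring.
Qed.

Lemma pair_face_convex a (i j : 'I_3) (X Y : 'M[R]_(3, 2)) (c : R) :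
  0 <= c <= 1 -> 0 < pair_face a i j X -> 0 < pair_face a i j Y ->
  0 < pair_face a i j ((1 - c) *: X + c *: Y).
Proof.
move=> c01 h h'; have := face_convex c01 h h'; congr (0 < face a _ _).
  by rewrite !mxE; ring.
by rewrite !mxE; ring.
Qed.

Lemma in_cell_convex d (X Y : 'M[R]_(3, 2)) (c : R) : 0 <= c <= 1 ->
  in_cell d X -> in_cell d Y -> in_cell d ((1 - c) *: X + c *: Y).
Proof.
by move=> c01 [? ? ?] [? ? ?]; split; exact: pair_face_convex.
Qed.

Lemma pair_faceV a (i j : 'I_3) (X : 'M[R]_(3, 2)) :
  pair_face a j i X = - pair_face a i j X.
Proof. by rewrite /pair_face; case: a => /=; ring. Qed.

Lemma in_cell_conf d : in_cell d `<=` Conf R 3.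
Proof.
move=> X [h01 h12 h02] i j hij.
have hf a : pair_face a i j X = 0.
  have h k : X i k = X j k by move/rowP/(_ k): hij; rewrite !mxE.
  by rewrite /pair_face !h !subrr; case: a => /=; ring.
have hf' a : pair_face a j i X = 0 by rewrite pair_faceV hf oppr0.
have [ei|ei|ei] := ord3P i; have [ej|ej|ej] := ord3P j;
  rewrite ei ej // in hf hf' *; exfalso.
- by rewrite hf ltxx in h01.
- by rewrite hf ltxx in h02.
- by rewrite hf' ltxx in h01.
- by rewrite hf ltxx in h12.
- by rewrite hf' ltxx in h02.
- by rewrite hf' ltxx in h12.
Qed.

Definition conf_cell d : convex_cell (Conf R 3) :=
  ConvexCell (@in_cell_convex d) (@in_cell_conf d).

Lemma cont_pair_face a (i j : 'I_3) : continuous (pair_face a i j).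
Proof.
have ce k l : continuous (fun X : 'M[R]_(3, 2) => X k l) by exact: coord_continuous.
have cs k l h : continuous (fun X : 'M[R]_(3, 2) => X k h - X l h) by exact: cont_sub.
by case: a; [exact: cs|exact: cs|apply: cont_opp; exact: cont_add].
Qed.

Lemma in_cell_open d : open (in_cell d).
Proof.
have op a i j := open_gt0 (@cont_pair_face a i j).
rewrite (_ : in_cell d = [set X | 0 < pair_face d.1.1 strand0 strand1 X] `&`
  [set X | 0 < pair_face d.1.2 strand1 strand2 X] `&`
  [set X | 0 < pair_face d.2 strand0 strand2 X]).
  by apply: openI => //; exact: openI.
by apply/seteqP; split=> X /= => [[? ? ?]|[[? ?] ?]].
Qed.

(** The points [X] of a nonempty intersection of cells are on the positive sides
    of at most two of the three faces for each pair of strands, and the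
    direction missed by the pair of strands 0 and 2 is missed by one of the
    other two pairs. *)
Definition clique : Type := (direction * direction * bool)%type.

Definition cliques : seq clique :=
  [seq (ab, c) | ab <- [seq (a, b) | a <- directions, b <- directions],
                 c <- [:: true; false]].

(** The nested conditionals spare the remaining tests under call by value. *)
Definition in_clique (q : clique) d : bool :=
  if direction_eqb d.1.1 q.1.1 then false else
  if direction_eqb d.1.2 q.1.2 then false else
  ~~ direction_eqb d.2 (if q.2 then q.1.1 else q.1.2).

Lemma in_cliqueP (q : clique) d : in_clique q d ->
  [&& d.1.1 != q.1.1, d.1.2 != q.1.2 & d.2 != (if q.2 then q.1.1 else q.1.2)].
Proof.
rewrite /in_clique; case: ifP => // /negbT h1; case: ifP => // /negbT h2 h3.
by apply/and3P; split; [exact: h1|exact: h2|exact: h3].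
Qed.

Definition missing_vec a : R * R :=
  match a with East => (- 2, 1) | North => (1, - 2) | Southwest => (1, 1) end.

Lemma face_missing a b : face b (missing_vec a).1 (missing_vec a).2 =
  if b == a then - 2 else 1.
Proof. by case: a; case: b => /=; ring. Qed.

(** The differences of the pairs (0, 1), (1, 2) and (0, 2) are [k u], [l v] and [k u + l v]. The
    faces of [u] and [v] are [- 2] in the missed direction and 1 elsewhere, so the vector with
    weight 3 dominates: as [3 - 2 > 0], the sum is positive wherever the dominating vector is. *)
Definition sample_mx (q : clique) : 'M[R]_(3, 2) :=
  let u := missing_vec q.1.1 in let v := missing_vec q.1.2 in
  let k := if q.2 then 3 else 1 in let l := if q.2 then 1 else 3 in
  \matrix_(i, j) if i == strand0 then 0
    else k * (if j == 0 then u.1 else u.2) +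
      (if i == strand1 then 0 else l * (if j == 0 then v.1 else v.2)).

Lemma sample_in_cell q d : in_clique q d -> in_cell d (sample_mx q).
Proof.
case: q d => [[a b] t] [[d1 d2] d3] /in_cliqueP /and3P[/= h1 h2 h3].
have f1 := face_missing a d1; have f2 := face_missing b d2.
have f3 := face_missing a d3; have f4 := face_missing b d3.
rewrite (negPf h1) in f1; rewrite (negPf h2) in f2.
have lin f (k l : R) (u v : R * R) :
    face f (k * u.1 + l * v.1) (k * u.2 + l * v.2) =
    k * face f u.1 u.2 + l * face f v.1 v.2.
  by case: f => /=; ring.
have pf f i j : pair_face f i j (sample_mx (a, b, t)) =
    face f (sample_mx (a, b, t) j 0 - sample_mx (a, b, t) i 0)
           (sample_mx (a, b, t) j 1 - sample_mx (a, b, t) i 1) by [].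
rewrite /in_cell !pf !mxE /= !subr0 !addr0.
have lin1 f (k : R) (u : R * R) : face f (k * u.1) (k * u.2) = k * face f u.1 u.2.
  by case: f => /=; ring.
have sh (z w : R) : z + w - z = w by ring.
rewrite !sh !lin1 lin f1 f2 f3 f4 {pf}; case: t h3 => /= h3.
  by rewrite (negPf h3); split; do ?[case: ifP => _]; lra.
by rewrite (negPf h3); split; do ?[case: ifP => _]; lra.
Qed.

Definition meet_clique d e (q : clique) := in_clique q d && in_clique q e.

Lemma face_sum a (X : 'M[R]_(3, 2)) : pair_face a strand0 strand2 X =
  pair_face a strand0 strand1 X + pair_face a strand1 strand2 X.
Proof. by rewrite /pair_face; case: a => /=; ring. Qed.

(** If no clique contains both cells, then each direction is positive for the pair (0, 2): it is
    chosen there by one of the cells, or it is chosen for both other pairs, whose faces add up. This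
    is absurd because the three faces have sum zero. The combinatorial implication is checked on all
    pairs of indices. *)
Lemma in_cell_clique d e (X : 'M[R]_(3, 2)) : in_cell d X -> in_cell e X ->
  has (meet_clique d e) cliques.
Proof.
move=> [d01 d12 d02] [e01 e12 e02].
have nall : ~~ all (fun a => [|| a == d.2, a == e.2 |
    ((a == d.1.1) || (a == e.1.1)) && ((a == d.1.2) || (a == e.1.2))]) directions.
  apply/negP => /allP h.
  have pos a : 0 < pair_face a strand0 strand2 X.
    have /or3P[/eqP->|/eqP->|] := h a (mem_directions a) => //.
    by case/andP => /orP[]/eqP-> => /orP[]/eqP h'; rewrite face_sum;
      apply: addr_gt0; rewrite // h'.
  have := addr_gt0 (addr_gt0 (pos East) (pos North)) (pos Southwest).
  by rewrite /pair_face /= addrN ltxx.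
move: nall; apply: contraNT.
move: (mem_cell_indices d) (mem_cell_indices e).
suff : all (fun d => all (fun e => ~~ has (meet_clique d e) cliques ==>
    all (fun a => [|| a == d.2, a == e.2 |
    ((a == d.1.1) || (a == e.1.1)) && ((a == d.1.2) || (a == e.1.2))]) directions)
    cell_indices) cell_indices.
  by move=> /allP h /h /allP h' /h' /implyP.
by vm_compute.
Qed.

End ConfigurationCells.

(** Contrary to [has], [has_lazy] stops at the first witness under call by
    value. *)
Definition has_lazy (T : Type) (p : pred T) (s : seq T) : bool := (find p s < size s)%N.

Lemma has_lazyE (T : Type) (p : pred T) (s : seq T) : has_lazy p s = has p s.
Proof. by rewrite /has_lazy has_find. Qed.

(** * Tables indexed by pairs of cells *)

Section Tables.
Implicit Types (a b c : direction) (d e : cell_index).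

Definition triple (A : Type) : Type := (A * A * A)%type.
Definition triple_of (A : Type) (f : direction -> A) : triple A :=
  (f East, f North, f Southwest).
Definition entry (A : Type) (t : triple A) a : A :=
  match a with East => t.1.1 | North => t.1.2 | Southwest => t.2 end.

Lemma entry_triple (A : Type) (f : direction -> A) a : entry (triple_of f) a = f a.
Proof. by case: a. Qed.

Definition cell_triple (A : Type) : Type := triple (triple (triple A)).
Definition cell_triple_of (A : Type) (f : cell_index -> A) : cell_triple A :=
  triple_of (fun a => triple_of (fun b => triple_of (fun c => f (a, b, c)))).
Definition cell_entry (A : Type) (t : cell_triple A) d : A :=
  entry (entry (entry t d.1.1) d.1.2) d.2.

(** Nested tuples store the values computed at one round of closure, so that the next round looks
    them up instead of recomputing them. *)
Definition table : Type := cell_triple (cell_triple bool).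
Definition tabulate (F : cell_index -> cell_index -> bool) : table :=
  cell_triple_of (fun d => cell_triple_of (F d)).
Definition lookup (t : table) d e : bool := cell_entry (cell_entry t d) e.

Lemma lookup_tabulate F d e : lookup (tabulate F) d e = F d e.
Proof. by rewrite /lookup /cell_entry !entry_triple; case: d e => [[? ?] ?] [[]]. Qed.

End Tables.

(** * Branches, passages and their holonomy *)

Section CellGroupoid.
Context {R : realType}.
Implicit Types (d e f : cell_index) (x y : Conf R 3).
Local Notation C := (@conf_cell R).
Local Notation x0 := (base R 3).

Definition east : cell_index := (East, East, East).

Definition meet d e : Prop := exists y, in_cell d (\val y) /\ in_cell e (\val y).

Lemma meet_cliqueP d e : has (meet_clique d e) cliques -> meet d e.
Proof.
move=> /hasP[q _ /andP[qd qe]].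
by exists (point (in_cell_conf (sample_in_cell (R := R) qd))); split;
  exact: sample_in_cell.
Qed.

Lemma meet_clique3 d e f :
  has (fun q => meet_clique d e q && in_clique q f) cliques ->
  exists y, [/\ in_cell d (\val y), in_cell e (\val y) & in_cell f (\val y)].
Proof.
move=> /hasP[q _ /andP[/andP[qd qe] qf]].
by exists (point (in_cell_conf (sample_in_cell (R := R) qd))); split;
  exact: sample_in_cell.
Qed.

Lemma cell_center d : exists y, in_cell d (\val y).
Proof.
have [|y [yd _]] := @meet_cliqueP d d; last by exists y.
move: (mem_cell_indices d).
have /allP : all (fun d => has (meet_clique d d) cliques) cell_indices by vm_compute.
exact.
Qed.

Definition center d : Conf R 3 := sval (cid (cell_center d)).
Definition center_in d : C d (\val (center d)) := svalP (cid (cell_center d)).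

Definition crossing d e (h : meet d e) : pclass R (center d) (center e) :=
  seg (C d) (center_in d) (svalP (cid h)).1 \;;
  seg (C e) (svalP (cid h)).2 (center_in e).

(** The intersection of two cells is convex: the segment between [y] and [y'] lies in both and can
    be inserted and cancelled. *)
Lemma seg_meet x z d e y y' (xd : C d (\val x)) (yd : C d (\val y))
    (ye : C e (\val y)) (yd' : C d (\val y')) (ye' : C e (\val y'))
    (ze : C e (\val z)) :
  seg (C d) xd yd \;; seg (C e) ye ze = seg (C d) xd yd' \;; seg (C e) ye' ze.
Proof.
rewrite -(seg_comp xd yd' yd) -(seg_comp ye' ye ze) -!pcompA.
by rewrite (seg_cell yd' yd ye' ye).
Qed.

Lemma east_meet (c : direction) : meet east (East, East, c).
Proof. by apply: meet_cliqueP; case: c; vm_compute. Qed.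

Lemma east_meet2 (b c : direction) : meet (East, East, c) (East, b, c).
Proof. by apply: meet_cliqueP; case: b; case: c; vm_compute. Qed.

Lemma east_meet3 (a b c : direction) : meet (East, b, c) (a, b, c).
Proof. by apply: meet_cliqueP; case: a; case: b; case: c; vm_compute. Qed.

Lemma base_in_east : C east (\val x0).
Proof. by split; rewrite /pair_face !mxE /=; lra. Qed.

(** The spanning tree of cells is rooted at [east] and changes one direction at a time, for the pair
    (0, 2), then (1, 2), then (0, 1). Steps that change nothing are trivial crossings, so the
    formula is uniform in [d]. *)
Definition branch d : pclass R x0 (center d) :=
  let: (a, b, c) := d in
  seg (C east) base_in_east (center_in east) \;; crossing (east_meet c) \;;
  crossing (east_meet2 b c) \;; crossing (east_meet3 a b c).

Lemma crossingE d e (h : meet d e) y (yd : C d (\val y)) (ye : C e (\val y)) :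
  crossing h = seg (C d) (center_in d) yd \;; seg (C e) ye (center_in e).
Proof. exact: seg_meet. Qed.

Lemma crossing_id d (h : meet d d) : crossing h = pid (center d).
Proof. by rewrite (crossingE h (center_in d) (center_in d)) seg_comp seg_id. Qed.

Lemma branch_east : branch east = seg (C east) base_in_east (center_in east).
Proof. by rewrite /branch /= !crossing_id !pcompp1. Qed.

Lemma branch1 (a b c : direction) :
  branch (a, b, c) = branch (East, b, c) \;; crossing (east_meet3 a b c).
Proof. by rewrite /branch crossing_id pcompp1. Qed.

Lemma branch2 (b c : direction) :
  branch (East, b, c) = branch (East, East, c) \;; crossing (east_meet2 b c).
Proof. by rewrite /branch !crossing_id !pcompp1. Qed.

Lemma branch3 (c : direction) :
  branch (East, East, c) = branch east \;; crossing (east_meet c).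
Proof. by rewrite branch_east /branch !crossing_id !pcompp1. Qed.

Context {Q : groupType} (T : pclass R x0 x0 -> Q).
Hypothesis TM : forall a b, T (a \;; b) = (T a * T b)%g.

Lemma T1 : T (pid x0) = 1%g.
Proof.
have := TM (pid x0) (pid x0); rewrite pcompp1 => h.
by apply: (mulgI (T (pid x0))); rewrite -h mulg1.
Qed.

Lemma TV a : T (pinv a) = (T a)^-1%g.
Proof. by apply: (mulgI (T a)); rewrite -TM pcompV T1 mulgV. Qed.

(** The holonomy of a path ending in the cell [d], closed up along the tree of
    branches, and that of the passage from [d] to [e] through [y]. *)
Definition hol x (a : pclass R x0 x) d (xd : C d (\val x)) : Q :=
  T (a \;; (seg (C d) xd (center_in d) \;; pinv (branch d))).

Definition passage d e y (yd : C d (\val y)) (ye : C e (\val y)) : Q :=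
  hol (branch d \;; seg (C d) (center_in d) yd) ye.

Lemma hol_base : hol (pid x0) base_in_east = 1%g.
Proof. by rewrite /hol pcomp1p branch_east pcompV T1. Qed.

Lemma hol_move x y (a : pclass R x0 x) d (xd : C d (\val x)) (yd : C d (\val y)) :
  hol (a \;; seg (C d) xd yd) yd = hol a xd.
Proof. by rewrite /hol -pcompA (pcompA (seg _ _ _)) seg_comp. Qed.

Lemma hol_step x y (a : pclass R x0 x) d e (xd : C d (\val x))
    (yd : C d (\val y)) (ye : C e (\val y)) :
  hol (a \;; seg (C d) xd yd) ye = (hol a xd * passage yd ye)%g.
Proof.
rewrite /passage /hol -TM -!pcompA; congr (T (_ \;; _)).
by rewrite pcompVK (pcompA _ _ (_ \;; _)) seg_comp.
Qed.

Lemma hol_loop (a : pclass R x0 x0) : hol a base_in_east = T a.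
Proof. by rewrite /hol branch_east pcompV pcompp1. Qed.

Lemma passage_indep d e y y' (yd : C d (\val y)) (ye : C e (\val y))
    (yd' : C d (\val y')) (ye' : C e (\val y')) : passage yd ye = passage yd' ye'.
Proof.
rewrite /passage /hol -!pcompA; congr (T (_ \;; _)).
by rewrite !pcompA; congr (_ \;; _); exact: seg_meet.
Qed.

Lemma passage_id d y (yd : C d (\val y)) : passage yd yd = 1%g.
Proof.
by rewrite /passage hol_move /hol seg_id pcomp1p pcompV T1.
Qed.

Lemma passage_comp d e f y (yd : C d (\val y)) (ye : C e (\val y))
    (yf : C f (\val y)) : (passage yd ye * passage ye yf)%g = passage yd yf.
Proof.
rewrite /passage {1}/hol {1}/hol -TM /hol -!pcompA; congr (T (_ \;; (_ \;; _))).
by rewrite pcompVK pcompA seg_comp seg_id pcomp1p.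
Qed.

Lemma passageV d e y (yd : C d (\val y)) (ye : C e (\val y)) :
  passage ye yd = (passage yd ye)^-1%g.
Proof.
by apply: (mulgI (passage yd ye)); rewrite passage_comp passage_id mulgV.
Qed.

Lemma passage_branch d e (h : meet d e) y (yd : C d (\val y)) (ye : C e (\val y)) :
  branch e = branch d \;; crossing h -> passage yd ye = 1%g.
Proof.
move=> be; rewrite /passage /hol be (crossingE h yd ye).
by rewrite !pcompA pcompV T1.
Qed.

Variable A : Q.

(** The exponent of [sigma_1^2] in the passage from [d] to [e] counts the steps
    between [North] and [Southwest], with opposite signs for the pair (0, 1) and
    for the other two pairs of strands. *)
Definition up (a b : direction) : nat := (a == Southwest) && (b == North).

(** The signs are those imposed by the relators: [r_2] makes the passage from Southwest to North of
    the pair (1, 2) inverse to that of (0, 1), and [r_1] does the same for (0, 2). *)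
Definition label_pos d e : nat :=
  (up d.1.1 e.1.1 + up e.1.2 d.1.2 + up e.2 d.2)%N.
Definition label_neg d e : nat := label_pos e d.

Definition label d e : Q := (A ^+ label_pos d e * A ^- label_neg d e)%g.

Definition good d e : Prop :=
  forall y (yd : C d (\val y)) (ye : C e (\val y)), passage yd ye = label d e.

Lemma label_id d : label d d = 1%g.
Proof. by rewrite /label /label_neg mulgV. Qed.

Lemma labelV d e : label e d = (label d e)^-1%g.
Proof. by rewrite /label /label_neg invgM invgK. Qed.

Lemma frac_mul (m n m' n' k l : nat) : (m + m' + l = k + (n + n'))%N ->
  (A ^+ m * A ^- n * (A ^+ m' * A ^- n'))%g = (A ^+ k * A ^- l)%g.
Proof.
move=> h; have cm i j : (A ^+ i * A ^- j = (A ^+ j)^-1 * A ^+ i)%g.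
  by apply: (mulgI (A ^+ j)%g); rewrite mulKVg mulgA -expgnDr addnC expgnDr mulgK.
rewrite -!mulgA (mulgA (A ^- n)%g) -cm -!mulgA (mulgA (A ^+ m)%g) -expgnDr.
rewrite -invgM -expgnDr; apply: (mulIg (A ^+ l)%g).
rewrite mulgKV -mulgA -cm mulgA -expgnDr h.
by rewrite (addnC n) expgnDr mulgK.
Qed.

Lemma good_id d : good d d.
Proof. by move=> y yd yd'; rewrite label_id (passage_indep yd yd' yd yd) passage_id. Qed.

Lemma good_sym d e : good d e -> good e d.
Proof. by move=> de y yd ye; rewrite (labelV d e) passageV de. Qed.

(** A circuit through the three directions has nonzero exponent, but inside a clique each pair of
    strands uses only two directions, on which the exponent is additive. *)
Lemma label_trans d e f : has (fun q => meet_clique d e q && in_clique q f) cliques ->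
  (label d e * label e f)%g = label d f.
Proof.
move=> h; apply: frac_mul.
move: (mem_cell_indices d) (mem_cell_indices e) (mem_cell_indices f) h.
suff : all (fun d => all (fun e => all (fun f =>
    has (fun q => meet_clique d e q && in_clique q f) cliques ==>
    (label_pos d e + label_pos e f + label_neg d f ==
     label_pos d f + (label_neg d e + label_neg e f))%N)
  cell_indices) cell_indices) cell_indices.
  by move=> /allP h1 /h1 /allP h2 /h2 /allP h3 /h3 /implyP h4 /h4 /eqP.
by vm_compute.
Qed.

Lemma good_trans d e f : has (fun q => meet_clique d e q && in_clique q f) cliques ->
  good d e -> good e f -> good d f.
Proof.
move=> def de ef y yd yf; have [z [zd ze zf]] := meet_clique3 def.
rewrite (passage_indep yd yf zd zf) -(passage_comp zd ze zf) de ef.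
exact: label_trans.
Qed.

Definition clique3 d e f : bool :=
  has_lazy (fun q => if in_clique q d then if in_clique q e then in_clique q f
                     else false else false) cliques.

Lemma clique3P d e f : clique3 d e f ->
  has (fun q => meet_clique d e q && in_clique q f) cliques.
Proof.
rewrite /clique3 has_lazyE => /hasP[q qc h]; apply/hasP; exists q => //.
by rewrite /meet_clique; case: in_clique h => //; case: in_clique.
Qed.

Definition seed_table (s : seq (cell_index * cell_index)) : table :=
  tabulate (fun d e => [|| d == e, (d, e) \in s | (e, d) \in s]).

(** One round of deduction: the passage from [d] to [e] is known as soon as it factors through a
    cell [f] such that the three cells have a common point. *)
Definition close_table (t : table) : table :=
  tabulate (fun d e => if lookup t d e then true else
    has_lazy (fun f => if lookup t d f then if lookup t f e then clique3 d f e
                       else false else false) cell_indices).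

Definition tree_edges : seq (cell_index * cell_index) :=
  [seq ((East, d.1.2, d.2), d) | d <- cell_indices] ++
  [seq ((East, East, d.2), (East, d.1.2, d.2)) | d <- cell_indices] ++
  [seq (east, (East, East, d.2)) | d <- cell_indices].

Lemma tree_good p : p \in tree_edges -> good p.1 p.2.
Proof.
have lab d e : (label_pos d e + label_neg d e = 0)%N -> label d e = 1%g.
  by move=> /eqP; rewrite addn_eq0 => /andP[/eqP h /eqP h']; rewrite /label h h' mulgV.
rewrite !mem_cat => /or3P[] /mapP[[[a b] c] _ ->] y yd ye /=;
  rewrite lab; try by case: a yd ye; case: b; case: c.
- exact: passage_branch (branch1 a b c).
- exact: passage_branch (branch2 b c).
- exact: passage_branch (branch3 c).
Qed.

Lemma close_good (s : seq (cell_index * cell_index)) n :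
  (forall p, p \in s -> good p.1 p.2) ->
  forall d e, lookup (iter n close_table (seed_table (tree_edges ++ s))) d e -> good d e.
Proof.
move=> sg; elim: n => [|n IHn] d e.
  have sg' p : p \in tree_edges ++ s -> good p.1 p.2.
    by rewrite mem_cat => /orP[/tree_good|/sg].
  rewrite /= lookup_tabulate => /or3P[/eqP->|/sg'//|/sg' /good_sym//].
  exact: good_id.
rewrite iterS lookup_tabulate; case: ifP => [/IHn//|_].
rewrite has_lazyE => /hasP[f _]; case: ifP => // /IHn df; case: ifP => // /IHn fe.
by move=> /clique3P/good_trans; exact.
Qed.

End CellGroupoid.

(** * Generators of the pure braid group modulo R *)

Section CellPaths.
Context {R : realType} {m n : nat} {S : set 'M[R]_(m, n)}.
Local Notation I := (unitI R).
Implicit Types (C D E : convex_cell S).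

Lemma continuous_between_path (x y : S) (p : {path I from x to y}) t u :
  continuous (fun s => p (between t u s)).
Proof.
exact: continuous_comp_fun (@continuous_between _ t u) (@continuous_path _ _ _ _ p).
Qed.

Lemma path_cells C D E (x y : S) (p : {path I from x to y}) t u
    (Cx : C (\val x)) (Ct : C (\val (p t))) (Dt : D (\val (p t)))
    (Du : D (\val (p u))) (Eu : E (\val (p u))) (Ey : E (\val y)) :
  (forall s, C (\val (p (between zero t s)))) ->
  (forall s, D (\val (p (between t u s)))) ->
  (forall s, E (\val (p (between u one s)))) ->
  pcls p = seg C Cx Ct \;; seg D Dt Du \;; seg E Eu Ey.
Proof.
move=> Cp Dp Ep.
have p0 : p (between zero t zero) = x by rewrite between0 path_zero.
have pt v : p (between v t one) = p t by rewrite between1.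
have pt' v : p (between t v zero) = p t by rewrite between0.
have pu v : p (between v u one) = p u by rewrite between1.
have pu' v : p (between u v zero) = p u by rewrite between0.
have p1 : p (between u one one) = y by rewrite between1 path_one.
have c v w := @continuous_between_path x y p v w.
rewrite -(@path_seg _ _ _ _ C _ _ Cx Ct (mk_path (c zero t) p0 (pt zero))) //.
rewrite -(@path_seg _ _ _ _ D _ _ Dt Du (mk_path (c t u) (pt' u) (pu t))) //.
rewrite -(@path_seg _ _ _ _ E _ _ Eu Ey (mk_path (c u one) (pu' one) p1)) //.
rewrite -!pcls_cat; apply/pclsP; rewrite /= /mk_path.
pose g := cat_fun (cat_fun (between zero t) (between t u)) (between u one).
have -> : cat_fun (cat_fun (fun s => p (between zero t s))
    (fun s => p (between t u s))) (fun s => p (between u one s)) = fun s => p (g s).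
  by apply/funext => s; rewrite /g /cat_fun; case: ifP => // _; case: ifP.
have cb v w := @continuous_between R v w.
have b01 : between zero t one = between t u zero by rewrite between0 between1.
have b12 : cat_fun (between zero t) (between t u) one = between u one zero.
  by rewrite cat_fun1 between1 between0.
apply: (@homotopic_reparamI _ _ p id g).
- exact: continuous_path.
- by move=> s; exact: cvg_id.
- by apply: continuous_cat => //; exact: continuous_cat.
- by rewrite /g !cat_fun0 between0.
- by rewrite /g !cat_fun1 between1.
Qed.

End CellPaths.

(** * Cells visited by a twist *)

Section Twists.
Context {R : realType}.
Local Notation I := (unitI R).
Implicit Types (k : 'I_2) (u : I).

(** Direction from position [p] to position [q] in each of three successive
    phases of the twist of the positions [k] and [k + 1]. *)
Definition twist_dir (k p q phase : nat) : direction :=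
  if (p == k) && (q == k.+1) then (if phase == 0 then East else Southwest)
  else if (p == k.+1) && (q == k) then
    match phase with 0 => Southwest | 1 => North | _ => East end
  else if (p < q)%N then East else Southwest.

(** At time [x] the difference of the two twisted positions is [(1 - 2 x, - 2 x (1 - x))]. It is
    East for [x < 1/2] and Southwest for [x > 1 - sqrt 2 / 2], and [2/5] lies between these bounds.
    The opposite vector is Southwest up to [1/4 < 1 - sqrt 2 / 2], North up to [3/4], then East. *)
Definition phase_start (straight : bool) (phase : nat) : R :=
  match phase with
  | 0 => 0 | 1 => if straight then 2 / 5 else 1 / 4 | 2 => 3 / 4 | _ => 1
  end.

(** The lower numbered of the two twisted strands starts at position [k]. The direction between them
    then turns from East directly to Southwest, and phases 1 and 2 share a cell. *)
Definition straight (k : nat) (p : nat * nat * nat) : bool :=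
  [|| (p.1.1 == k) && (p.1.2 == k.+1), (p.1.2 == k) && (p.2 == k.+1) |
      (p.1.1 == k) && (p.2 == k.+1)].

Definition twist_cell (k : nat) (p : nat * nat * nat) (phase : nat) : cell_index :=
  (twist_dir k p.1.1 p.1.2 phase, twist_dir k p.1.2 p.2 phase,
   twist_dir k p.1.1 p.2 phase).

Definition positions (s : 'S_3) : nat * nat * nat :=
  (s strand0 : nat, s strand1 : nat, s strand2 : nat).

Lemma twist_pair_face k (p q : 'I_3) (c : bool) (phase : nat) (x : R) :
  p != q -> 0 <= x <= 1 -> (phase < 3)%N ->
  phase_start c phase <= x <= phase_start c phase.+1 ->
  ((p == k :> nat) && (q == k.+1 :> nat) -> c) ->
  ((p == k.+1 :> nat) && (q == k :> nat) -> ~~ c) ->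
  0 < face (twist_dir k p q phase) (twist_mx k x q 0 - twist_mx k x p 0)
    (twist_mx k x q 1 - twist_mx k x p 1).
Proof.
move=> pq /andP[x0 x1]; rewrite !mxE.
case: phase => [|[|[|//]]] _ /= /andP[];
case: k => [[|[|//]] hk]; case: p pq => [[|[|[|//]]] hp];
case: q => [[|[|[|//]]] hq] //= _; case: c => //= h h' c1 c2;
  rewrite ?c1 ?c2 //=; try (have := c1 isT; by []); try (have := c2 isT; by []);
  rewrite /twist_dir /=; nra.
Qed.

End Twists.

(** * Words in the generators and their traces in the cells *)

Section BraidWords.
Context {R : realType}.
Local Notation I := (unitI R).
Local Notation C := (@conf_cell R).
Local Notation x0 := (base R 3).
Implicit Types (k : 'I_2) (b : braid R 3) (s : 'S_3) (d : cell_index).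

Definition twist_braid k : braid R 3 :=
  Braid (mk_path (@twist_continuous R 2 k) (@twist_zero R 2 k) (@twist_one R 2 k)
         : {path I from x0 to relabel (twist_perm k) x0}).

Definition braid_word (w : seq 'I_2) : braid R 3 :=
  foldl (fun b k => braid_mul b (twist_braid k)) (braid_one (R := R)) w.

Lemma braid_classM b b' :
  braid_class (braid_mul b b') = (braid_class b * braid_class b')%g.
Proof. exact: (@class_ofM _ (@braid_pregroup R 3)). Qed.

Lemma braid_class_word (w : seq 'I_2) :
  braid_class (braid_word w) = (\prod_(k <- w) sigma k)%g.
Proof.
rewrite /braid_word -[RHS]mul1g -[X in (X * _)%g]/(braid_class (braid_one (R := R))).
elim: w (braid_one (R := R)) => [|k w IHw] b /=; first by rewrite big_nil mulg1.
by rewrite IHw big_cons braid_classM mulgA.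
Qed.

Lemma braid_class_homotopic b b' :
  homotopic (strands b) (strands b') -> braid_class b = braid_class b'.
Proof. by move=> h; apply/class_ofP/asboolP. Qed.

Lemma braid_class_ext b b' :
  strands b =1 strands b' -> braid_class b = braid_class b'.
Proof.
by move=> h; apply/braid_class_homotopic/homotopic_eq => //; exact: continuous_path.
Qed.

Lemma pure_class_ext (p : {path I from x0 to x0}) (x : pure_braid_group R 3) :
  pure_val x = braid_class (pure_braid p) -> x = pure_class p.
Proof. by move=> h; apply: val_inj. Qed.

Definition mod_class (a : pclass R x0 x0) : P3_mod_R R :=
  to_quotient (Rsub R) (pure_class (prepr a)).

Lemma mod_classE (p : {path I from x0 to x0}) :
  mod_class (pcls p) = to_quotient (Rsub R) (pure_class p).
Proof.
congr to_quotient; apply: pure_class_ext; apply: braid_class_homotopic.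
by have /pclsP := preprK (pcls p).
Qed.

Lemma to_quotientM (x y : pure_braid_group R 3) : to_quotient (Rsub R) (x * y)%g =
  (to_quotient (Rsub R) x * to_quotient (Rsub R) y)%g.
Proof. exact: (@class_ofM _ (quotient_pregroup (Rsub R))). Qed.

Lemma mod_classM (a b : pclass R x0 x0) : mod_class (a \;; b) = (mod_class a * mod_class b)%g.
Proof.
rewrite -(preprK a) -(preprK b) -pcls_cat !mod_classE -to_quotientM.
congr to_quotient; apply/esym/pure_class_ext.
rewrite /= -braid_classM; apply: braid_class_ext => u.
by rewrite /= /mk_path /cat_fun; case: ifP => // _; rewrite relabel1.
Qed.

Lemma pure_strands b : braid_perm b = 1%g ->
  exists p : {path I from x0 to x0}, p =1 strands b.
Proof.
case: b => s p /= s1; subst s.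
exists (mk_path (@continuous_path _ _ _ _ p) (path_zero (s := p))
  (etrans (path_one (s := p)) (relabel1 _))) => //.
Qed.

Lemma pure_surj (x : pure_braid_group R 3) : exists p, x = pure_class p.
Proof.
have [p pE] : exists p : {path I from x0 to x0}, p =1 strands (class_repr (pure_val x)).
  by apply: pure_strands; have := pure_valP x; rewrite inE => /eqP.
exists p; apply: pure_class_ext; rewrite -[LHS]class_reprK.
by apply: braid_class_ext => u; rewrite -pE.
Qed.

Local Notation hol := (hol mod_class).
Local Notation passage := (passage mod_class).

(** The passage depends on the two cells only, by [passage_indep]; 1 is a default value for cells
    that do not meet. *)
Definition crossing_class d e : P3_mod_R R :=
  if pselect (meet (R := R) d e) is left h
  then passage (svalP (cid h)).1 (svalP (cid h)).2 else 1%g.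

Lemma passageE d e y (yd : C d (\val y)) (ye : C e (\val y)) :
  passage yd ye = crossing_class d e.
Proof.
rewrite /crossing_class; case: pselect => [h|[]]; first exact: passage_indep.
by exists y.
Qed.

(** The upper end of the braid [b] is the base configuration relabelled by the
    positions [p] of its strands. *)
Definition traced b (p : nat * nat * nat) d (v : P3_mod_R R) : Prop :=
  positions (braid_perm b) = p /\
  exists xd : C d (\val (relabel (braid_perm b) x0)), hol (pcls (strands b)) xd = v.

Lemma hol_ext x y (p : {path I from x0 to x}) (q : {path I from x0 to y}) d
    (xd : C d (\val x)) (yd : C d (\val y)) : p =1 q ->
  hol (pcls p) xd = hol (pcls q) yd.
Proof.
move=> pq; have xy : x = y by rewrite -(path_one (s := p)) pq path_one.
subst y; rewrite (pcls_ext pq); congr hol; exact: Prop_irrelevance.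
Qed.

Lemma traced_one : traced (braid_one (R := R)) (0, 1, 2) east 1%g.
Proof.
split; first by rewrite /positions !perm1.
have xd : C east (\val (relabel 1 x0)) by rewrite relabel1; exact: base_in_east.
exists xd; rewrite -[RHS](hol_base mod_classM).
by rewrite -[pid x0]/(pcls _); exact: hol_ext.
Qed.

Lemma traced_pure b v (x : pure_braid_group R 3) :
  traced b (0, 1, 2) east v -> pure_val x = braid_class b ->
  v = to_quotient (Rsub R) x.
Proof.
move=> [pb [xd <-]] xb.
have b1 : braid_perm b = 1%g.
  apply/permP => i; rewrite perm1; apply: val_inj.
  by case: pb => p0 p1 p2; have [->|->|->] := ord3P i.
have [p pE] := pure_strands b1.
have -> : x = pure_class p.
  by apply: pure_class_ext; rewrite xb; exact/esym/braid_class_ext.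
rewrite -mod_classE -(hol_loop mod_class (pcls p)).
by apply: hol_ext => u; rewrite pE.
Qed.

Definition next_pos (k p : nat) : nat :=
  if p == k then k.+1 else if p == k.+1 then k else p.

Lemma twist_permE k (i : 'I_3) : twist_perm k i = next_pos k i :> nat.
Proof.
rewrite /twist_perm /next_pos.
have [ik|ik] := eqVneq (i : nat) k.
  have -> : i = widen_ord (leqnSn 2) k by exact: val_inj.
  by rewrite tpermL lift0.
have [ik1|ik1] := eqVneq (i : nat) k.+1.
  have -> : i = lift ord0 k by apply: val_inj; rewrite /= ik1.
  by rewrite tpermR.
rewrite tpermD //; apply/eqP => /(congr1 val) /= h.
  by move: ik; rewrite -h eqxx.
by move: ik1; rewrite -h /bump leq0n add1n eqxx.
Qed.

Lemma twist_in_cell k s (phase : nat) (u : I) :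
  (phase < 3)%N ->
  phase_start (straight k (positions s)) phase <= ival u ->
  ival u <= phase_start (straight k (positions s)) phase.+1 ->
  C (twist_cell k (positions s) phase) (\val (relabel s (twist_fun k u))).
Proof.
move=> ph uge ule.
have pair (i j : 'I_3) : i != j ->
    ((s i == k :> nat) && (s j == k.+1 :> nat) -> straight k (positions s)) ->
    ((s i == k.+1 :> nat) && (s j == k :> nat) -> ~~ straight k (positions s)) ->
    0 < pair_face (twist_dir k (s i) (s j) phase) i j
      (\val (relabel s (twist_fun k u))).
  move=> ij c1 c2; rewrite /pair_face.
  rewrite /= ![row_perm _ _ _ _]mxE.
  apply: (twist_pair_face _ _ _ _ c1 c2) => //.
  - by rewrite (inj_eq perm_inj).
  - by rewrite ival_ge0 ival_le1.
  - by rewrite uge ule.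
have n01 : s strand0 != s strand1 by rewrite (inj_eq perm_inj).
have n12 : s strand1 != s strand2 by rewrite (inj_eq perm_inj).
have n02 : s strand0 != s strand2 by rewrite (inj_eq perm_inj).
have neq (i j : 'I_3) : i != j -> (i : nat) != j by [].
split; apply: pair => //; rewrite /straight /positions /=;
  move: (neq _ _ n01) (neq _ _ n12) (neq _ _ n02);
  case: k {uge ule} => [[|[|//]] hk] /=;
  case: (s strand0) => [[|[|[|//]]] h0] /=;
  case: (s strand1) => [[|[|[|//]]] h1] /=;
  by case: (s strand2) => [[|[|[|//]]] h2].
Qed.

End BraidWords.

(** * Values of the passages modulo the relators *)

Section BraidHolonomy.
Context {R : realType}.
Local Notation I := (unitI R).
Local Notation C := (@conf_cell R).
Local Notation x0 := (base R 3).
Implicit Types (k : 'I_2) (b : braid R 3) (s : 'S_3) (d : cell_index).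
Local Notation hol := (hol (@mod_class R)).
Local Notation passage := (passage (@mod_class R)).
Local Notation crossing_class := (@crossing_class R).

Lemma between_bounds (t u s : I) : ival t <= ival u ->
  ival t <= ival (between t u s) <= ival u.
Proof.
move=> tu; have s0 := ival_ge0 s; have s1 := ival_le1 s.
have h1 : 0 <= ival s * (ival u - ival t) by rewrite mulr_ge0 ?subr_ge0.
have h2 : 0 <= (1 - ival s) * (ival u - ival t) by rewrite mulr_ge0 ?subr_ge0.
have t0 := ival_ge0 t; have u1 := ival_le1 u.
by rewrite clampK; apply/andP; split; lra.
Qed.

Lemma phase_bounds (c : bool) : [/\ 0 <= phase_start c 1 :> R,
  phase_start c 1 <= phase_start c 2 :> R & phase_start c 2 <= 1 :> R].
Proof. by case: c => /=; split; lra. Qed.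

Definition next_positions (k : nat) (p : nat * nat * nat) : nat * nat * nat :=
  (next_pos k p.1.1, next_pos k p.1.2, next_pos k p.2).

Lemma traced_step b p d v k : traced b p d v -> d = twist_cell k p 0 ->
  traced (braid_mul b (twist_braid k)) (next_positions k p) (twist_cell k p 2)
    (v * (crossing_class d (twist_cell k p 1) *
          crossing_class (twist_cell k p 1) (twist_cell k p 2)))%g.
Proof.
move=> [pb [xd <-]] dE; subst d; split.
  by rewrite -pb /positions /next_positions /= !permM !twist_permE.
set s := braid_perm b.
pose q : {path I from relabel s x0 to relabel (s * twist_perm k) x0} :=
  relabel_path s (strands (twist_braid k)).
have qE u : q u = relabel s (twist_fun k u) by [].
set c := straight k p; have [p1 p12 p2] := phase_bounds c.
pose t1 : I := clamp (phase_start c 1); pose t2 : I := clamp (phase_start c 2).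
have t1E : ival t1 = phase_start c 1 by apply: clampK; apply/andP; split; lra.
have t2E : ival t2 = phase_start c 2 by apply: clampK; apply/andP; split; lra.
have inq (ph : nat) u : (ph < 3)%N -> phase_start c ph <= ival u ->
    ival u <= phase_start c ph.+1 -> C (twist_cell k p ph) (\val (q u)).
  by move=> *; rewrite qE -pb; apply: twist_in_cell; rewrite ?pb.
have inb (ph : nat) t u r : (ph < 3)%N -> ival t = phase_start c ph ->
    ival u = phase_start c ph.+1 -> ival t <= ival u ->
    C (twist_cell k p ph) (\val (q (between t u r))).
  move=> ph3 tE uE tu; have /andP[? ?] := between_bounds r tu.
  by apply: inq; rewrite -?tE -?uE.
have in0 r : C (twist_cell k p 0) (\val (q (between zero t1 r))).
  by apply: inb; rewrite ?ival0 ?t1E.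
have in1 r : C (twist_cell k p 1) (\val (q (between t1 t2 r))).
  by apply: inb; rewrite ?t1E ?t2E.
have in2 r : C (twist_cell k p 2) (\val (q (between t2 one r))).
  by apply: inb; rewrite ?ival1 ?t2E.
have Ct : C (twist_cell k p 0) (\val (q t1)) by have := in0 one; rewrite between1.
have Dt : C (twist_cell k p 1) (\val (q t1)) by have := in1 zero; rewrite between0.
have Du : C (twist_cell k p 1) (\val (q t2)) by have := in1 one; rewrite between1.
have Eu : C (twist_cell k p 2) (\val (q t2)) by have := in2 zero; rewrite between0.
have Ey : C (twist_cell k p 2) (\val (relabel (s * twist_perm k) x0)).
  by have := in2 one; rewrite between1 (path_one (s := q)).
exists Ey; rewrite [pcls _](pcls_cat (strands b) q).
rewrite (path_cells xd Ct Dt Du Eu Ey in0 in1 in2) !pcompA.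
rewrite hol_move (hol_step (@mod_classM R)) (hol_step (@mod_classM R)).
by rewrite !passageE -mulgA.
Qed.


Lemma crossing_class_id d : crossing_class d d = 1%g.
Proof.
by rewrite -(passageE (center_in (R := R) d) (center_in d)) (passage_id (@mod_classM R)).
Qed.

Lemma traced_straight b p d v k e : traced b p d v ->
  d = twist_cell k p 0 -> e = twist_cell k p 1 -> e = twist_cell k p 2 ->
  traced (braid_mul b (twist_braid k)) (next_positions k p) e
    (v * crossing_class d e)%g.
Proof.
move=> bp d0 e1 e2; have := traced_step bp d0.
by rewrite -e1 -e2 crossing_class_id mulg1.
Qed.

Definition i0 : 'I_2 := ord0.
Definition i1 : 'I_2 := ord_max.

Lemma holonomy_s1s1 : traced (braid_word (R := R) [:: i0; i0]) (0, 1, 2) east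
  (crossing_class east (Southwest, East, East) *
   (crossing_class (Southwest, East, East) (North, East, East) *
    crossing_class (North, East, East) east))%g.
Proof.
have h1 := traced_straight (k := i0) (e := (Southwest, East, East))
  (traced_one (R := R)) erefl erefl erefl.
by have := traced_step (k := i0) h1 erefl; rewrite /= mul1g.
Qed.

Lemma holonomy_r1 : traced (braid_word (R := R) [:: i0; i1; i1; i0]) (0, 1, 2) east
  (crossing_class east (Southwest, East, East) *
   crossing_class (Southwest, East, East) (Southwest, East, Southwest) *
   (crossing_class (Southwest, East, Southwest) (Southwest, East, North) *
    crossing_class (Southwest, East, North) (Southwest, East, East)) *
   (crossing_class (Southwest, East, East) (North, East, East) *
    crossing_class (North, East, East) east))%g.
Proof.
have h1 := traced_straight (k := i0) (e := (Southwest, East, East))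
  (traced_one (R := R)) erefl erefl erefl.
have h2 := traced_straight (k := i1) (e := (Southwest, East, Southwest))
  h1 erefl erefl erefl.
have h3 := traced_step (k := i1) h2 erefl.
by have := traced_step (k := i0) h3 erefl; rewrite /= mul1g.
Qed.

Lemma holonomy_r2 : traced (braid_word (R := R) [:: i0; i0; i1; i1]) (0, 1, 2) east
  (crossing_class east (Southwest, East, East) *
   (crossing_class (Southwest, East, East) (North, East, East) *
    crossing_class (North, East, East) east) *
   crossing_class east (East, Southwest, East) *
   (crossing_class (East, Southwest, East) (East, North, East) *
    crossing_class (East, North, East) east))%g.
Proof.
have h1 := traced_straight (k := i1) (e := (East, Southwest, East))
  holonomy_s1s1 erefl erefl erefl.
exact: (traced_step (k := i1) h1 erefl).
Qed.

Lemma holonomy_r3 : traced (braid_word (R := R) [:: i1; i0; i0; i1]) (0, 1, 2) east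
  (crossing_class east (East, Southwest, East) *
   crossing_class (East, Southwest, East) (East, Southwest, Southwest) *
   (crossing_class (East, Southwest, Southwest) (East, Southwest, North) *
    crossing_class (East, Southwest, North) (East, Southwest, East)) *
   (crossing_class (East, Southwest, East) (East, North, East) *
    crossing_class (East, North, East) east))%g.
Proof.
have h1 := traced_straight (k := i1) (e := (East, Southwest, East))
  (traced_one (R := R)) erefl erefl erefl.
have h2 := traced_straight (k := i0) (e := (East, Southwest, Southwest))
  h1 erefl erefl erefl.
have h3 := traced_step (k := i0) h2 erefl.
by have := traced_step (k := i1) h3 erefl; rewrite /= mul1g.
Qed.

Lemma s1s1_pure : ((@sigma R 2 ord0) ^+ 2)%g \in @pure R 3.
Proof. by rewrite inE class_perm_sigma2. Qed.

Definition full_twist12 : P3_mod_R R := to_quotient (Rsub R) (PureBraid s1s1_pure).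
Local Notation A := full_twist12.

Lemma to_quotient_eq1 (x : pure_braid_group R 3) :
  to_quotient (Rsub R) x = 1%g <-> ns_set (Rsub R) x.
Proof.
rewrite -[1%g]/(to_quotient (Rsub R) 1%g); split.
  move=> /esym/class_ofP /=; rewrite /eq_mod => /asboolP.
  by rewrite invg1 mul1g.
move=> Rx; apply/esym/class_ofP/asboolP; by rewrite invg1 mul1g.
Qed.

Lemma Rsub_gen (x : pure_braid_group R 3) : [set r1 R; r2 R; r3 R] x ->
  ns_set (Rsub R) x.
Proof. by move=> hx N; apply. Qed.

Lemma prod_word (w : seq 'I_2) (v : P3_mod_R R) (x : pure_braid_group R 3) :
  traced (braid_word (R := R) w) (0, 1, 2) east v ->
  pure_val x = (\prod_(k <- w) sigma k)%g -> to_quotient (Rsub R) x = v.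
Proof.
by move=> tw xw; apply/esym/(traced_pure tw); rewrite braid_class_word.
Qed.

Lemma crossing_s1s1 :
  (crossing_class east (Southwest, East, East) *
   (crossing_class (Southwest, East, East) (North, East, East) *
    crossing_class (North, East, East) east))%g = A.
Proof.
apply/esym/(prod_word holonomy_s1s1).
by rewrite /= !big_cons big_nil mulg1 expg2.
Qed.

Lemma crossing_r1 :
  (crossing_class east (Southwest, East, East) *
   crossing_class (Southwest, East, East) (Southwest, East, Southwest) *
   (crossing_class (Southwest, East, Southwest) (Southwest, East, North) *
    crossing_class (Southwest, East, North) (Southwest, East, East)) *
   (crossing_class (Southwest, East, East) (North, East, East) *
    crossing_class (North, East, East) east))%g = 1%g.
Proof.
rewrite -(prod_word (x := r1 R) holonomy_r1).
  by apply/to_quotient_eq1/Rsub_gen; left; left.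
by rewrite /= !big_cons big_nil mulg1 expg2 !mulgA.
Qed.

Lemma crossing_r2 :
  (crossing_class east (Southwest, East, East) *
   (crossing_class (Southwest, East, East) (North, East, East) *
    crossing_class (North, East, East) east) *
   crossing_class east (East, Southwest, East) *
   (crossing_class (East, Southwest, East) (East, North, East) *
    crossing_class (East, North, East) east))%g = 1%g.
Proof.
rewrite -(prod_word (x := r2 R) holonomy_r2).
  by apply/to_quotient_eq1/Rsub_gen; left; right.
by rewrite /= !big_cons big_nil mulg1 !expg2 !mulgA.
Qed.

Lemma crossing_r3 :
  (crossing_class east (East, Southwest, East) *
   crossing_class (East, Southwest, East) (East, Southwest, Southwest) *
   (crossing_class (East, Southwest, Southwest) (East, Southwest, North) *
    crossing_class (East, Southwest, North) (East, Southwest, East)) *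
   (crossing_class (East, Southwest, East) (East, North, East) *
    crossing_class (East, North, East) east))%g = 1%g.
Proof.
rewrite -(prod_word (x := r3 R) holonomy_r3).
  by apply/to_quotient_eq1/Rsub_gen; right.
by rewrite /= !big_cons big_nil mulg1 !expg2 !mulgA.
Qed.

Local Notation good := (good (@mod_class R) A).

Lemma good_crossing d e : good d e -> meet (R := R) d e ->
  crossing_class d e = label A d e.
Proof. by move=> de [y [yd ye]]; rewrite -(passageE yd ye) de. Qed.

Lemma crossing_good d e : crossing_class d e = label A d e -> good d e.
Proof. by move=> de y yd ye; rewrite passageE. Qed.

Lemma close_crossing (s : seq (cell_index * cell_index)) n d e :
  (forall p, p \in s -> good p.1 p.2) -> clique3 d e e ->
  lookup (iter n close_table (seed_table (tree_edges ++ s))) d e ->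
  crossing_class d e = label A d e.
Proof.
move=> sg /clique3P dee h; apply: good_crossing.
  exact: (close_good (@mod_classM R) sg h).
by apply: meet_cliqueP; apply: sub_has dee => q /andP[].
Qed.

Lemma label1 d e : (label_pos d e == 0) && (label_neg d e == 0) -> label A d e = 1%g.
Proof. by rewrite /label => /andP[/eqP-> /eqP->]; rewrite mulgV. Qed.

(** No seed is used, since these values serve to compute the seeds themselves. *)
Lemma tree_crossing d e : clique3 d e e ->
  lookup (iter 2 close_table (seed_table (tree_edges ++ [::]))) d e ->
  (label_pos d e == 0) && (label_neg d e == 0) -> crossing_class d e = 1%g.
Proof. by move=> de h /label1 <-; apply: close_crossing de h. Qed.

Lemma tree_crossings : [/\
  crossing_class east (Southwest, East, East) = 1%g,
  crossing_class (North, East, East) east = 1%g,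
  crossing_class east (East, Southwest, East) = 1%g &
  crossing_class (East, North, East) east = 1%g] /\ [/\
  crossing_class (Southwest, East, East) (Southwest, East, Southwest) = 1%g,
  crossing_class (Southwest, East, North) (Southwest, East, East) = 1%g,
  crossing_class (East, Southwest, East) (East, Southwest, Southwest) = 1%g &
  crossing_class (East, Southwest, North) (East, Southwest, East) = 1%g].
Proof. by split; split; apply: tree_crossing; vm_compute. Qed.

(** There is one passage from Southwest to North for each pair of strands. Their values come from
    [sigma_1 ^ 2], [r_2] and [r_1] respectively, and [r_3] is kept for the relation [A * A = 1]. *)
Definition seeds : seq (cell_index * cell_index) :=
  [:: ((Southwest, East, East), (North, East, East));
      ((East, Southwest, East), (East, North, East));
      ((Southwest, East, Southwest), (Southwest, East, North))].

Lemma seed_good p : p \in seeds -> good p.1 p.2.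
Proof.
have [[h1 h2 h3 h4] [h5 h6 h7 h8]] := tree_crossings.
have a1 := crossing_s1s1; have a2 := crossing_r1; have a3 := crossing_r2.
rewrite h1 h2 mul1g mulg1 in a1.
rewrite h1 h2 h5 h6 a1 !mulg1 mul1g in a2.
rewrite h1 h2 h3 h4 a1 !mulg1 mul1g in a3.
have labV d e : label_pos d e == 0 -> label_neg d e == 1 -> label A d e = A^-1%g.
  by rewrite /label => /eqP-> /eqP->; rewrite mul1g.
rewrite !inE => /or3P[]/eqP-> /=; apply: crossing_good.
- by rewrite a1 /label invg1 mulg1.
- by rewrite labV //; apply: (mulgI A); rewrite a3 mulgV.
- by rewrite labV //; apply: (mulIg A); rewrite a2 mulVg.
Qed.

Definition complete_table (t : table) : bool :=
  all (fun d => all (fun e => if clique3 d e e then lookup t d e else true)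
    cell_indices) cell_indices.

(** Evaluation shows that eight rounds reach all pairs of meeting cells from the tree and the three
    seeds. *)
Lemma closure_complete :
  complete_table (iter 8 close_table (seed_table (tree_edges ++ seeds))).
Proof. by vm_compute. Qed.

Lemma good_all d e : good d e.
Proof.
move=> y yd ye; rewrite passageE.
move: closure_complete => /allP /(_ _ (mem_cell_indices d)).
move=> /allP /(_ _ (mem_cell_indices e)); case: ifP => [de h|/negP []].
  exact: close_crossing seed_good de h.
have := in_cell_clique yd ye; rewrite /clique3 has_lazyE.
by apply: sub_has => q; rewrite /meet_clique => /andP[-> ->].
Qed.

Lemma full_twist12_involutive : (A * A)%g = 1%g.
Proof.
have [[h1 h2 h3 h4] [h5 h6 h7 h8]] := tree_crossings.
(* Once all passages are known, the word of [r_3] reads [A^-1 * A^-1]. *)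
have a4 := crossing_r3.
have c d e : clique3 d e e -> crossing_class d e = label A d e.
  move=> /clique3P de; apply: good_crossing (@good_all d e) _.
  by apply: meet_cliqueP; apply: sub_has de => q /andP[].
have b1 : crossing_class (East, Southwest, Southwest) (East, Southwest, North) = A^-1%g.
  by rewrite c // /label mul1g.
have b2 : crossing_class (East, Southwest, East) (East, North, East) = A^-1%g.
  by rewrite c // /label mul1g.
rewrite h3 h4 h7 h8 b1 b2 !mulg1 mul1g in a4.
by apply: invg_inj; rewrite invgM a4 invg1.
Qed.

Lemma label_two d e : label A d e = 1%g \/ label A d e = A.
Proof.
have pow n : (A ^+ n)%g = 1%g \/ (A ^+ n)%g = A.
  elim: n => [|n IHn]; first by left.
  rewrite expgS; case: IHn => ->; rewrite ?mulg1; first by right.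
  by left; exact: full_twist12_involutive.
have AV : A^-1%g = A by apply: (mulgI A); rewrite mulgV full_twist12_involutive.
rewrite /label; case: (pow (label_pos d e)) => ->; case: (pow (label_neg d e)) => ->;
  rewrite ?invg1 ?AV ?mulg1 ?mul1g; by [left|right|left; exact: full_twist12_involutive].
Qed.

Theorem P3_mod_R_two (z : P3_mod_R R) : z = 1%g \/ z = A.
Proof.
have [x ->] : exists x, z = to_quotient (Rsub R) x.
  by exists (class_repr z); rewrite /to_quotient class_reprK.
have [w ->] := pure_surj x; rewrite -mod_classE.
pose K a := mod_class a = 1%g \/ mod_class a = A.
apply: (cover_generation (K := K) (@in_cell_open R) (@in_cell_cover R)
  (Cc := center_in (R := R)) (delta := @branch R)).
- move=> a b; rewrite /K mod_classM => -[->|->] [->|->]; rewrite ?mulg1 ?mul1g;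
    by [left|right|rewrite full_twist12_involutive; left].
- move=> a; rewrite /K (TV (@mod_classM R)) => -[->|->]; rewrite ?invg1; first by left.
  by right; apply: (mulgI A); rewrite mulgV full_twist12_involutive.
- move=> d xd.
  have := label_two d east; rewrite -(good_all xd base_in_east).
  by rewrite /passage hol_loop.
- move=> d e y yd ye; have := label_two d e; rewrite -(good_all yd ye).
  by [].
Qed.

End BraidHolonomy.

(** * Square root of the discriminant *)

Section SquareRoots.
Context {R : realType}.
Implicit Types (z w : R * R).

Definition cmul z w : R * R := (z.1 * w.1 - z.2 * w.2, z.1 * w.2 + z.2 * w.1).
Definition cnorm z : R := Num.sqrt (z.1 ^+ 2 + z.2 ^+ 2).
Definition crow z : 'rV[R]_2 := \row_j (if j == 0 then z.1 else z.2).

(** The line of the square roots of [z]. *)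
Definition sqrt_mx z : 'M[R]_2 := \matrix_(i, j)
  if i == j then (if i == 0 then cnorm z + z.1 else cnorm z - z.1) else z.2.

Lemma ord2P (i : 'I_2) : i = 0 \/ i = 1.
Proof. by case: i => [[|[|//]] hi]; [left|right]; exact: val_inj. Qed.

Lemma cnorm_sq z : cnorm z ^+ 2 = z.1 ^+ 2 + z.2 ^+ 2.
Proof. by rewrite sqr_sqrtr // addr_ge0 // sqr_ge0. Qed.

Lemma cnorm_ge0 z : 0 <= cnorm z. Proof. exact: sqrtr_ge0. Qed.

Lemma lifts_sqrt w z (k : R) : 0 < k -> cmul w w = (k * z.1, k * z.2) ->
  lifts (crow w) (sqrt_mx z).
Proof.
move=> k0 [h1 h2]; have nz : cnorm z = (w.1 ^+ 2 + w.2 ^+ 2) / k.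
  apply/eqP; rewrite -(eqrXn2 (n := 2)) ?cnorm_ge0 //; last first.
    by rewrite divr_ge0 ?addr_ge0 ?sqr_ge0 // ltW.
  rewrite cnorm_sq; apply/eqP.
  have -> : z.1 = (w.1 * w.1 - w.2 * w.2) / k by rewrite h1 mulrC mulKf ?gt_eqF.
  have -> : z.2 = (w.1 * w.2 + w.2 * w.1) / k by rewrite h2 mulrC mulKf ?gt_eqF.
  by field; rewrite gt_eqF.
have z1 : z.1 = (w.1 * w.1 - w.2 * w.2) / k by rewrite h1 mulrC mulKf ?gt_eqF.
have z2 : z.2 = (w.1 * w.2 + w.2 * w.1) / k by rewrite h2 mulrC mulKf ?gt_eqF.
exists (2 / k); first exact: divr_gt0.
apply/matrixP => i j; rewrite !mxE big_ord1 !mxE nz z1 z2.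
by have [->|->] := ord2P i; have [->|->] := ord2P j => /=; field; rewrite gt_eqF.
Qed.

Lemma sqrt_mx_line z : z != (0, 0) -> line (sqrt_mx z).
Proof.
move=> z0; have n0 : 0 < z.1 ^+ 2 + z.2 ^+ 2.
  rewrite lt_def addr_ge0 ?sqr_ge0 // andbT paddr_eq0 ?sqr_ge0 // !sqrf_eq0.
  by apply: contra z0; case: z => x y /= /andP[/eqP -> /eqP ->].
(* The square of [|z| + z] is [2 (|z| + Re z) z], so [|z| + z] spans the line of roots except on the
   negative real axis, where the imaginary unit does. *)
have [h|h] := ltrP 0 (cnorm z + z.1).
  exists (crow (cnorm z + z.1, z.2)).
    apply/eqP => /rowP /(_ 0); rewrite !mxE /= => h0.
    by move: h; rewrite h0 ltxx.
  apply: (@lifts_sqrt _ _ (2 * (cnorm z + z.1))); first by rewrite mulr_gt0.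
  rewrite /cmul /=; congr pair; last by ring.
  by have := cnorm_sq z; lra.
have nge := cnorm_ge0 z; have nsq := cnorm_sq z.
have z2 : z.2 = 0.
  apply/eqP; rewrite -sqrf_eq0 eq_le sqr_ge0 andbT.
  have : cnorm z ^+ 2 <= z.1 ^+ 2 by nra.
  by rewrite nsq; lra.
have z1 : z.1 < 0.
  by rewrite lt_def; apply/andP; split; [apply/eqP => h0; nra|lra].
exists (crow (0, 1)).
  by apply/eqP => /rowP /(_ 1) /eqP; rewrite !mxE /= oner_eq0.
apply: (@lifts_sqrt _ _ (- z.1)^-1); first by rewrite invr_gt0 oppr_gt0.
rewrite /cmul /= z2; congr pair; last by ring.
by field; rewrite lt_eqF.
Qed.

Lemma cont_sqrt_mx (U : topologicalType) (f : U -> R * R) :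
  continuous (fun u => (f u).1) -> continuous (fun u => (f u).2) ->
  continuous (fun u => sqrt_mx (f u)).
Proof.
move=> c1 c2; have cn : continuous (fun u => cnorm (f u)).
  have : continuous (fun u => (f u).1 ^+ 2 + (f u).2 ^+ 2).
    by apply: cont_add; under eq_fun do rewrite expr2; exact: cont_mul.
  by move=> c; exact: continuous_comp_fun c (@sqrt_continuous R).
apply: continuous_mx => i j; under eq_fun do rewrite mxE.
case: (i == j) => //; case: (i == 0); [exact: cont_add|exact: cont_sub].
Qed.

(** Right multiplication by [quarter_mx] is the multiplication by the imaginary
    unit. *)
Definition quarter_mx : 'M[R]_2 := \matrix_(i, j)
  if i == j then 0 else if i == 0 then 1 else - 1.
Local Notation J := quarter_mx.

Lemma crow_quarter z : crow z *m J = crow (- z.2, z.1).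
Proof.
apply/rowP => j; rewrite !mxE !big_ord_recl big_ord0 !mxE.
by have [->|->] := ord2P j => /=; ring.
Qed.

Lemma quarter2 : J ^+ 2 = - 1%:M.
Proof.
apply/matrixP => i j; rewrite expr2 !mxE !big_ord_recl big_ord0 !mxE.
by have [->|->] := ord2P i; have [->|->] := ord2P j => /=; ring.
Qed.

Lemma quarter4 : J ^+ 4 = 1%:M.
Proof. by rewrite (exprM J 2 2) quarter2 sqrrN expr1n. Qed.

Lemma lifts_quarter e z : lifts e (sqrt_mx z) ->
  lifts (e *m J) (sqrt_mx (- z.1, - z.2)).
Proof.
have nN : cnorm (- z.1, - z.2) = cnorm z by rewrite /cnorm /= !sqrrN.
move=> [c c0 h]; exists c => //.
have -> : sqrt_mx (- z.1, - z.2) = J^T *m sqrt_mx z *m J.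
  apply/matrixP => i j; rewrite !mxE !big_ord_recl big_ord0 !mxE.
  rewrite !big_ord_recl !big_ord0 !mxE nN.
  by have [->|->] := ord2P i; have [->|->] := ord2P j => /=; ring.
by rewrite h trmx_mul -scalemxAr -scalemxAl !mulmxA.
Qed.

End SquareRoots.

(** * Quarter turns of the root along paths of configurations *)

Section Discriminant.
Context {R : realType}.
Local Notation I := (unitI R).
Local Notation J := (@quarter_mx R).
Local Notation x0 := (base R 3).
Implicit Types (X : Conf R 3) (p q : I -> Conf R 3) (b : braid R 3) (k : 'I_2).

Definition strand_diff (i j : 'I_3) (X : 'M[R]_(3, 2)) : R * R :=
  (X i 0 - X j 0, X i 1 - X j 1).

(** This is the Vandermonde product, whose square is the usual discriminant: a relabelling of the
    strands may change its sign, and a half turn of two strands becomes a quarter turn of its square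
    root. *)
Definition discriminant (X : 'M[R]_(3, 2)) : R * R :=
  cmul (cmul (strand_diff strand0 strand1 X) (strand_diff strand0 strand2 X))
       (strand_diff strand1 strand2 X).

Definition disc_mx X : 'M[R]_2 := sqrt_mx (discriminant (\val X)).

Lemma cmul_eq0 (z w : R * R) : cmul z w = (0, 0) -> z = (0, 0) \/ w = (0, 0).
Proof.
case: z w => [a b] [c d] [/= h1 h2].
have : (a ^+ 2 + b ^+ 2) * (c ^+ 2 + d ^+ 2) = 0.
  transitivity ((a * c - b * d) ^+ 2 + (a * d + b * c) ^+ 2); first by ring.
  by rewrite h1 h2 expr0n addr0.
move=> /eqP; rewrite mulf_eq0 !paddr_eq0 ?sqr_ge0 // !sqrf_eq0.
by case/orP => /andP[/eqP -> /eqP ->]; [left|right].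
Qed.

Lemma strand_diff_neq0 (i j : 'I_3) X : i != j -> strand_diff i j (\val X) <> (0, 0).
Proof.
move=> ij [/eqP h0 /eqP h1]; move: h0 h1; rewrite !subr_eq0 => /eqP h0 /eqP h1.
suff : i = j by move/eqP; rewrite (negPf ij).
apply: (conf_inj (X := X)); apply/rowP => k; rewrite !mxE.
by have [->|->] := ord2P k.
Qed.

Lemma discriminant_neq0 X : discriminant (\val X) != (0, 0).
Proof.
apply/eqP => /cmul_eq0[/cmul_eq0[]|]; exact: strand_diff_neq0.
Qed.

Lemma disc_mx_line X : line (disc_mx X).
Proof. exact/sqrt_mx_line/discriminant_neq0. Qed.

Lemma cont_cmul (U : topologicalType) (f g : U -> R * R) :
  continuous (fun u => (f u).1) -> continuous (fun u => (f u).2) ->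
  continuous (fun u => (g u).1) -> continuous (fun u => (g u).2) ->
  continuous (fun u => (cmul (f u) (g u)).1) /\
  continuous (fun u => (cmul (f u) (g u)).2).
Proof.
by move=> *; split; [apply: cont_sub|apply: cont_add]; exact: cont_mul.
Qed.

Lemma continuous_disc_mx (U : topologicalType) (f : U -> Conf R 3) :
  continuous f -> continuous (fun u => disc_mx (f u)).
Proof.
move=> /continuous_sval cf.
have cd i j : continuous (fun u => (strand_diff i j (\val (f u))).1) /\
    continuous (fun u => (strand_diff i j (\val (f u))).2).
  by split; apply: cont_sub; exact: cont_entry.
have [d1 d2] := cd strand0 strand1; have [d3 d4] := cd strand0 strand2.
have [d5 d6] := cd strand1 strand2.
have [e1 e2] := cont_cmul d1 d2 d3 d4.
by have [g1 g2] := cont_cmul e1 e2 d5 d6; exact: cont_sqrt_mx.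
Qed.

Definition disc_path p (u : I) : 'M[R]_2 := disc_mx (p u).

(** The path [p] turns the square root of the discriminant by [n] quarter turns
    and a positive factor. *)
Definition quarter_turns (n : nat) p : Prop := exists2 e,
  lift_path e (disc_path p) & posmul (e zero *m J ^+ n) (e one).

Lemma posmulZ (c : R) (m : nat) (e f : 'rV[R]_m) :
  posmul e f -> posmul (c *: e) (c *: f).
Proof. by move=> [d d0 ->]; exists d => //; rewrite !scalerA mulrC. Qed.

Lemma posmul_mx (m m' : nat) (A : 'M[R]_(m, m')) e f :
  posmul e f -> posmul (e *m A) (f *m A).
Proof. by move=> [d d0 ->]; exists d => //; rewrite scalemxAl. Qed.

Lemma quarter_homotopic n p q : homotopic p q ->
  quarter_turns n p -> quarter_turns n q.
Proof.
move=> [h [ch h0 h1 hz ho]] [e [ce le] e01].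
have ch' : continuous (fun z => disc_mx (h z)) by exact: continuous_disc_mx.
have le' : lift_path e (fun s => disc_mx (h (s, zero))).
  by split=> // s; rewrite h0; exact: le.
have [f [[cf lf] f0 f1]] := lift_homotopy ch' (fun z => disc_mx_line _) le' one.
exists f; first by split=> // s; rewrite /disc_path -h1; exact: lf.
apply: posmul_trans (posmul_mx _ (posmul_sym (f0 _))) _.
  by move=> t; rewrite !hz.
by apply: posmul_trans e01 (f1 _) => t; rewrite !ho.
Qed.

Lemma disc_lift p e0 : continuous p -> lifts e0 (disc_mx (p zero)) ->
  exists2 e, lift_path e (disc_path p) & posmul e0 (e zero).
Proof.
move=> cp; apply: path_lift => [|s]; first exact: continuous_disc_mx.
exact: disc_mx_line.
Qed.

(* The lifts of the two pieces differ by a real factor where they meet. *)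
Lemma quarter_cat n m p q : quarter_turns n p -> quarter_turns m q ->
  p one = q zero -> quarter_turns (n + m) (cat_fun p q).
Proof.
move=> [e le e01] [f lf f01] pq.
have [c c0 fe] : exists2 c : R, c != 0 & e one = c *: f zero.
  apply: (lifts_uniq (disc_mx_line (q zero))); first exact: lf.2.
  by rewrite -pq; exact: le.2.
exists (cat_fun e (fun s => c *: f s)).
  have -> : disc_path (cat_fun p q) = cat_fun (disc_path p) (disc_path q).
    by apply/funext => s; rewrite /disc_path /cat_fun; case: ifP.
  by apply: lift_path_cat => //; exact: lift_pathZ.
rewrite cat_fun0 cat_fun1 exprD; apply: posmul_trans (posmulZ c f01).
by rewrite scalemxAl -fe mulmxA; exact: posmul_mx.
Qed.

Lemma discriminant_relabel (s : 'S_3) :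
  (forall X, discriminant (\val (relabel s X)) = discriminant (\val X)) \/
  (forall X, discriminant (\val (relabel s X)) =
    (- (discriminant (\val X)).1, - (discriminant (\val X)).2)).
Proof.
have n01 : s strand0 != s strand1 by rewrite (inj_eq perm_inj).
have n12 : s strand1 != s strand2 by rewrite (inj_eq perm_inj).
have n02 : s strand0 != s strand2 by rewrite (inj_eq perm_inj).
have [e0|e0|e0] := ord3P (s strand0); have [e1|e1|e1] := ord3P (s strand1);
  have [e2|e2|e2] := ord3P (s strand2); move: n01 n12 n02; rewrite e0 e1 e2 //= => _ _ _;
  by [left=> X; rewrite /discriminant /strand_diff /= !mxE e0 e1 e2 /cmul /=;
        congr pair; ring
     |right=> X; rewrite /discriminant /strand_diff /= !mxE e0 e1 e2 /cmul /=;
        congr pair; ring].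
Qed.

(** When the relabelling negates the product, multiplying the lift by the imaginary unit gives a
    lift for the relabelled path; this commutes with quarter turns. *)
Lemma quarter_relabel n (s : 'S_3) p : quarter_turns n p ->
  quarter_turns n (fun u => relabel s (p u)).
Proof.
move=> [e [ce le] e01].
have [h|h] := discriminant_relabel s.
  by exists e => //; split=> // u; rewrite /disc_path /disc_mx h; exact: le.
exists (fun u => e u *m J).
  split; first by apply: cont_mulmx => //; exact: cst_continuous.
  by move=> u; rewrite /disc_path /disc_mx h; exact: lifts_quarter (le u).
by rewrite -mulmxA -[J *m _]exprS exprSr mulmxA; exact: posmul_mx.
Qed.

Lemma quarter_braid_mul n m b b' : quarter_turns n (strands b) ->
  quarter_turns m (strands b') -> quarter_turns (n + m) (strands (braid_mul b b')).
Proof.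
move=> qb qb'; apply: quarter_cat => //; first exact: quarter_relabel.
by rewrite path_one path_zero.
Qed.

Lemma quarter_one : quarter_turns 0 (strands (braid_one (R := R))).
Proof.
have [e e0 le] := disc_mx_line x0; exists (fun=> e); last first.
  by rewrite mulmx1; exact: posmul_refl.
by split=> //; exact: cst_continuous.
Qed.

Lemma quarter_unique n m p : quarter_turns n p -> quarter_turns m p ->
  J ^+ n = - J ^+ m -> False.
Proof.
move=> [e le e01] [f lf f01] nm.
have [c c0 fe] := lifts_uniq (disc_mx_line _) (le.2 zero) (lf.2 zero).
have := lift_path_uniq (fun s => disc_mx_line (p s)) (lift_pathZ c0 le) lf.
rewrite fe => /(_ (posmul_refl _)) h.
have := posmul_trans (posmulZ c e01) (posmul_trans h (posmul_sym f01)).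
rewrite fe nm mulmxN -scalemxAl scalerN => -[d d0 /eqP].
rewrite scalerN -subr_eq0 opprK -{1}[c *: (_ *m _)]scale1r -scalerDl scaler_eq0.
rewrite gt_eqF /=; last by rewrite ltr_wpDr // ltW.
rewrite scaler_eq0 (negPf c0) /= => /eqP h0.
have e0 := line_neq0 (disc_mx_line _) (le.2 zero).
have := line_neq0 (disc_mx_line _) (lf.2 one); case: f01 => k k0 ->.
by rewrite fe -scalemxAl h0 !scaler0 eqxx.
Qed.

Lemma line_proj (n : nat) (M : 'M[R]_n) e0 : line M -> e0 *m M != 0 -> lifts (e0 *m M) M.
Proof.
move=> [f f0 [c c0 ->]]; rewrite -scalemxAr mulmx_outer scalerA => h.
apply: liftsZ; last by exists c.
by apply: contraNneq h => ->; rewrite scale0r.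
Qed.

(* The discriminant of a twist describes half a circle around the origin that
   avoids the negative imaginary axis, so that the square roots can be chosen on
   the same side of the orthogonal of [1 + i]. *)
Lemma quarter_twist k : quarter_turns 3 (strands (twist_braid (R := R) k)).
Proof.
pose e0 := crow ((1, 1) : R * R).
pose p : I -> Conf R 3 := twist_fun k.
have pE : (strands (twist_braid k) : I -> _) = p by [].
(* The first factor is the difference of the two twisted strands, the second the product of their
   differences with the third one. *)
have D u : let x := ival u in let y := x * (1 - x) in
    discriminant (\val (p u)) = cmul (2 * x - 1, 2 * y)
      ((2 - x) * (1 + x) + y ^+ 2, y * (1 - 2 * x)).
  rewrite /discriminant /strand_diff /= !mxE.
  by case: k @p pE => [[|[|//]] hk] p pE /=; rewrite /cmul /=; congr pair; ring.
rewrite pE; exists (fun u => e0 *m disc_mx (p u)).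
  split.
    apply: cont_mulmx; first exact: cst_continuous.
    exact/continuous_disc_mx/twist_continuous.
  move=> u; apply: line_proj; first exact: disc_mx_line.
  rewrite /disc_mx; move: (D u) (discriminant_neq0 (p u)).
  move: (discriminant _) => z /= zE z0.
  have n0 := cnorm_ge0 z; have n2 := cnorm_sq z.
  apply/eqP => /rowP h; move: (h 0) (h 1).
  rewrite !mxE !big_ord_recl !big_ord0 !mxE /= => h1 h2.
  have x1 : z.1 = 0 by lra.
  have y1 : z.2 = - cnorm z by lra.
  have ux0 := ival_ge0 u; have ux1 := ival_le1 u.
  move: x1 y1; rewrite zE /cmul /=; set x := ival u in ux0 ux1 *.
  set y := x * (1 - x) => x1 y1.
  have y0 : 0 <= y by rewrite mulr_ge0 ?subr_ge0.
  have A0 : 0 < (2 - x) * (1 + x) + y ^+ 2.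
    by apply: ltr_wpDr (sqr_ge0 _) _; apply: mulr_gt0; clear -ux0 ux1; lra.
  (* The real part of the product is [2 x - 1] times a positive factor. At its zero the imaginary
     part is positive, which contradicts [y1]. *)
  have x2 : x = 2^-1.
    have : (2 * x - 1) * ((2 - x) * (1 + x) + y ^+ 2 + 2 * y ^+ 2) = 0 by rewrite -x1; ring.
    move/eqP; rewrite mulf_eq0 => /orP[/eqP|/eqP]; first lra.
    by have := sqr_ge0 y; lra.
  have y2 : y = 4^-1 by rewrite /y x2; lra.
  have : (2 * x - 1) * (y * (1 - 2 * x)) + 2 * y * ((2 - x) * (1 + x) + y ^+ 2) <= 0.
    by rewrite y1 oppr_le0 cnorm_ge0.
  by rewrite y2 x2; lra.
have cn (a : R) : cnorm (a, 0) = `|a| by rewrite /cnorm /= expr0n addr0 sqrtr_sqr.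
have -> : e0 *m disc_mx (p zero) = crow (0, 4).
  apply/rowP => j; rewrite /disc_mx D ival0 /cmul /= !mxE !big_ord_recl big_ord0 !mxE.
  have -> : (2 * 0 - 1) * ((2 - 0) * (1 + 0) + (0 * (1 - 0)) ^+ 2) -
    2 * (0 * (1 - 0)) * (0 * (1 - 0) * (1 - 2 * 0)) = - 2 :> R by ring.
  have -> : (2 * 0 - 1) * (0 * (1 - 0) * (1 - 2 * 0)) + 2 * (0 * (1 - 0)) *
    ((2 - 0) * (1 + 0) + (0 * (1 - 0)) ^+ 2) = 0 :> R by ring.
  by rewrite cn normrN ger0_norm //; have [->|->] := ord2P j => /=; ring.
have -> : e0 *m disc_mx (p one) = crow (4, 0).
  apply/rowP => j; rewrite /disc_mx D ival1 /cmul /= !mxE !big_ord_recl big_ord0 !mxE.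
  have -> : (2 * 1 - 1) * ((2 - 1) * (1 + 1) + (1 * (1 - 1)) ^+ 2) -
    2 * (1 * (1 - 1)) * (1 * (1 - 1) * (1 - 2 * 1)) = 2 :> R by ring.
  have -> : (2 * 1 - 1) * (1 * (1 - 1) * (1 - 2 * 1)) + 2 * (1 * (1 - 1)) *
    ((2 - 1) * (1 + 1) + (1 * (1 - 1)) ^+ 2) = 0 :> R by ring.
  by rewrite cn ger0_norm //; have [->|->] := ord2P j => /=; ring.
(* The root goes from the direction of [i] to that of 1, a clockwise quarter turn, counted as three
   counterclockwise ones because exponents are natural numbers. *)
rewrite !exprS expr0 mulr1 !mulmxA !crow_quarter /= oppr0 opprK.
exact: posmul_refl.
Qed.

End Discriminant.

(** * Parity of pure braids *)

Section PureParity.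
Context {R : realType}.
Local Notation I := (unitI R).
Local Notation J := (@quarter_mx R).
Local Notation x0 := (base R 3).
Implicit Types (x y : pure_braid_group R 3) (b : braid R 3).

Definition turns (n : nat) x : Prop :=
  exists2 b, pure_val x = braid_class b & quarter_turns n (strands b).

Lemma turns_mul n m x y : turns n x -> turns m y -> turns (n + m) (x * y)%g.
Proof.
move=> [b xb qb] [b' yb' qb']; exists (braid_mul b b').
  by rewrite braid_classM -xb -yb'.
exact: quarter_braid_mul.
Qed.

Lemma quarter_mod4 n (p : I -> Conf R 3) : quarter_turns (n + 4) p -> quarter_turns n p.
Proof. by move=> [e le h]; exists e => //; move: h; rewrite exprD quarter4 mulr1. Qed.

Lemma turns_mod4 n x : turns (n + 4) x -> turns n x.
Proof. by move=> [b xb qb]; exists b => //; exact: quarter_mod4. Qed.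

Lemma turns_unique n m x : turns n x -> turns m x -> J ^+ n = - J ^+ m -> False.
Proof.
move=> [b xb qb] [b' xb' qb']; apply: quarter_unique qb _.
apply: quarter_homotopic qb'; apply/asboolP/(@class_ofP _ (@braid_pregroup R 3)).
by rewrite -[LHS]xb' -[RHS]xb.
Qed.

Lemma turns02 x : turns 0 x -> turns 2 x -> False.
Proof. by move=> t0 t2; apply: (turns_unique t0 t2); rewrite quarter2 opprK. Qed.

(** The strands of a pure braid form a loop of configurations, so both ends of a lift are square
    roots of the same number up to positive factors; the real factor between them is positive or
    negative. *)
Lemma turns_ex x : turns 0 x \/ turns 2 x.
Proof.
have [p xp] := pure_surj x; have [e0 _ le0] := disc_mx_line (p zero).
have [e le _] := disc_lift (@continuous_path _ _ _ _ p) le0.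
have [c c0 ce] : exists2 c : R, c != 0 & e one = c *: e zero.
  apply: (lifts_uniq (disc_mx_line (p zero))); first exact: le.2.
  by rewrite path_zero -(path_one (s := p)); exact: le.2.
have [c_gt|c_lt] : 0 < c \/ 0 < - c.
- by move: c0; rewrite neq_lt => /orP[h|h]; [right; rewrite oppr_gt0|left].
- left; exists (pure_braid p); first by rewrite xp.
  by exists e => //; exists c; rewrite ?expr0 ?mulmx1.
- right; exists (pure_braid p); first by rewrite xp.
  exists e => //; exists (- c) => //; rewrite quarter2 mulmxN mulmx1 scalerN.
  by rewrite scaleNr opprK.
Qed.

Lemma turns_one : turns 0 1%g.
Proof. by exists (braid_one (R := R)) => //; exact: quarter_one. Qed.

(** The dichotomy [turns_ex] replaces a computation of the lift along the inverse braid: the other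
    parity would make the identity odd. *)
Lemma turnsV x : turns 0 x -> turns 0 x^-1%g.
Proof.
move=> tx; have [//|t2] := turns_ex x^-1%g.
by have := turns_mul tx t2; rewrite mulgV => /(turns02 turns_one).
Qed.

Lemma turnsJ x y : turns 0 x -> turns 0 (x ^ y)%g.
Proof.
move=> tx; have [//|t2] := turns_ex (x ^ y)%g; exfalso.
have [ty|ty] := turns_ex y; have [tv|tv] := turns_ex y^-1%g.
- have := turns_mul tv (turns_mul tx ty); rewrite -conjgE => t0.
  exact: turns02 t0 t2.
- by have := turns_mul ty tv; rewrite mulgV => /(turns02 turns_one).
- by have := turns_mul ty tv; rewrite mulgV => /(turns02 turns_one).
- have := turns_mul tv (turns_mul tx ty); rewrite -conjgE => /(@turns_mod4 0) t0.
  exact: turns02 t0 t2.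
Qed.

Definition even_pure : normal_subgroup (pure_braid_group R 3) :=
  @NormalSubgroup (pure_braid_group R 3) [set x | turns 0 x] turns_one
    (fun x y => @turns_mul 0 0 x y) turnsV turnsJ.

Lemma quarter_word (w : seq 'I_2) :
  quarter_turns (3 * size w) (strands (braid_word (R := R) w)).
Proof.
suff fold b n : quarter_turns n (strands b) -> quarter_turns (n + 3 * size w)
    (strands (foldl (fun b k => braid_mul b (twist_braid (R := R) k)) b w)).
  exact: fold quarter_one.
elim: w b n => [|k w IHw] b n qb /=; first by rewrite muln0 addn0.
by rewrite mulnS addnA; apply: IHw; apply: quarter_braid_mul => //; exact: quarter_twist.
Qed.

Lemma turns_word (w : seq 'I_2) x :
  pure_val x = (\prod_(k <- w) sigma k)%g -> turns (3 * size w) x.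
Proof.
by move=> xw; exists (braid_word w); [rewrite braid_class_word|exact: quarter_word].
Qed.

Lemma Rsub_even x : ns_set (Rsub R) x -> turns 0 x.
Proof.
move=> Rx; apply: (Rx even_pure) => y /= hy.
(* Each relator has four letters, hence 12 quarter turns, which are removed four at a time. *)
apply/(@turns_mod4 0)/(@turns_mod4 4)/(@turns_mod4 8).
case: hy => [[->|->]|->].
- apply: (@turns_word [:: i0; i1; i1; i0]).
  by rewrite /= !big_cons big_nil mulg1 expg2 !mulgA.
- apply: (@turns_word [:: i0; i0; i1; i1]).
  by rewrite /= !big_cons big_nil mulg1 !expg2 !mulgA.
- apply: (@turns_word [:: i1; i0; i0; i1]).
  by rewrite /= !big_cons big_nil mulg1 expg2 !mulgA.
Qed.

Lemma turns_s1s1 : turns 2 (PureBraid (s1s1_pure (R := R))).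
Proof.
apply/(@turns_mod4 2)/(@turns_word [:: i0; i0]).
by rewrite /= !big_cons big_nil mulg1 expg2.
Qed.

(** As the quotient has no third element and [sigma_1 ^ 2] is odd, parity is a complete invariant of
    the class. *)
Lemma to_quotient_turns0 x : turns 0 x -> to_quotient (Rsub R) x = 1%g.
Proof.
move=> tx; have [//|h] := P3_mod_R_two (to_quotient (Rsub R) x).
have : ns_set (Rsub R) (x^-1 * PureBraid (s1s1_pure (R := R)))%g.
  by move/class_ofP: h => /asboolP.
move=> /Rsub_even t; have := turns_mul tx t; rewrite mulVKg => t0.
by have := turns02 t0 turns_s1s1.
Qed.

Lemma to_quotient_turns2 x : turns 2 x -> to_quotient (Rsub R) x = full_twist12.
Proof.
move=> tx; have [/to_quotient_eq1/Rsub_even t0|//] := P3_mod_R_two (to_quotient (Rsub R) x).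
by have := turns02 t0 tx.
Qed.

Lemma full_twist12_neq1 : full_twist12 <> 1%g :> P3_mod_R R.
Proof.
by move=> /to_quotient_eq1/Rsub_even t0; exact: turns02 t0 turns_s1s1.
Qed.

End PureParity.

(** * Rotations and quaternions *)

Notation c0 := strand0.
Notation c1 := strand1.
Notation c2 := strand2.

Section Davenport.
Context {R : realType}.
Implicit Types (q : 'rV[R]_4) (A : 'M[R]_3).

Definition k0 : 'I_4 := @Ordinal 4 0 isT.
Definition k1 : 'I_4 := @Ordinal 4 1 isT.
Definition k2 : 'I_4 := @Ordinal 4 2 isT.
Definition k3 : 'I_4 := @Ordinal 4 3 isT.

Lemma ord4P (i : 'I_4) : [\/ i = k0, i = k1, i = k2 | i = k3].
Proof.
case: i => [[|[|[|[|//]]]] hi]; [apply: Or41|apply: Or42|apply: Or43|apply: Or44];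
  exact: val_inj.
Qed.

Lemma sum3 (F : 'I_3 -> R) : \sum_i F i = F c0 + F c1 + F c2.
Proof.
rewrite !big_ord_recl big_ord0 addr0 addrA; congr (_ + _ + _); congr F; exact: val_inj.
Qed.

Lemma sum4 (F : 'I_4 -> R) : \sum_i F i = F k0 + F k1 + F k2 + F k3.
Proof.
rewrite !big_ord_recl big_ord0 addr0 !addrA.
by congr (_ + _ + _ + _); congr F; exact: val_inj.
Qed.

(** Davenport's matrix: if [A] is the rotation of the unit quaternion [q], then
    [davenport A] is [4 q^T q]. *)
Definition davenport_entry A (i j : nat) : R :=
  match i, j with
  | 0, 0 => 1 + A c0 c0 + A c1 c1 + A c2 c2
  | 1, 1 => 1 + A c0 c0 - A c1 c1 - A c2 c2
  | 2, 2 => 1 - A c0 c0 + A c1 c1 - A c2 c2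
  | 3, 3 => 1 - A c0 c0 - A c1 c1 + A c2 c2
  | 0, 1 | 1, 0 => A c2 c1 - A c1 c2
  | 0, 2 | 2, 0 => A c0 c2 - A c2 c0
  | 0, 3 | 3, 0 => A c1 c0 - A c0 c1
  | 1, 2 | 2, 1 => A c0 c1 + A c1 c0
  | 1, 3 | 3, 1 => A c0 c2 + A c2 c0
  | 2, 3 | 3, 2 => A c1 c2 + A c2 c1
  | _, _ => 0
  end.

Definition davenport A : 'M[R]_4 := \matrix_(i, j) davenport_entry A i j.

Definition rot_entry q (i j : nat) : R :=
  let a := q 0 k0 in let b := q 0 k1 in let c := q 0 k2 in let d := q 0 k3 in
  match i, j with
  | 0, 0 => a ^+ 2 + b ^+ 2 - c ^+ 2 - d ^+ 2
  | 0, 1 => 2 * (b * c - a * d)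
  | 0, 2 => 2 * (b * d + a * c)
  | 1, 0 => 2 * (b * c + a * d)
  | 1, 1 => a ^+ 2 - b ^+ 2 + c ^+ 2 - d ^+ 2
  | 1, 2 => 2 * (c * d - a * b)
  | 2, 0 => 2 * (b * d - a * c)
  | 2, 1 => 2 * (c * d + a * b)
  | 2, 2 => a ^+ 2 - b ^+ 2 - c ^+ 2 + d ^+ 2
  | _, _ => 0
  end.

Definition qnorm q : R := q 0 k0 ^+ 2 + q 0 k1 ^+ 2 + q 0 k2 ^+ 2 + q 0 k3 ^+ 2.

Definition rotation q : 'M[R]_3 := \matrix_(i, j) (rot_entry q i j / qnorm q).

Lemma qnorm_gt0 q : q != 0 -> 0 < qnorm q.
Proof. by move=> /dot_gt0; rewrite mxE sum4 !mxE. Qed.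

Lemma SO3_identities A : SO3 A ->
  [/\ (forall i j, A i c0 * A j c0 + A i c1 * A j c1 + A i c2 * A j c2 = (i == j)%:R),
      (forall i j, A c0 i * A c0 j + A c1 i * A c1 j + A c2 i * A c2 j = (i == j)%:R) &
      \det A = 1].
Proof.
move=> [AT dA]; split=> // i j.
  by have /matrixP /(_ i j) := AT; rewrite !mxE sum3 !mxE.
by have /matrixP /(_ i j) := mulmx1C AT; rewrite !mxE sum3 !mxE.
Qed.

Lemma det2 (M : 'M[R]_2) : \det M = M 0 0 * M 1 1 - M 0 1 * M 1 0.
Proof.
rewrite (expand_det_row _ 0) !big_ord_recl big_ord0 /cofactor !det_mx11 !mxE /=.
have -> : lift (0 : 'I_2) 0 = 1 by exact: val_inj.
have -> : lift (1 : 'I_2) 0 = 0 by exact: val_inj.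
by rewrite expr0 expr1; ring.
Qed.

Lemma lift3E : (lift c0 0 = c1) * (lift c0 1 = c2) * (lift c1 0 = c0) *
  (lift c1 1 = c2) * (lift c2 0 = c0) * (lift c2 1 = c1).
Proof. by do 5![apply: pair; last exact: val_inj]; exact: val_inj. Qed.

Lemma det3 A : \det A =
  A c0 c0 * (A c1 c1 * A c2 c2 - A c1 c2 * A c2 c1)
  - A c0 c1 * (A c1 c0 * A c2 c2 - A c1 c2 * A c2 c0)
  + A c0 c2 * (A c1 c0 * A c2 c1 - A c1 c1 * A c2 c0).
Proof.
rewrite (expand_det_row _ c0) sum3 /cofactor !det2 !mxE /=.
rewrite !lift3E.
by rewrite !exprS expr0; ring.
Qed.

Lemma rotation_SO3 q : q != 0 -> SO3 (rotation q).
Proof.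
move=> /qnorm_gt0 n0; have nz : qnorm q != 0 by rewrite gt_eqF.
split.
  apply/matrixP => i j; rewrite !mxE sum3 !mxE /qnorm in nz *.
  by have [->|->|->] := ord3P i; have [->|->|->] := ord3P j => /=; field.
by rewrite det3 !mxE /= /qnorm in nz *; field.
Qed.

Lemma SO3_cofactor A : SO3 A -> [/\
  [/\ A c0 c0 = A c1 c1 * A c2 c2 - A c1 c2 * A c2 c1,
   A c0 c1 = A c1 c2 * A c2 c0 - A c1 c0 * A c2 c2 &
   A c0 c2 = A c1 c0 * A c2 c1 - A c1 c1 * A c2 c0],
  [/\ A c1 c0 = A c2 c1 * A c0 c2 - A c2 c2 * A c0 c1,
   A c1 c1 = A c2 c2 * A c0 c0 - A c2 c0 * A c0 c2 &
   A c1 c2 = A c2 c0 * A c0 c1 - A c2 c1 * A c0 c0] &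
  [/\ A c2 c0 = A c0 c1 * A c1 c2 - A c0 c2 * A c1 c1,
   A c2 c1 = A c0 c2 * A c1 c0 - A c0 c0 * A c1 c2 &
   A c2 c2 = A c0 c0 * A c1 c1 - A c0 c1 * A c1 c0]].
Proof.
move=> [AT dA].
have adj : A^T = \adj A.
  have := mul_mx_adj A; rewrite dA => h.
  by rewrite -[LHS]mulmx1 -h mulmxA (mulmx1C AT) mul1mx.
have e i j : A i j = cofactor A i j by have /matrixP /(_ j i) := adj; rewrite !mxE.
split; split; rewrite [LHS]e /cofactor det2 !mxE /= !lift3E ?exprS ?expr0; ring.
Qed.

(** The vanishing of these minors expresses that the matrix has rank one. It follows from
    orthogonality and from the fact that a rotation equals its cofactor matrix. *)
Lemma davenport_minor A (i j k : 'I_4) : SO3 A ->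
  davenport A i j * davenport A k k = davenport A i k * davenport A j k.
Proof.
move=> sA; have [h1 h2 _] := SO3_identities sA.
have [[e1 e2 e3] [e4 e5 e6] [e7 e8 e9]] := SO3_cofactor sA.
have r00 := h1 c0 c0; have r01 := h1 c0 c1; have r02 := h1 c0 c2.
have r11 := h1 c1 c1; have r12 := h1 c1 c2; have r22 := h1 c2 c2.
have k00 := h2 c0 c0; have k01 := h2 c0 c1; have k02 := h2 c0 c2.
have k11 := h2 c1 c1; have k12 := h2 c1 c2.
rewrite /= in r00 r01 r02 r11 r12 r22 k00 k01 k02 k11 k12.
rewrite !mxE; clear h1 h2 sA.
have [->|->|->|->] := ord4P k; have [->|->|->|->] := ord4P i;
  have [->|->|->|->] := ord4P j => /=;
  (* Conjugation by diagonal half turns grades the entries of [A] by the unordered pair of their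
     indices, all diagonal entries having trivial degree. Each minor is homogeneous, and the
     identities of its degree suffice for [lra], with products as atoms. *)
  first [ clear -e2 e4 r01 k01; lra
        | clear -e3 e7 r02 k02; lra
        | clear -e6 e8 r12 k12; lra
        | clear -e1 e5 e9 r00 r11 r22 k00 k11; lra ].
Qed.
Lemma davenport_trace A : \tr (davenport A) = 4.
Proof. by rewrite /mxtrace sum4 !mxE /=; ring. Qed.

(** The trace is 4, so some diagonal entry is positive, and the row through it spans the line by
    [davenport_minor]. *)
Lemma davenport_line A : SO3 A -> line (davenport A).
Proof.
move=> sA; have [k hk] : exists k, 0 < davenport A k k.
  apply: contrapT => h; have le k : davenport A k k <= 0.
    by rewrite leNgt; apply/negP => hk; apply: h; exists k.
  have : \tr (davenport A) <= 0 by apply: sumr_le0 => i _.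
  by rewrite davenport_trace; lra.
exists (\row_j davenport A k j).
  by apply/eqP => /rowP /(_ k); rewrite [LHS]mxE [RHS]mxE => h; rewrite h ltxx in hk.
exists (davenport A k k)^-1; first by rewrite invr_gt0.
apply/matrixP => i j; rewrite [RHS]mxE [X in _ * X]mxE big_ord1.
rewrite [X in _ * (X * _)]mxE [X in _ * (X * _)]mxE [X in _ * (_ * X)]mxE.
have sym u v : davenport A u v = davenport A v u.
  by rewrite !mxE; have [->|->|->|->] := ord4P u; have [->|->|->|->] := ord4P v.
rewrite (sym k i) (sym k j) -(davenport_minor _ _ _ sA) mulrC.
by rewrite mulfK // gt_eqF.
Qed.

Lemma lifts_davenport q : q != 0 -> lifts q (davenport (rotation q)).
Proof.
move=> /qnorm_gt0 n0; exists (4 / qnorm q); first exact: divr_gt0.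
have nz : qnorm q != 0 by rewrite gt_eqF.
apply/matrixP => i j; rewrite [RHS]mxE [X in _ * X]mxE big_ord1 [X in _ * (X * _)]mxE.
rewrite !mxE /qnorm in nz *.
by have [->|->|->|->] := ord4P i; have [->|->|->|->] := ord4P j => /=;
  rewrite !mxE /= /qnorm; field.
Qed.

Lemma lifts_rotation A q : lifts q (davenport A) -> A = rotation q.
Proof.
move=> [c c_gt0 h]; have e i j : davenport A i j = c * (q 0 i * q 0 j).
  by rewrite h [LHS]mxE [X in _ * X]mxE big_ord1 [X in _ * (X * _)]mxE.
have n4 : c * qnorm q = 4.
  by rewrite -(davenport_trace A) /mxtrace sum4 !e /qnorm; ring.
have nz : qnorm q != 0.
  by apply/eqP => n0; move: n4; rewrite n0 mulr0; lra.
have cE : c = 4 / qnorm q by rewrite -n4 mulfK.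
apply/matrixP => i j; rewrite [RHS]mxE; move: cE; move: (qnorm q)^-1 => s cE.
have e0 := e k0 k0; have e1 := e k1 k1; have e2 := e k2 k2; have e3 := e k3 k3.
have e01 := e k0 k1; have e02 := e k0 k2; have e03 := e k0 k3.
have e12 := e k1 k2; have e13 := e k1 k3; have e23 := e k2 k3.
rewrite cE !mxE /= in e0 e1 e2 e3 e01 e02 e03 e12 e13 e23.
by have [->|->|->] := ord3P i; have [->|->|->] := ord3P j => /=;
  first [clear -e01 e23; lra | clear -e02 e13; lra | clear -e03 e12; lra
        | clear -e0 e1 e2 e3; lra].
Qed.

End Davenport.

(** * Lifting loops of rotations to quaternions *)

Section Spin.
Context {R : realType}.
Local Notation I := (unitI R).
Implicit Types (w : I -> @SO3 R) (q : 'rV[R]_4).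

Lemma val_SO3 (A : @SO3 R) : SO3 (\val A). Proof. exact: set_mem (valP A). Qed.

Definition spin_lines w (t : I) : 'M[R]_4 := davenport (\val (w t)).

Lemma spin_line w t : line (spin_lines w t).
Proof. exact/davenport_line/val_SO3. Qed.

(** The lift of [w] to the unit quaternions ends at the starting point or at the
    opposite point. *)
Definition spin (odd : bool) w : Prop := exists2 e, lift_path e (spin_lines w) &
  posmul ((-1) ^+ odd *: e zero) (e one).

Lemma continuous_davenport (U : topologicalType) (f : U -> @SO3 R) :
  continuous f -> continuous (fun u => davenport (\val (f u))).
Proof.
move=> cf; have cv : continuous (fun u => \val (f u)).
  by apply: continuous_comp_fun cf _; exact: initial_continuous.
have ce i j : continuous (fun u => (\val (f u) : 'M[R]_3) i j) by exact: cont_entry.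
have ad i j k l : continuous (fun u => (\val (f u) : 'M[R]_3) i j + (\val (f u) : 'M[R]_3) k l).
  exact: cont_add.
have sb i j k l : continuous (fun u => (\val (f u) : 'M[R]_3) i j - (\val (f u) : 'M[R]_3) k l).
  exact: cont_sub.
have one_ad i : continuous (fun u => 1 + (\val (f u) : 'M[R]_3) i i).
  by apply: cont_add => //; exact: cont_cst.
have one_sb i : continuous (fun u => 1 - (\val (f u) : 'M[R]_3) i i).
  by apply: cont_sub => //; exact: cont_cst.
apply: continuous_mx => i j; under eq_fun do rewrite mxE.
have [->|->|->|->] := ord4P i; have [->|->|->|->] := ord4P j => /=;
  [ apply: cont_add; [exact: cont_add|exact: ce]
  | exact: sb | exact: sb | exact: sb | exact: sb
  | apply: cont_sub; [exact: cont_sub|exact: ce]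
  | exact: ad | exact: ad | exact: sb | exact: ad
  | apply: cont_sub; [exact: cont_add|exact: ce]
  | exact: ad | exact: sb | exact: ad | exact: ad
  | apply: cont_add; [exact: cont_sub|exact: ce] ].
Qed.

Lemma spin_homotopic odd w w' : homotopic w w' -> spin odd w -> spin odd w'.
Proof.
move=> [h [ch h0 h1 hz ho]] [e [ce le] e01].
have ch' : continuous (fun z => davenport (\val (h z))) by exact: continuous_davenport.
have le' : lift_path e (fun s => davenport (\val (h (s, zero)))).
  by split=> // s; rewrite h0; exact: le.
have [f [[cf lf] f0 f1]] :=
  lift_homotopy ch' (fun z => davenport_line (val_SO3 (h z))) le' one.
exists f; first by split=> // s; rewrite /spin_lines -h1; exact: lf.
apply: posmul_trans (posmulZ _ (posmul_sym (f0 _))) _.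
  by move=> t; rewrite !hz.
by apply: posmul_trans e01 (f1 _) => t; rewrite !ho.
Qed.

Lemma spin_cat a b w w' : spin a w -> spin b w' -> w one = w' zero ->
  spin (a (+) b) (cat_fun w w').
Proof.
move=> [e le e01] [f lf f01] pq.
have [c c0 fe] : exists2 c : R, c != 0 & e one = c *: f zero.
  apply: (lifts_uniq (spin_line w' zero)); first exact: lf.2.
  by rewrite /spin_lines -pq; exact: le.2.
exists (cat_fun e (fun s => c *: f s)).
  have -> : spin_lines (cat_fun w w') = cat_fun (spin_lines w) (spin_lines w').
    by apply/funext => s; rewrite /spin_lines /cat_fun; case: ifP.
  by apply: lift_path_cat => //; exact: lift_pathZ.
rewrite cat_fun0 cat_fun1 signr_addb; apply: posmul_trans (posmulZ c f01).
rewrite [c *: _]scalerA [c * _]mulrC -(scalerA _ c) -fe [X in X *: _]mulrC -scalerA.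
exact: posmulZ.
Qed.

Lemma spin_ex w : continuous w -> w zero = w one -> exists odd, spin odd w.
Proof.
move=> cw w01; have [e0 _ le0] := spin_line w zero.
have [e le _] := path_lift (continuous_davenport cw) (spin_line w) le0.
have [c c0 ce] : exists2 c : R, c != 0 & e one = c *: e zero.
  apply: (lifts_uniq (spin_line w zero)); first exact: le.2.
  by rewrite /spin_lines w01; exact: le.2.
exists (c < 0), e => //; exists `|c|; first by rewrite normr_gt0.
by rewrite scalerA mulrC -realEsign ?num_real.
Qed.

Lemma davenport1 : lifts (@quat1 R) (davenport 1%:M).
Proof.
exists 4 => //; apply/matrixP => i j; rewrite !mxE big_ord1 !mxE.
by have [->|->|->|->] := ord4P i; have [->|->|->|->] := ord4P j => /=;
  rewrite !mxE /=; ring.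
Qed.

Lemma continuous_rotation (U : topologicalType) (f : U -> 'rV[R]_4) :
  (forall u, f u != 0) -> continuous f -> continuous (fun u => rotation (f u)).
Proof.
move=> f0 cf; have ce k : continuous (fun u => f u 0 k) by exact: cont_entry.
have cs k : continuous (fun u => f u 0 k ^+ 2).
  by under eq_fun do rewrite expr2; exact: cont_mul.
have cm k l : continuous (fun u => f u 0 k * f u 0 l) by exact: cont_mul.
have cn : continuous (fun u => qnorm (f u)).
  by do 3!apply: cont_add => //.
apply: continuous_mx => i j; under eq_fun do rewrite mxE.
apply: cont_mul; last by apply: cont_inv cn => u; rewrite gt_eqF // qnorm_gt0.
have ad k l m n : continuous (fun u => 2 * (f u 0 k * f u 0 l + f u 0 m * f u 0 n)).
  by apply: cont_mul; [exact: cont_cst|exact: cont_add].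
have sb k l m n : continuous (fun u => 2 * (f u 0 k * f u 0 l - f u 0 m * f u 0 n)).
  by apply: cont_mul; [exact: cont_cst|exact: cont_sub].
have [->|->|->] := ord3P i; have [->|->|->] := ord3P j => /=;
  [ apply: cont_sub; [apply: cont_sub; [exact: cont_add|]|]; exact: cs
  | exact: sb | exact: ad | exact: ad
  | apply: cont_sub; [apply: cont_add; [exact: cont_sub|]|]; exact: cs
  | exact: sb | exact: sb | exact: ad
  | apply: cont_add; [apply: cont_sub; [exact: cont_sub|]|]; exact: cs ].
Qed.

Definition SO3_of (A : 'M[R]_3) (hA : SO3 A) : @SO3 R :=
  @exist _ (fun B => B \in @SO3 R) A (mem_set hA).

Lemma even_null_homotopic (w : {path I from @SO3_id R to @SO3_id R}) :
  spin false w -> homotopic w (cst_path (@SO3_id R)).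
Proof.
move=> [e le e01].
have le0 : lifts (e zero) (davenport 1%:M) by have := le.2 zero; rewrite /spin_lines path_zero.
have [c c_neq0 qE] := lifts_uniq (davenport_line (SO3_id_subproof R)) le0 davenport1.
have [d d0 dE] : posmul (@quat1 R) (c *: e one).
  by rewrite qE; apply: posmulZ; move: e01; rewrite expr0 scale1r.
have [cf lf] := lift_pathZ c_neq0 le.
(* The rescaled lift starts at [quat1] but ends at [d] times it. The factor [k], from 1 to [d^-1],
   closes it up, and positive factors do not affect the rotation. *)
pose k (t : I) : R := (1 - ival t) * 1 + ival t * d^-1.
have k0 t : 0 < k t by apply: convex_gt0; rewrite ?invr_gt0 // ival_ge0 ival_le1.
pose f t := k t *: (c *: e t).
have fn0 t : nonzero (f t).
  rewrite /nonzero /= scaler_eq0 gt_eqF //=.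
  exact: line_neq0 (spin_line w t) (lf t).
have cfk : continuous f.
  apply: cont_scalemx => //; apply: cont_add; apply: cont_mul; try exact: cont_cst.
    by apply: cont_sub; [exact: cont_cst|exact: continuous_ival].
  exact: continuous_ival.
have f0 : point (fn0 zero) = point (@quat1_neq0 R).
  by apply: val_inj; rewrite /= /f /k ival0 subr0 mulr1 mul0r addr0 scale1r qE.
have f1 : point (fn0 one) = point (@quat1_neq0 R).
  apply: val_inj; rewrite /= /f /k ival1 subrr mul0r mul1r add0r dE scalerA mulVf.
    by rewrite scale1r.
  by rewrite gt_eqF.
have /pclsP hf := nonzero_simply_connected (mk_path (continuous_point cfk) f0 f1).
pose rho (v : @nonzero R) : @SO3 R := SO3_of (rotation_SO3 (set_mem (valP v))).
have crho : continuous rho.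
  apply: continuous_comp_initial.
  apply: (@continuous_rotation _ (fun v : @nonzero R => \val v)).
    by move=> v; exact: set_mem (valP v).
  exact: initial_continuous.
have := homotopic_comp crho hf; rewrite /mk_path.
have -> : (fun s => rho (point (fn0 s))) = w.
  apply/funext => s; apply: val_inj => /=.
  apply/esym/lifts_rotation/liftsZ; first by rewrite gt_eqF.
  exact: lf.
suff -> : (fun s => rho (cst_path (point quat1_neq0) s)) = (fun _ : I => @SO3_id R) by [].
apply/funext => s; apply: val_inj => /=.
by apply/esym/lifts_rotation/davenport1.
Qed.

Lemma spin_cst : spin false (cst_path (@SO3_id R)).
Proof.
exists (fun=> @quat1 R); last by rewrite expr0 scale1r; exact: posmul_refl.
by split=> [|s]; [exact: cst_continuous|exact: davenport1].
Qed.

End Spin.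

(** * Stereographic projection *)

Section Moebius.
Context {R : realType}.
Implicit Types (r s : 'rV[R]_4) (z : R * R).

(** Stereographic projection carries the rotation of the quaternion
    [(a, b, c, d)] to the Moebius transformation
    [z |-> ((a + i d) z + (- c + i b)) / ((c + i b) z + (a - i d))]. *)
Definition moebius_num r z : R * R :=
  (r 0 k0 * z.1 - r 0 k3 * z.2 - r 0 k2, r 0 k0 * z.2 + r 0 k3 * z.1 + r 0 k1).
Definition moebius_den r z : R * R :=
  (r 0 k2 * z.1 - r 0 k1 * z.2 + r 0 k0, r 0 k2 * z.2 + r 0 k1 * z.1 - r 0 k3).

Definition stereo_pair (v : 'cV[R]_3) : R * R :=
  (v c0 0 / (1 - v c2 0), v c1 0 / (1 - v c2 0)).

Lemma moebius_stereo r z : r != 0 -> z.1 ^+ 2 + z.2 ^+ 2 = 1 ->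
  let v := rotation r *m vec3 z.1 z.2 0 in
  v c2 0 != 1 -> cmul (stereo_pair v) (moebius_den r z) = moebius_num r z.
Proof.
move=> r0 z1 v v1; have n0 := qnorm_gt0 r0.
have nz : qnorm r != 0 by rewrite gt_eqF.
have vE i : qnorm r * v i 0 = rot_entry r i 0 * z.1 + rot_entry r i 1 * z.2.
  rewrite /v mxE sum3 !mxE /= mulr0 addr0.
  by move: nz; move: (qnorm r) (rot_entry r i 0) (rot_entry r i 1) => n ? ? nz; field.
have v0 := vE c0; have v0' := vE c1; have v0'' := vE c2.
have d0 : 1 - v c2 0 != 0 by rewrite subr_eq0 eq_sym.
have key1 : v c0 0 * (moebius_den r z).1 - v c1 0 * (moebius_den r z).2 =
    (1 - v c2 0) * (moebius_num r z).1.
  apply: (mulfI nz); rewrite mulrBr !mulrA v0 v0'.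
  rewrite [qnorm r * (1 - _)]mulrBr v0'' mulr1.
  (* The two sides agree on the unit circle only: their difference is this multiple of its equation.
     The same holds for [key2]. *)
  have : (- qnorm r * r 0 k2) * (z.1 ^+ 2 + z.2 ^+ 2 - 1) = 0 by rewrite z1 subrr mulr0.
  rewrite /moebius_den /moebius_num /qnorm /= => h.
  by apply/eqP; rewrite -subr_eq0 -h; apply/eqP; ring.
have key2 : v c0 0 * (moebius_den r z).2 + v c1 0 * (moebius_den r z).1 =
    (1 - v c2 0) * (moebius_num r z).2.
  apply: (mulfI nz); rewrite mulrDr !mulrA v0 v0'.
  rewrite [qnorm r * (1 - _)]mulrBr v0'' mulr1.
  have : (qnorm r * r 0 k1) * (z.1 ^+ 2 + z.2 ^+ 2 - 1) = 0 by rewrite z1 subrr mulr0.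
  rewrite /moebius_den /moebius_num /qnorm /= => h.
  by apply/eqP; rewrite -subr_eq0 -h; apply/eqP; ring.
rewrite /cmul /stereo_pair /= [RHS]surjective_pairing; congr pair.
  apply: (mulfI d0); rewrite -key1 mulrBr !mulrA.
  by rewrite ![(1 - _) * _ / _]mulrAC mulfV // !mul1r.
apply: (mulfI d0); rewrite -key2 mulrDr !mulrA.
by rewrite ![(1 - _) * _ / _]mulrAC mulfV // !mul1r.
Qed.

(** The norm of the quaternion is the determinant of the Moebius transformation. *)
Lemma moebius_det r z w :
  let m := cmul (moebius_num r z) (moebius_den r w) in
  let m' := cmul (moebius_num r w) (moebius_den r z) in
  (m.1 - m'.1, m.2 - m'.2) = (qnorm r * (z.1 - w.1), qnorm r * (z.2 - w.2)).
Proof.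
by rewrite /cmul /moebius_num /moebius_den /qnorm /=; congr pair; ring.
Qed.

Definition qmul s r : 'rV[R]_4 := \row_(k < 4)
  match k : nat with
  | 0 => s 0 k0 * r 0 k0 - s 0 k1 * r 0 k1 - s 0 k2 * r 0 k2 - s 0 k3 * r 0 k3
  | 1 => s 0 k0 * r 0 k1 + s 0 k1 * r 0 k0 + s 0 k2 * r 0 k3 - s 0 k3 * r 0 k2
  | 2 => s 0 k0 * r 0 k2 - s 0 k1 * r 0 k3 + s 0 k2 * r 0 k0 + s 0 k3 * r 0 k1
  | _ => s 0 k0 * r 0 k3 + s 0 k1 * r 0 k2 - s 0 k2 * r 0 k1 + s 0 k3 * r 0 k0
  end.

Lemma qnorm_qmul s r : qnorm (qmul s r) = qnorm s * qnorm r.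
Proof. by rewrite /qnorm !mxE /=; ring. Qed.

Lemma qmul_neq0 s r : s != 0 -> r != 0 -> qmul s r != 0.
Proof.
move=> /qnorm_gt0 s0 /qnorm_gt0 r0; apply/eqP => h.
have : qnorm (qmul s r) = 0 by rewrite h /qnorm !mxE; ring.
by apply/eqP; rewrite qnorm_qmul gt_eqF // mulr_gt0.
Qed.

Lemma rotation_qmul s r : rotation (qmul s r) = rotation s *m rotation r.
Proof.
apply/matrixP => i j; rewrite mxE [RHS]mxE sum3 ![rotation _ _ _]mxE qnorm_qmul.
have e u v : (\sum_(k < 3) rot_entry s u k * rot_entry r k v) / (qnorm s * qnorm r) =
    \sum_(k < 3) rot_entry s u k / qnorm s * (rot_entry r k v / qnorm r).
  by rewrite mulr_suml; apply: eq_bigr => k _; rewrite invfM mulrACA.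
have := e i j; rewrite !sum3 => <-; congr (_ / _).
by have [->|->|->] := ord3P i; have [->|->|->] := ord3P j;
  rewrite /= !mxE /=; ring.
Qed.

Lemma qmulZ (c : R) s r : qmul s (c *: r) = c *: qmul s r.
Proof.
by apply/rowP => k; rewrite !mxE; have [->|->|->|->] := ord4P k => /=; ring.
Qed.

End Moebius.

Section StereographicParity.
Context {R : realType}.
Local Notation I := (unitI R).

Definition root3 (i : 'I_3) : R * R :=
  match i : nat with
  | 0 => (1, 0) | 1 => (- 2^-1, Num.sqrt 3 / 2) | _ => (- 2^-1, - (Num.sqrt 3 / 2))
  end.

Lemma sqrt3_sq : Num.sqrt 3 ^+ 2 = 3 :> R. Proof. by rewrite sqr_sqrtr. Qed.

Lemma root3_unit i : (root3 i).1 ^+ 2 + (root3 i).2 ^+ 2 = 1.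
Proof.
have := sqrt3_sq.
by have [->|->|->] := ord3P i => /= h; nra.
Qed.

Lemma x0E i : x0 R i = vec3 (root3 i).1 (root3 i).2 0.
Proof. by rewrite /x0; have [->|->|->] := ord3P i. Qed.

Lemma cmul_den (z w d d' m m' : R * R) : cmul z d = m -> cmul w d' = m' ->
  cmul (z.1 - w.1, z.2 - w.2) (cmul d d') =
  ((cmul m d').1 - (cmul m' d).1, (cmul m d').2 - (cmul m' d).2).
Proof. by move=> <- <-; rewrite /cmul /=; congr pair; ring. Qed.

Lemma cmul_reorder (a b c d e f : R * R) :
  cmul (cmul (cmul a b) c) (cmul (cmul (cmul d e) f) (cmul (cmul d e) f)) =
  cmul (cmul (cmul a (cmul d e)) (cmul b (cmul d f))) (cmul c (cmul e f)).
Proof. by rewrite /cmul /=; congr pair; ring. Qed.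

Definition den_product (r : 'rV[R]_4) : R * R :=
  cmul (cmul (moebius_den r (root3 strand0)) (moebius_den r (root3 strand1)))
    (moebius_den r (root3 strand2)).

Lemma stereo_pair_entry (A : 'M[R]_3) i (rho : R) (j : 'I_2) : 0 < rho ->
  let v := A *m x0 R i in
  stereo rho (rho *: v) 0 j = if j == 0 then (stereo_pair v).1 else (stereo_pair v).2.
Proof.
move=> rho0 v; have nz : rho != 0 by rewrite gt_eqF.
rewrite /stereo mxE ![(rho *: v) _ _]mxE.
have -> : ord_max = c2 by exact: val_inj.
have frac (a b : R) : rho * a / (rho - rho * b) = a / (1 - b).
  by rewrite -[X in _ / (X - _)]mulr1 -mulrBr -mulf_div mulfV // mul1r.
rewrite frac /stereo_pair /=; have [->|->] := ord2P j => /=.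
  by rewrite (_ : widen_ord _ _ = c0) //; exact: val_inj.
by rewrite (_ : widen_ord _ _ = c1) //; exact: val_inj.
Qed.

(* The product [E] of the three denominators satisfies [D E^2 = n^3 D0], where [D]
   is the discriminant of the projected points and [D0 = 3 sqrt(3) i]. *)
Lemma discriminant_den (r : 'rV[R]_4) (X : 'M[R]_(3, 2)) : r != 0 ->
  (forall i, (rotation r *m x0 R i) c2 0 != 1) ->
  (forall i, X i 0 = (stereo_pair (rotation r *m x0 R i)).1) ->
  (forall i, X i 1 = (stereo_pair (rotation r *m x0 R i)).2) ->
  cmul (discriminant X) (cmul (den_product r) (den_product r)) =
  (0, qnorm r ^+ 3 * (3 * Num.sqrt 3)).
Proof.
move=> r0 h X0 X1.
have mE i : cmul (X i 0, X i 1) (moebius_den r (root3 i)) = moebius_num r (root3 i).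
  rewrite X0 X1 -surjective_pairing x0E; apply: moebius_stereo => //.
    exact: root3_unit.
  by rewrite -x0E; exact: h.
have dE i j := cmul_den (mE i) (mE j).
rewrite /discriminant /den_product cmul_reorder /strand_diff.
rewrite (dE strand0 strand1) (dE strand0 strand2) (dE strand1 strand2).
rewrite !moebius_det /cmul /=.
have s3 := sqrt3_sq; move: (qnorm r) (Num.sqrt 3) s3 => n s s3.
(* With [j] a primitive cube root of unity, [(1 - j)] times its conjugate is [9/4 + s^2/4], and [j]
   minus its conjugate is [i s]. In this form the identity holds for any [s], so [field] proves
   it. *)
have -> : 3 * s = (9 / 4 + s ^+ 2 / 4) * s by rewrite s3; field.
by congr pair; field.
Qed.

(** With [E] for [den_product r], the hypothesis makes [z] a positive multiple of [i] times the
    square of the conjugate of [E]. As [(1 + i)^2 = 2 i], the product of [1 + i] by that conjugate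
    is a square root up to a positive factor. *)
Lemma lifts_den (r : 'rV[R]_4) (z : R * R) : r != 0 ->
  cmul z (cmul (den_product r) (den_product r)) =
  (0, qnorm r ^+ 3 * (3 * Num.sqrt 3)) ->
  lifts (crow (cmul (1, 1) ((den_product r).1, - (den_product r).2))) (sqrt_mx z).
Proof.
move=> r0; have n0 := qnorm_gt0 r0.
have s0 : 0 < Num.sqrt 3 :> R by rewrite sqrtr_gt0.
set m := qnorm r ^+ 3 * _; have m0 : 0 < m.
  by rewrite !mulr_gt0 // exprn_gt0.
case: (den_product r) z => [a b] [x y] /= h.
have [h1 h2] : (x * (a * a - b * b) - y * (a * b + b * a) = 0) /\
    (x * (a * b + b * a) + y * (a * a - b * b) = m).
  by case: h.
set N := a ^+ 2 + b ^+ 2; have N0 : 0 < N.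
  rewrite lt_def addr_ge0 ?sqr_ge0 // andbT paddr_eq0 ?sqr_ge0 // !sqrf_eq0.
  apply/negP => /andP[/eqP a0 /eqP b0]; move: m0; rewrite -h2 a0 b0.
  by rewrite !(mulr0, addr0, subr0) ltxx.
apply: (@lifts_sqrt _ _ _ (2 * N ^+ 2 / m)).
  by rewrite divr_gt0 // mulr_gt0 // exprn_gt0.
have mz : m != 0 by rewrite gt_eqF.
have xE : N ^+ 2 * x = m * (a * b + b * a).
  transitivity ((x * (a * a - b * b) - y * (a * b + b * a)) * (a * a - b * b) +
    (x * (a * b + b * a) + y * (a * a - b * b)) * (a * b + b * a)).
    by rewrite /N; ring.
  by rewrite h1 h2; ring.
have yE : N ^+ 2 * y = m * (a * a - b * b).
  transitivity ((x * (a * b + b * a) + y * (a * a - b * b)) * (a * a - b * b) -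
    (x * (a * a - b * b) - y * (a * b + b * a)) * (a * b + b * a)).
    by rewrite /N; ring.
  by rewrite h1 h2; ring.
have div u v : N ^+ 2 * u = m * v -> 2 * N ^+ 2 / m * u = 2 * v.
  by move=> uv; rewrite mulrAC -(mulrA 2) uv mulrCA mulrAC mulfV // mul1r.
by rewrite /= (div _ _ xE) (div _ _ yE) /cmul /=; congr pair; ring.
Qed.

Lemma den_productZ (c : R) r : den_product (c *: r) =
  (c ^+ 3 * (den_product r).1, c ^+ 3 * (den_product r).2).
Proof.
have dZ z : moebius_den (c *: r) z =
    (c * (moebius_den r z).1, c * (moebius_den r z).2).
  by rewrite /moebius_den !mxE /=; congr pair; ring.
by rewrite /den_product !dZ /cmul /=; congr pair; ring.
Qed.

Lemma cont_den_product (U : topologicalType) (f : U -> 'rV[R]_4) :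
  continuous f -> continuous (fun u => (den_product (f u)).1) /\
                  continuous (fun u => (den_product (f u)).2).
Proof.
move=> cf; have ce k (c : R) : continuous (fun u => f u 0 k * c).
  by apply: cont_mul; [exact: cont_entry|exact: cont_cst].
have cz k : continuous (fun u => f u 0 k) by exact: cont_entry.
have cd i : continuous (fun u => (moebius_den (f u) (root3 i)).1) /\
    continuous (fun u => (moebius_den (f u) (root3 i)).2).
  split; rewrite /moebius_den /=.
    by apply: cont_add => //; exact: cont_sub.
  by apply: cont_sub => //; exact: cont_add.
have [d1 d2] := cd strand0; have [d3 d4] := cd strand1; have [d5 d6] := cd strand2.
have [e1 e2] := cont_cmul d1 d2 d3 d4; exact: cont_cmul e1 e2 d5 d6.
Qed.

Lemma unit_north (v : 'cV[R]_3) : v^T *m v = 1%:M -> v c2 0 = 1 -> v = north R.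
Proof.
move=> vN v2; have := congr1 (fun M : 'M[R]_1 => M 0 0) vN.
rewrite mxE sum3 !mxE v2 /= => vsq.
have v0 : v c0 0 = 0 by apply/eqP; rewrite -sqrf_eq0 eq_le sqr_ge0 andbT; nra.
have v1 : v c1 0 = 0 by apply/eqP; rewrite -sqrf_eq0 eq_le sqr_ge0 andbT; nra.
by apply/colP => k; rewrite [RHS]mxE; have [->|->|->] := ord3P k.
Qed.

Lemma avoids_north (w : I -> @SO3 R) (g : @SO3 R) i t :
  ray_avoids (\val g *m north R) w ->
  ((\val g)^T *m \val (w t) *m x0 R i) c2 0 != 1.
Proof.
move=> av; apply/eqP => v2.
have [gT _] := val_SO3 g; have [wT _] := val_SO3 (w t).
set v := _ *m x0 R i in v2.
have vN : v^T *m v = 1%:M.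
  rewrite /v !trmx_mul trmxK -!mulmxA (mulmxA (\val g)) gT mul1mx.
  rewrite (mulmxA (\val (w t))^T) (mulmx1C wT) mul1mx x0E.
  apply/matrixP => a b; rewrite !ord1 !mxE sum3 !mxE /= mulr0 addr0 -!expr2.
  exact: root3_unit.
have vE := unit_north vN v2.
apply: (av i t (radius t)).
  by rewrite /radius; have := ival_le1 t; lra.
rewrite /spherical_strand -vE /v; congr (_ *: _).
by rewrite !mulmxA gT mul1mx.
Qed.

Lemma spin_quarter odd (w : {path I from @SO3_id R to @SO3_id R}) (g : @SO3 R)
    (y : Conf R 3) (p : {path I from y to y}) :
  spin odd w -> ray_avoids (\val g *m north R) w ->
  (forall i t, row i (\val (p t)) = projected_strand w g i t) ->
  quarter_turns (2 * odd)%N p.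
Proof.
move=> [e [ce le] e01] av hp.
have gT : SO3 (\val g)^T.
  have [gT dg] := val_SO3 g; split; last by rewrite det_tr.
  by rewrite trmxK; exact: mulmx1C.
(* The quaternion [s] of the inverse of [g] turns the lift of [w] into a lift of the path seen in
   the frame where the ray is vertical. *)
have [s s0 ls] := davenport_line gT.
pose r t := qmul s (e t).
have r0 t : r t != 0 by apply: qmul_neq0 => //; exact: line_neq0 (spin_line w t) (le t).
have rE t : rotation (r t) = (\val g)^T *m \val (w t).
  by rewrite /r rotation_qmul -(lifts_rotation ls) -(lifts_rotation (le t)).
have cr : continuous r.
  have ch k l : continuous (fun t => s 0 k * e t 0 l).
    by apply: cont_mul; [exact: cont_cst|exact: cont_entry].
  apply: continuous_mx => i j; under eq_fun do rewrite mxE.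
  have [->|->|->|->] := ord4P j => /=.
  - by apply: cont_sub => //; apply: cont_sub => //; exact: cont_sub.
  - by apply: cont_sub => //; apply: cont_add => //; exact: cont_add.
  - by apply: cont_add => //; apply: cont_add => //; exact: cont_sub.
  - by apply: cont_add => //; apply: cont_sub => //; exact: cont_add.
have [c1 c2] := cont_den_product cr.
have pE i t (j : 'I_2) : \val (p t) i j = if j == 0
    then (stereo_pair (rotation (r t) *m x0 R i)).1
    else (stereo_pair (rotation (r t) *m x0 R i)).2.
  have rho0 : 0 < radius t by rewrite /radius; have := ival_le1 t; lra.
  rewrite -(stereo_pair_entry _ _ _ rho0) rE.
  have /rowP /(_ j) := hp i t; rewrite mxE => ->.
  by rewrite /projected_strand /spherical_strand -scalemxAr mulmxA.
exists (fun t => crow (cmul (1, 1) ((den_product (r t)).1, - (den_product (r t)).2))).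
  split.
    apply: continuous_mx => i j; under eq_fun do rewrite mxE.
    have [k1' k2'] := @cont_cmul R _ (fun _ : I => (1, 1))
      (fun t => ((den_product (r t)).1, - (den_product (r t)).2))
      (@cont_cst _ _ _) (@cont_cst _ _ _) c1 (cont_opp c2).
    by case: (j == 0).
  move=> t; apply: (lifts_den (r0 t)); apply: (discriminant_den (r0 t)) => i.
  - by rewrite rE; exact: avoids_north.
  - by rewrite pE eqxx.
  - by rewrite pE.
have [d d0 e1] := e01.
(* The factor between the two ends enters [den_product] through its cube, which has the same
   sign. *)
have r1 : r one = (d * (-1) ^+ odd) *: r zero by rewrite /r e1 scalerA qmulZ.
rewrite r1 den_productZ.
exists (d ^+ 3); first exact: exprn_gt0.
case: odd {e01 e1 r1} => /=.
  rewrite muln1 quarter2 mulmxN mulmx1 scalerN -scaleNr.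
  apply/rowP => j; rewrite !mxE /cmul /=; by case: (j == 0); ring.
rewrite muln0 expr0 mulmx1.
by apply/rowP => j; rewrite !mxE /cmul /=; case: (j == 0); ring.
Qed.

End StereographicParity.

(** * The map on the fundamental group *)

Section FundamentalGroup.
Context {R : realType}.
Local Notation I := (unitI R).
Local Notation base := (base R 3).
Implicit Types (a b : pi1_SO3 R) (c : P3_mod_R R).

(** The path [q] is run forth and back. On the way back its reversed lift is used, multiplied by the
    real factor acquired along [p], so only that factor remains. *)
Lemma quarter_conj (odd : bool) (y : Conf R 3) (p : {path I from y to y})
    (q : {path I from base to y}) : quarter_turns (2 * odd)%N p ->
  quarter_turns (2 * odd)%N (cat_path (cat_path q p) (rev_path q)).
Proof.
have Jsign (v : 'rV[R]_2) : v *m @quarter_mx R ^+ (2 * odd)%N = (-1) ^+ odd *: v.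
  case: odd; last by rewrite /= muln0 !expr0 mulmx1 scale1r.
  by rewrite /= muln1 quarter2 mulmxN mulmx1 expr1 scaleN1r.
move=> [f lf [d d0 f01]].
have [e0 _ le0] := disc_mx_line (q zero).
have [e le _] := disc_lift (@continuous_path _ _ _ _ q) le0.
have [c c0 fe] : exists2 c : R, c != 0 & e one = c *: f zero.
  apply: (lifts_uniq (disc_mx_line (p zero))); first exact: lf.2.
  by rewrite path_zero -(path_one (s := q)); exact: le.2.
have s0 : d * (-1) ^+ odd != 0 :> R by rewrite mulf_neq0 ?signr_eq0 // gt_eqF.
have lg := lift_path_cat (lift_path_cat le (lift_pathZ c0 lf) fe)
  (lift_pathZ s0 (lift_path_rev le)).
exists (cat_fun (cat_fun e (fun s => c *: f s))
  (fun s => (d * (-1) ^+ odd) *: rev_fun e s)).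
  have -> : disc_path (cat_path (cat_path q p) (rev_path q)) =
      cat_fun (cat_fun (disc_path q) (disc_path p)) (rev_fun (disc_path q)).
    apply/funext => s; rewrite /disc_path /= /mk_path /cat_fun.
    by case: ifP => // _; case: ifP.
  apply: lg; rewrite cat_fun1 f01 Jsign rev_fun0 fe !scalerA.
  by congr (_ *: _); ring.
rewrite !cat_fun0 cat_fun1 rev_fun1 Jsign; exists d => //.
by rewrite scalerA.
Qed.

Lemma class_loop_homotopic (w w' : {path I from @SO3_id R to @SO3_id R}) :
  homotopic w w' ->
  class_of (loop_pregroup (@SO3_id R)) w = class_of (loop_pregroup (@SO3_id R)) w'.
Proof. by move=> h; apply/class_ofP/asboolP. Qed.

Lemma even_class (w : {path I from @SO3_id R to @SO3_id R}) :
  spin false w -> class_of (loop_pregroup (@SO3_id R)) w = 1%g.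
Proof. by move=> /even_null_homotopic/class_loop_homotopic. Qed.

Lemma class1_even (w : {path I from @SO3_id R to @SO3_id R}) :
  class_of (loop_pregroup (@SO3_id R)) w = 1%g -> spin false w.
Proof.
move=> /class_ofP/asboolP /homotopic_sym h.
exact: spin_homotopic h spin_cst.
Qed.

Lemma spin_unique (w : I -> @SO3 R) : spin true w -> spin false w -> False.
Proof.
move=> [e le e01] [f lf f01].
have [c c0 fe] := lifts_uniq (spin_line w zero) (le.2 zero) (lf.2 zero).
have := lift_path_uniq (spin_line w) (lift_pathZ c0 le) lf.
rewrite fe => /(_ (posmul_refl _)) h.
move: f01; rewrite expr0 scale1r => f01.
have [d d0 /eqP] := posmul_trans (posmulZ c e01) (posmul_trans h (posmul_sym f01)).
rewrite fe expr1 scaleN1r !scalerN -subr_eq0 opprK -{1}[c *: _]scale1r -scalerDl.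
rewrite scaler_eq0 gt_eqF /=; last by rewrite ltr_wpDr // ltW.
rewrite scaler_eq0 (negPf c0) /= => /eqP e0.
by have := line_neq0 (spin_line w zero) (le.2 zero); rewrite e0 eqxx.
Qed.

Lemma loop_spin (w : {path I from @SO3_id R to @SO3_id R}) :
  exists odd, spin odd w.
Proof.
by apply: spin_ex; [exact: continuous_path|rewrite path_zero path_one].
Qed.

(** Signs multiply, and a loop of positive sign is null homotopic. With [a = b] among the cases,
    this bounds the order of the group by two. *)
Lemma pi1_mul_neq1 a b : a <> 1%g -> b <> 1%g -> (a * b)%g = 1%g.
Proof.
rewrite -(class_reprK a) -(class_reprK b); set w := class_repr a; set w' := class_repr b.
have [[] sw] := loop_spin w; last by rewrite (even_class sw).
have [[] sw'] := loop_spin w'; last by rewrite (even_class sw').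
move=> _ _; rewrite -class_ofM; apply: even_class.
by apply: (spin_cat sw sw'); rewrite path_one path_zero.
Qed.

(** The map is defined from the group orders alone; its agreement with stereographic projection is
    the content of [stereo_graph_map]. *)
Definition stereo_map a : P3_mod_R R := if a == 1%g then 1%g else full_twist12.

Lemma stereo_graph_map a c : stereo_graph a c -> c = stereo_map a.
Proof.
move=> [w [g [y [p [q [-> av hp ->]]]]]].
have turn odd : spin odd w ->
    turns (2 * odd)%N (pure_class (cat_path (cat_path q p) (rev_path q))).
  move=> sw; exists (pure_braid (cat_path (cat_path q p) (rev_path q))) => //.
  exact: quarter_conj (spin_quarter sw av hp).
rewrite /stereo_map; have [odd sw] := loop_spin w.
case: eqP => [/class1_even/turn/to_quotient_turns0 //|w1].
case: odd sw => [/turn/to_quotient_turns2 //|/even_class].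
by move/w1.
Qed.

(** * Turns around the vertical axis *)

Section AxialLoop.
Variable odd : bool.

(** This is half the angle of rotation: a full turn lifts to a half circle of quaternions. For [odd]
    false the loop is constant. *)
Definition axial_angle (t : I) : R := odd%:R * pi * ival t.

Definition axial_quat (t : I) : 'rV[R]_4 := \row_(k < 4)
  match k : nat with
  | 0 => cos (axial_angle t) | 3 => sin (axial_angle t) | _ => 0
  end.

Lemma axial_qnorm t : qnorm (axial_quat t) = 1.
Proof. by rewrite /qnorm !mxE /= expr0n !addr0 cos2Dsin2. Qed.

Lemma axial_quat_neq0 t : axial_quat t != 0.
Proof.
apply/eqP => h; have := axial_qnorm t; rewrite h /qnorm !mxE expr0n !addr0 => /eqP.
by rewrite eq_sym oner_eq0.
Qed.

Lemma axial_quat_continuous : continuous axial_quat.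
Proof.
have ca : continuous axial_angle.
  by apply: cont_mul; [exact: cont_cst|exact: continuous_ival].
apply: continuous_mx => i j; under eq_fun do rewrite mxE.
have [->|->|->|->] := ord4P j => /=; try exact: cont_cst.
  exact: continuous_comp_fun ca (@continuous_cos R).
exact: continuous_comp_fun ca (@continuous_sin R).
Qed.

Definition axial (t : I) : @SO3 R := SO3_of (rotation_SO3 (axial_quat_neq0 t)).

Lemma axial_continuous : continuous axial.
Proof.
apply: continuous_comp_initial.
exact: continuous_rotation axial_quat_neq0 axial_quat_continuous.
Qed.

Lemma axial_quat0 : axial_quat zero = @quat1 R.
Proof.
apply/rowP => k; rewrite !mxE /axial_angle ival0 mulr0 cos0 sin0.
by have [->|->|->|->] := ord4P k.
Qed.

Lemma axial_quat1 : axial_quat one = (-1) ^+ odd *: @quat1 R.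
Proof.
apply/rowP => k; rewrite !mxE /axial_angle ival1 mulr1.
case: odd; rewrite ?mul1r ?mul0r ?cospi ?sinpi ?cos0 ?sin0.
  by have [->|->|->|->] := ord4P k => /=; rewrite ?mulr1 ?mulr0.
by have [->|->|->|->] := ord4P k => /=; rewrite ?mulr1 ?mulr0.
Qed.

Lemma rotation_quat1 (s : bool) : rotation ((-1) ^+ s *: @quat1 R) = 1%:M.
Proof.
apply/esym/lifts_rotation/liftsZ; last exact: davenport1.
by rewrite signr_eq0.
Qed.

Lemma axial_zero : axial zero = @SO3_id R.
Proof.
apply: val_inj; rewrite /= axial_quat0 -[quat1]scale1r -(expr0 (-1)).
exact: (rotation_quat1 false).
Qed.

Lemma axial_one : axial one = @SO3_id R.
Proof. by apply: val_inj; rewrite /= axial_quat1 rotation_quat1. Qed.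

Definition axial_loop : {path I from @SO3_id R to @SO3_id R} :=
  mk_path axial_continuous axial_zero axial_one.

Lemma spin_axial : spin odd axial_loop.
Proof.
exists axial_quat; last by rewrite axial_quat0 axial_quat1; exact: posmul_refl.
split=> [|t]; first exact: axial_quat_continuous.
exact/lifts_davenport/axial_quat_neq0.
Qed.

Definition axial_strand (i : 'I_3) (t : I) : 'cV[R]_3 := \val (axial t) *m x0 R i.

Lemma axial_strand_horizontal i t : axial_strand i t c2 0 = 0.
Proof.
by rewrite /axial_strand x0E mxE sum3 !mxE /= !mxE /=; ring.
Qed.

Lemma axial_strand_inj t : injective (axial_strand^~ t).
Proof.
move=> i j /(congr1 (mulmx (\val (axial t))^T)).
have [AT _] := val_SO3 (axial t).
rewrite !mulmxA (mulmx1C AT) !mul1mx !x0E => h.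
have s3 : 0 < Num.sqrt 3 :> R by rewrite sqrtr_gt0.
have := congr1 (fun v : 'cV[R]_3 => v c0 0) h.
have := congr1 (fun v : 'cV[R]_3 => v c1 0) h.
rewrite !mxE /= => {h AT}.
by have [->|->|->] := ord3P i; have [->|->|->] := ord3P j => //= h1 h0;
  exfalso; lra.
Qed.

Definition axial_mx (t : I) : 'M[R]_(3, 2) := \matrix_(i, j)
  if j == 0 then axial_strand i t c0 0 else axial_strand i t c1 0.

Lemma axial_conf t : Conf R 3 (axial_mx t).
Proof.
move=> i j h; apply: (@axial_strand_inj t); apply/colP => k.
have e l : axial_mx t i l = axial_mx t j l.
  by have := congr1 (fun v : 'rV[R]_2 => v 0 l) h; rewrite /= ![row _ _ _ _]mxE.
have := e 0; have := e 1; rewrite ![axial_mx _ _ _]mxE /= => h1 h0.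
by have [->|->|->] := ord3P k => //=; rewrite !axial_strand_horizontal.
Qed.

Definition axial_braid (t : I) : Conf R 3 := point (@axial_conf t).

Lemma axial_braid_continuous : continuous axial_braid.
Proof.
apply: continuous_point; apply: continuous_mx => i j; under eq_fun do rewrite mxE.
have cs k : continuous (fun t => axial_strand i t k 0).
  apply: cont_entry; apply: cont_mulmx; last exact: cst_continuous.
  exact: continuous_rotation axial_quat_neq0 axial_quat_continuous.
by case: (j == 0) => t; exact: cs.
Qed.

Lemma axial_braid_one : axial_braid one = axial_braid zero.
Proof.
apply: val_inj; apply/matrixP => i j; rewrite !mxE /axial_strand.
by rewrite axial_one axial_zero.
Qed.

Definition axial_braid_loop : {path I from axial_braid zero to axial_braid zero} :=
  mk_path axial_braid_continuous erefl axial_braid_one.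

Lemma conf_path_connected (y : Conf R 3) : exists q : {path I from base to y}, True.
Proof.
have [d yd] := in_cell_cover y.
by exists (prepr (branch d \;; seg (conf_cell d) (center_in d) yd)).
Qed.

(** The directions of the strands stay on the equator, so the vertical ray misses them, and
    stereographic projection fixes the points of the equator. *)
Lemma axial_graph : exists c,
  stereo_graph (class_of (loop_pregroup (@SO3_id R)) axial_loop) c.
Proof.
have [q _] := conf_path_connected (axial_braid zero).
eexists; exists axial_loop, (@SO3_id R), (axial_braid zero), axial_braid_loop, q.
have rho0 t : 0 < radius t :> R by rewrite /radius; have := ival_le1 t; lra.
split=> //.
  move=> i t c _ h.
  have h' : radius t *: axial_strand i t = c *: north R.
    by rewrite -[north R]mul1mx -h.
  have := congr1 (fun v : 'cV[R]_3 => v c2 0) h'.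
  rewrite mxE axial_strand_horizontal mulr0 !mxE /= mulr1 => c_0.
  move: h'; rewrite -c_0 scale0r => /eqP; rewrite scaler_eq0 gt_eqF //= => /eqP v0.
  have [AT _] := val_SO3 (axial t).
  have : x0 R i = 0 by rewrite -[LHS]mul1mx -(mulmx1C AT) -mulmxA -[_ *m x0 R i]/(axial_strand i t) v0 mulmx0.
  have := root3_unit (R := R) i; rewrite x0E => u h0.
  have z1 := congr1 (fun v : 'cV[R]_3 => v c0 0) h0.
  have z2 := congr1 (fun v : 'cV[R]_3 => v c1 0) h0.
  rewrite !mxE /= in z1 z2; move: u; rewrite z1 z2 expr0n addr0 => /eqP.
  by rewrite eq_sym oner_eq0.
move=> i t; apply/rowP => j; rewrite mxE.
have := stereo_pair_entry (\val (axial t)) i j (rho0 t).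
rewrite /projected_strand /spherical_strand /= trmx1 mul1mx => ->.
rewrite mxE /stereo_pair -/(axial_strand i t) axial_strand_horizontal subr0 !divr1.
by [].
Qed.

End AxialLoop.

(** A nontrivial class has the same product with the odd axial loop as that loop with itself, hence
    equals its class. *)
Lemma stereo_graph_total a : exists c, stereo_graph a c.
Proof.
have [c0 g0] := axial_graph false; have [c1 g1] := axial_graph true.
have [->|/eqP a1] := eqVneq a 1%g.
  by exists c0; rewrite -(even_class (spin_axial false)).
set b := class_of _ _ in g1; have b1 : b <> 1%g.
  by move=> /class1_even; exact: spin_unique (spin_axial true).
exists c1; suff -> : a = b by [].
have : (a * b)%g = (b * b)%g by rewrite !pi1_mul_neq1.
exact: mulIg.
Qed.

Lemma stereo_map_morph : {morph stereo_map : a b / (a * b)%g >-> (a * b)%g}.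
Proof.
move=> a b; have [->|/eqP a1] := eqVneq a 1%g.
  by rewrite mul1g /stereo_map eqxx mul1g.
have [->|/eqP b1] := eqVneq b 1%g.
  by rewrite mulg1 /stereo_map eqxx mulg1.
rewrite (pi1_mul_neq1 a1 b1) /stereo_map eqxx !ifF; try exact/eqP.
by rewrite full_twist12_involutive.
Qed.

Lemma stereo_map_inj : injective stereo_map.
Proof.
move=> a b; rewrite /stereo_map; have A1 := @full_twist12_neq1 R.
case: eqP => [->|a1]; case: eqP => [->|b1] //.
- by move/esym.
- move=> _; have : (a * b)%g = (b * b)%g by rewrite !pi1_mul_neq1.
  exact: mulIg.
Qed.

End FundamentalGroup.

(** The equivalence says that [stereo_graph] is the graph of a map: every class has a value, and the
    loop, the ray and the identification of the base points do not influence it. *)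
Theorem proposition2 (R : realType) :
  exists f : pi1_SO3 R -> P3_mod_R R,
    [/\ forall a c, stereo_graph a c <-> c = f a,
        {morph f : x y / (x * y)%g >-> (x * y)%g}
      & injective f].
Proof.
exists (@stereo_map R); split; [|exact: stereo_map_morph|exact: stereo_map_inj].
move=> a c; split=> [|->]; first exact: stereo_graph_map.
by have [c' ac'] := stereo_graph_total a; rewrite -(stereo_graph_map ac').
Qed.
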